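(* Let $q\ge 5$ be a prime power with $q\equiv\xi\pmod 3$, $\xi\in\{1,-1\}$, and let $\mathcal O_L$ be the $G_q$-orbit of the line $\ell_L$. For every point type $\mathfrak p\in\{T,3_\Gamma,1_\Gamma,0_\Gamma\}$ let $\pi(\mathfrak p)$ be the plane type given by $\pi(T)=2_{\mathcal C}$, $\pi(3_\Gamma)=3_{\mathcal C}$, $\pi(1_\Gamma)=\overline{1_{\mathcal C}}$, $\pi(0_\Gamma)=0_{\mathcal C}$. Then $\Pi_\Gamma=\Lambda_\Gamma=P_{\mathcal C}=L_{\mathcal C}=0$, and for each such $\mathfrak p$ we have $P_{\mathfrak p}=\Pi_{\pi(\mathfrak p)}$ and $L_{\mathfrak p}=\Lambda_{\pi(\mathfrak p)}$, with the following values (listed as $(P_T,P_{3_\Gamma},P_{1_\Gamma},P_{0_\Gamma};\ L_T,L_{3_\Gamma},L_{1_\Gamma},L_{0_\Gamma})$): (1) $q$ odd, $\xi=-1$: $\big(2,\tfrac{q-5}{6},\tfrac{q-1}{2},\tfrac{q+1}{3};\ q-1,\tfrac{q-5}{2},\tfrac{q-1}{2},\tfrac{q+1}{2}\big)$; (2) $q=2^{2m+1}$ ($\xi=-1$): $\big(1,\tfrac{q-2}{6},\tfrac q2,\tfrac{q+1}{3};\ q-1,q-2,q,q+1\big)$; (3) $q$ odd, $\xi=1$, $2$ a non-cube in $\mathbb F_q$: $\big(1,\tfrac{q-1-\mathcal N_q}{3},\mathcal N_q,\tfrac{2q+1-2\mathcal N_q}{3};\ \tfrac{q-1}{3},\tfrac23(q-1-\mathcal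 N_q),\tfrac23\mathcal N_q,\tfrac{2q+1-2\mathcal N_q}{3}\big)$; (4) $q$ odd, $\xi=1$, $2$ a cube in $\mathbb F_q$: $\big(4,\tfrac{q-7-\mathcal N_q}{3},\mathcal N_q,\tfrac23(q-1-\mathcal N_q);\ \tfrac{q-1}{3},\tfrac{q-7-\mathcal N_q}{6},\tfrac{\mathcal N_q}{6},\tfrac{q-1-\mathcal N_q}{6}\big)$; (5) $q=2^{2m}$ ($\xi=1$): $\big(1,\tfrac13(\tfrac q2-1-(-2)^m),\tfrac q2+(-2)^m,\tfrac13(q+1+(-2)^{m+1});\ \tfrac{q-1}{3},\tfrac23(\tfrac q2-1-(-2)^m),\tfrac23(\tfrac q2+(-2)^m),\tfrac13(q+1+(-2)^{m+1})\big)$.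
   Context: Let $\mathbb F_q$ be the field of order $q$ and $\mathrm{PG}(3,q)$ the projective space with points $\mathbf P(x_0,x_1,x_2,x_3)$. For $t\in\mathbb F_q$ put $P(t)=\mathbf P(t^3,t^2,t,1)$, and $P(\infty)=\mathbf P(1,0,0,0)$; the twisted cubic is $\mathcal C=\{P(t):t\in\mathbb F_q\cup\{\infty\}\}$ and $G_q$ is the group of projectivities of $\mathrm{PG}(3,q)$ fixing $\mathcal C$. Write $\boldsymbol\pi(c_0,c_1,c_2,c_3)$ for the plane $c_0x_0+c_1x_1+c_2x_2+c_3x_3=0$. The osculating plane at $P(t)$ is $\boldsymbol\pi(1,-3t,3t^2,-t^3)$ ($t\in\mathbb F_q$) and $\boldsymbol\pi(0,0,0,1)$ at $P(\infty)$; these $q+1$ planes are the $\Gamma$-planes. The tangent to $\mathcal C$ at $P(t)$, $t\in\mathbb F_q$, is the line through $P(t)$ and $\mathbf P(3t^2,2t,1,0)$; the tangent at $P(\infty)$ is the line through $\mathbf P(1,0,0,0)$ and $\mathbf P(0,1,0,0)$. Plane types: a $d_{\mathcal C}$-plane ($d\in\{0,2,3\}$) is a plane containing exactly $d$ points of $\mathcal C$; a $\overline{1_{\mathcal C}}$-plane is a non-$\Gamma$-plane containing exactly one point of $\mathcal C$; the orbits of $2_{\mathcal C}$-, $3_{\mathcal C}$-, $\overline{1_{\mathcal C}}$-, $0_{\mathcal C}$-planes under $G_q$ have sizes $q^2+q$, $(q^3-q)/6$, $(q^3-q)/2$, $(q^3-q)/3$. Point types (for $q\not\equiv0\pmod 3$):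 $\mathcal C$-points are points of $\mathcal C$; $T$-points are points off $\mathcal C$ on a tangent; for $\mu\in\{0,1,3\}$, $\mu_\Gamma$-points are points off $\mathcal C$ lying in exactly $\mu$ distinct $\Gamma$-planes; the orbits of $T$-, $3_\Gamma$-, $1_\Gamma$-, $0_\Gamma$-points have sizes $q^2+q$, $(q^3-q)/6$, $(q^3-q)/2$, $(q^3-q)/3$. For a $G_q$-orbit $\mathcal O$ of lines: $\Pi_\pi$ is the number of $\pi$-planes through a line of $\mathcal O$; $\Lambda_\pi$ the number of lines of $\mathcal O$ in a $\pi$-plane; $P_{\mathfrak p}$ the number of $\mathfrak p$-points on a line of $\mathcal O$; $L_{\mathfrak p}$ the number of lines of $\mathcal O$ through a $\mathfrak p$-point (each independent of the chosen line/plane/point). Here $\ell_L$ is the line through $\mathbf P(1,0,0,1)$ and $\mathbf P(0,0,1,0)$, $\mathcal O_L$ its $G_q$-orbit. It is known that the lines of $\mathcal O_L$ are external to $\mathcal C$, not in $\Gamma$-planes, neither chords nor axes, and $\#\mathcal O_L$ equals $(q^3-q)/3$ if $\xi=1$ and ($q$ even or $2$ a non-cube), $(q^3-q)/12$ if $\xi=1$, $q$ odd and $2$ a cube, $q^3-q$ if $\xi=-1$, $q$ even, and $(q^3-q)/2$ if $\xi=-1$, $q$ odd. $\mathcal N_q=\#\{\beta\in\mathbb F_q: 1+4\beta^3 \text{ is a non-square in }\mathbb F_q\}$. *)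

(* Defs.v *)
(* PG(3,q) modelled by subspaces of the row space F^4,
   each subspace represented canonically by its generating matrix <<A>>%MS. *)
From HB Require Import structures.
From mathcomp Require Import all_boot all_order all_algebra.
Set Implicit Arguments.
Unset Strict Implicit.
Unset Printing Implicit Defensive.
Import GRing.Theory Num.Theory.
Local Open Scope ring_scope.

Section TwistedCubic.
Variable F : finFieldType.

Definition vec4 (a b c d : F) : 'rV[F]_4 := \row_(i < 4) nth 0 [:: a; b; c; d] i.

Definition pt (v : 'rV[F]_4) : 'M[F]_4 := <<v>>%MS.

Definition subsp (k : nat) : {set 'M[F]_4} :=
  [set M : 'M[F]_4 | (\rank M == k) && (<<M>>%MS == M)].
Definition points := subsp 1.
Definition lines := subsp 2.
Definition planes := subsp 3.

Definition lineThrough (u v : 'rV[F]_4) : 'M[F]_4 := <<col_mx u v>>%MS.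

Definition planeOf (c : 'rV[F]_4) : 'M[F]_4 := <<kermx c^T>>%MS.

(* the twisted cubic: None stands for t = infinity *)
Definition Cpt (o : option F) : 'M[F]_4 :=
  match o with
  | Some t => pt (vec4 (t ^+ 3) (t ^+ 2) t 1)
  | None => pt (vec4 1 0 0 0)
  end.
Definition cubic : {set 'M[F]_4} := [set Cpt o | o : option F].

Definition oscPlane (o : option F) : 'M[F]_4 :=
  match o with
  | Some t => planeOf (vec4 1 (- (3%:R * t)) (3%:R * t ^+ 2) (- t ^+ 3))
  | None => planeOf (vec4 0 0 0 1)
  end.
Definition gammaPlanes : {set 'M[F]_4} := [set oscPlane o | o : option F].

Definition tangent (o : option F) : 'M[F]_4 :=
  match o with
  | Some t => lineThrough (vec4 (t ^+ 3) (t ^+ 2) t 1) (vec4 (3%:R * t ^+ 2) (2%:R * t) 1 0)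
  | None => lineThrough (vec4 1 0 0 0) (vec4 0 1 0 0)
  end.

Definition act (M : 'M[F]_4) (S : 'M[F]_4) : 'M[F]_4 := <<S *m M>>%MS.

Definition Gq : {set 'M[F]_4} :=
  [set M : 'M[F]_4 | (M \in unitmx) && ([set act M P | P in cubic] == cubic)].

Definition lineL : 'M[F]_4 := lineThrough (vec4 1 0 0 1) (vec4 0 0 1 0).
Definition orbitL : {set 'M[F]_4} := [set act M lineL | M in Gq].

Definition nCpts (pi : 'M[F]_4) : nat := #|[set P in cubic | (P <= pi)%MS]|.
Definition isGammaPlane (pi : 'M[F]_4) : bool := pi \in gammaPlanes.
Definition isdCPlane (d : nat) (pi : 'M[F]_4) : bool :=
  (pi \in planes) && (nCpts pi == d).
Definition isbar1CPlane (pi : 'M[F]_4) : bool :=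
  [&& pi \in planes, pi \notin gammaPlanes & nCpts pi == 1%N].

Definition isCPoint (P : 'M[F]_4) : bool := P \in cubic.
Definition isTPoint (P : 'M[F]_4) : bool :=
  [&& P \in points, P \notin cubic & [exists o : option F, (P <= tangent o)%MS]].
Definition isMuGammaPoint (mu : nat) (P : 'M[F]_4) : bool :=
  [&& P \in points, P \notin cubic &
      #|[set pi in gammaPlanes | (P <= pi)%MS]| == mu].

Inductive ptype := pT | p3G | p1G | p0G.

Definition isPtype (p : ptype) : 'M[F]_4 -> bool :=
  match p with
  | pT => isTPoint
  | p3G => isMuGammaPoint 3
  | p1G => isMuGammaPoint 1
  | p0G => isMuGammaPoint 0
  end.

Definition isPlaneTypeOf (p : ptype) : 'M[F]_4 -> bool :=
  match p with
  | pT => isdCPlane 2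
  | p3G => isdCPlane 3
  | p1G => isbar1CPlane
  | p0G => isdCPlane 0
  end.

Definition Pcount (isp : 'M[F]_4 -> bool) (l : 'M[F]_4) : nat :=
  #|[set P in points | isp P && (P <= l)%MS]|.
Definition Picount (ispi : 'M[F]_4 -> bool) (l : 'M[F]_4) : nat :=
  #|[set pi in planes | ispi pi && (l <= pi)%MS]|.
Definition Lcount (P : 'M[F]_4) : nat := #|[set l in orbitL | (P <= l)%MS]|.
Definition Lambdacount (pi : 'M[F]_4) : nat := #|[set l in orbitL | (l <= pi)%MS]|.

Definition Nq : nat :=
  #|[set b : F | ~~ [exists y : F, y ^+ 2 == 1 + 4%:R * b ^+ 3]]|.

Definition hasValues (vP vL : ptype -> rat) : Prop :=
  (forall p l, l \in orbitL ->
      (Pcount (isPtype p) l)%:R = vP p /\ (Picount (isPlaneTypeOf p) l)%:R = vP p)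
  /\ (forall p P, P \in points -> isPtype p P -> (Lcount P)%:R = vL p)
  /\ (forall p pi, pi \in planes -> isPlaneTypeOf p pi -> (Lambdacount pi)%:R = vL p).

End TwistedCubic.

(* Main.v *)
(* Since 3 is invertible, the form x0 y3 - 3 x1 y2 + 3 x2 y1 - x3 y0 defines a null
   polarity sending P(t) to its osculating plane. It commutes with G_q, exchanges the
   point types with the plane types, and fixes l_L because l_L is totally isotropic;
   hence P_p = Pi_pi(p) and L_p = Lambda_pi(p).

   A point is a binary cubic form up to scalars whose roots are the osculating planes
   through it, so the types T, 3, 1, 0 are recorded by the number of distinct roots.
   G_q acts on the forms as PGL(2, q) and is transitive on each type; for forms with
   an irreducible factor of degree 2 or 3 this holds because roots a, b in a common
   extension of that degree satisfy b = (u a + v) / (w a + z) over F_q. Counting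
   incidences gives |type p| L_p = |O_L| P_p, and |O_L| follows from the T-point
   P(0, 0, 1, 0), whose lines in O_L are its joins with the points P(1, 0, 0, k^3).

   On l_L the form of P(1, 0, b, 1) is 1 + 3 b u^2 - u^3. It has a double root iff
   4 b^3 = -1, and forms with a single root correspond to the t such that
   y^2 + y + t^3 has no root y. The number of such t is N_q for q odd; for q even it
   is a cubic exponential sum, evaluated by squaring it and reducing modulo 3. *)

Require Import Defs.
From HB Require Import structures.
From mathcomp Require Import all_boot all_order all_algebra all_field.
From mathcomp Require Import ring lra zify.
Set Implicit Arguments.
Unset Strict Implicit.
Unset Printing Implicit Defensive.
Import GRing.Theory Num.Theory.
Local Open Scope ring_scope.

(** * Subspaces of F^4 *)

(** [Gq] is given only as the set of invertible matrices that permute the cubic, so neither an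
    invariant form nor the isomorphism with PGL(2, q) comes with it. The bridge is that an element
    fixing P(infinity) and P(0) is a scalar multiple of a diagonal symmetric cube; 2-transitivity
    then makes every element a similitude of the form. Orbit sizes are not assumed either. What
    replaces orbit-stabiliser is the identity |O_L| K (n + 1) = q (q + 1) (q - 1), where K is the
    number of cube roots of unity and n + 1 the number of T-points on l_L; so K (n + 1) is the order
    of the stabiliser of l_L. On l_L itself the four point numbers follow from n, the number of
    points with one root, and two linear relations: l_L has q + 1 points, and each of the q + 1
    osculating planes meets it exactly once. The five cases therefore differ only in K, n and the
    one-root number. *)

Section Subspaces.
Variable F : finFieldType.
Implicit Types (A B M N P : 'M[F]_4) (x y : 'rV[F]_4).

Lemma vec4P x : exists a b c d, x = vec4 a b c d.
Proof.
exists (x 0 0), (x 0 1), (x 0 2%:R), (x 0 3%:R); apply/rowP=> i; rewrite mxE.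
by case: i => [[|[|[|[|//]]]] Hi] /=; congr (x _ _); apply: val_inj.
Qed.

Lemma vec4_inj a b c d a' b' c' d' :
  vec4 a b c d = vec4 a' b' c' d' :> 'rV[F]_4 -> [/\ a = a', b = b', c = c' & d = d'].
Proof.
move/rowP=> E; have := E 0; have := E 1; have := E 2%:R; have := E 3%:R.
by rewrite !mxE.
Qed.

Lemma vec4Z k a b c d : k *: vec4 a b c d = vec4 (k * a) (k * b) (k * c) (k * d) :> 'rV[F]_4.
Proof.
apply/rowP=> i; rewrite !mxE.
by case: i => [[|[|[|[|//]]]] Hi].
Qed.

Lemma vec4D a b c d a' b' c' d' :
  vec4 a b c d + vec4 a' b' c' d' = vec4 (a + a') (b + b') (c + c') (d + d') :> 'rV[F]_4.
Proof.
apply/rowP=> i; rewrite !mxE.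
by case: i => [[|[|[|[|//]]]] Hi].
Qed.

Lemma vec4_0 : vec4 0 0 0 0 = 0 :> 'rV[F]_4.
Proof. by apply/rowP=> i; rewrite !mxE; case: i => [[|[|[|[|//]]]] Hi]. Qed.

Lemma vec4_eq0 a b c d :
  (vec4 a b c d == 0 :> 'rV[F]_4) = [&& a == 0, b == 0, c == 0 & d == 0].
Proof.
apply/eqP/and4P=> [|[/eqP-> /eqP-> /eqP-> /eqP->]]; last exact: vec4_0.
by rewrite -vec4_0 => /vec4_inj[-> -> -> ->].
Qed.

Definition mx4 (r0 r1 r2 r3 : 'rV[F]_4) : 'M[F]_4 :=
  \matrix_(i < 4, j < 4) nth 0 [:: r0; r1; r2; r3] i 0 j.

Lemma vec4_mul a b c d r0 r1 r2 r3 :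
  vec4 a b c d *m mx4 r0 r1 r2 r3 = a *: r0 + b *: r1 + c *: r2 + d *: r3.
Proof.
apply/rowP=> j; rewrite !mxE !big_ord_recl big_ord0 !mxE /=.
by rewrite addr0 !addrA.
Qed.

Lemma mx4P M : exists r0 r1 r2 r3, M = mx4 r0 r1 r2 r3.
Proof.
exists (row 0 M), (row 1 M), (row 2%:R M), (row 3%:R M); apply/matrixP=> i j.
rewrite !mxE.
by case: i => [[|[|[|[|//]]]] Hi] /=; rewrite mxE; congr (M _ _); apply: val_inj.
Qed.

Lemma mx4_eq M N :
  (forall a b c d, vec4 a b c d *m M = vec4 a b c d *m N) -> M = N.
Proof.
move=> E; apply/row_matrixP=> i; rewrite !rowE.
by have [a [b [c [d ->]]]] := vec4P (delta_mx 0 i); apply: E.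
Qed.

Lemma sub_ptl x A : (pt x <= A)%MS = (x <= A)%MS.
Proof. by rewrite /pt genmxE. Qed.

Lemma pt_subP x y : reflect (exists k, x = k *: y) (pt x <= pt y)%MS.
Proof. by rewrite sub_ptl /pt genmxE; apply: sub_rVP. Qed.

Lemma rank_pt x : \rank (pt x) = (x != 0).
Proof. by rewrite mxrank_gen rank_rV. Qed.

Lemma pt_points x : (pt x \in points F) = (x != 0).
Proof. by rewrite inE rank_pt genmx_id eqxx andbT eqb1. Qed.

Lemma pointsP P : P \in points F -> exists2 x, x != 0 & P = pt x.
Proof.
rewrite inE => /andP[/eqP rP /eqP gP].
have nzP : P != 0 by rewrite -mxrank_eq0 rP.
exists (nz_row P); first by rewrite nz_row_eq0.
have E : (nz_row P == P)%MS.
  by rewrite -(mxrank_leqif_eq (nz_row_sub P)) rP rank_rV nz_row_eq0 nzP.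
by rewrite -[LHS]gP; apply/esym/genmxP.
Qed.

Lemma pt_eq x y k : k != 0 -> x = k *: y -> pt x = pt y.
Proof. by move=> k0 ->; apply: eq_genmx; apply: eqmx_scale. Qed.

Lemma pt_inj x y : x != 0 -> pt x = pt y -> exists2 k, k != 0 & x = k *: y.
Proof.
move=> x0 E; have /pt_subP[k Ek] : (pt x <= pt y)%MS by rewrite E.
by exists k => //; apply: contraNneq x0 => k0; rewrite Ek k0 scale0r.
Qed.

Lemma genmx_act M A : <<act M A>>%MS = act M A.
Proof. exact: genmx_id. Qed.

Lemma act_comp M N A : act N (act M A) = act (M *m N) A.
Proof. by apply/eq_genmx; rewrite mulmxA; apply/eqmxMr/genmxE. Qed.

Lemma act1 A : <<A>>%MS = A -> act 1%:M A = A.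
Proof. by rewrite /act mulmx1. Qed.

Lemma act_pt M x : act M (pt x) = pt (x *m M).
Proof. by apply/eq_genmx/eqmxMr/genmxE. Qed.

Lemma act_sub M A B : M \in unitmx -> (act M A <= act M B)%MS = (A <= B)%MS.
Proof. by move=> uM; rewrite /act !genmxE submxMfree // row_free_unit. Qed.

(** [act] always returns a canonical matrix, so it can be cancelled only between matrices that are
    canonical themselves. This is why conditions [<<A>>%MS = A] recur throughout. *)
Lemma act_inj M A B : M \in unitmx -> <<A>>%MS = A -> <<B>>%MS = B ->
  act M A = act M B -> A = B.
Proof.
move=> uM gA gB /(congr1 (act (invmx M))).
by rewrite !act_comp mulmxV // !act1.
Qed.

Lemma rank_act M A : M \in unitmx -> \rank (act M A) = \rank A.
Proof. by move=> uM; rewrite mxrank_gen mxrankMfree // row_free_unit. Qed.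

Lemma act_subsp k M A : M \in unitmx -> A \in subsp F k -> act M A \in subsp F k.
Proof.
by move=> uM; rewrite !inE rank_act // genmx_act eqxx andbT => /andP[].
Qed.

Lemma lineThroughP a b x :
  reflect (exists s t, x = s *: a + t *: b) (x <= lineThrough a b)%MS.
Proof.
rewrite genmxE; apply: (iffP submxP) => [[D ->]|[s [t ->]]].
  exists (lsubmx D 0 0), (rsubmx D 0 0); rewrite -{1}[D]hsubmxK.
  by rewrite mul_row_col -!mul_scalar_mx -!mx11_scalar.
by exists (row_mx s%:M t%:M); rewrite mul_row_col !mul_scalar_mx.
Qed.

Lemma act_lineThrough M a b :
  act M (lineThrough a b) = lineThrough (a *m M) (b *m M).
Proof. by apply/eq_genmx; rewrite -mul_col_mx; apply/eqmxMr/genmxE. Qed.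

End Subspaces.

(** * The null polarity of the twisted cubic *)

Section Polarity.
Variable F : finFieldType.
Hypothesis char_neq3 : 3%:R != 0 :> F.
Implicit Types (A B M N P : 'M[F]_4) (x y : 'rV[F]_4).

#[local] Arguments Cpt : simpl never.
#[local] Arguments oscPlane : simpl never.

(* [x *m formJ *m y^T = x0 y3 - 3 x1 y2 + 3 x2 y1 - x3 y0], the symplectic form
   whose null polarity exchanges the point P(t) and the osculating plane at P(t). *)
Definition formJ : 'M[F]_4 :=
  mx4 (vec4 0 0 0 1) (vec4 0 0 (- 3%:R) 0) (vec4 0 3%:R 0 0) (vec4 (-1) 0 0 0).

Definition polar A : 'M[F]_4 := <<kermx (A *m formJ)^T>>%MS.

Lemma vec4_formJ a b c d :
  vec4 a b c d *m formJ = vec4 (- d) (3%:R * c) (- 3%:R * b) a.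
Proof. by rewrite vec4_mul !vec4Z !vec4D; congr vec4; ring. Qed.

Lemma vec4_dot a b c d a' b' c' d' :
  vec4 a b c d *m (vec4 a' b' c' d')^T = (a * a' + b * b' + c * c' + d * d')%:M :> 'M[F]_1.
Proof.
apply/matrixP=> i j; rewrite !ord1 !mxE !big_ord_recl big_ord0 !mxE /=.
by rewrite addr0 !addrA.
Qed.

Lemma formJ_tr : formJ^T = - formJ.
Proof.
apply/matrixP=> i j; rewrite !mxE.
by case: i => [[|[|[|[|//]]]] Hi]; case: j => [[|[|[|[|//]]]] Hj];
  rewrite /= !mxE /= ?oppr0 ?opprK.
Qed.

Lemma formJ_unit : formJ \in unitmx.
Proof.
suff /mulmx1_unit[] : formJ *m mx4 (vec4 0 0 0 (-1)) (vec4 0 0 3%:R^-1 0)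
   (vec4 0 (- 3%:R^-1) 0 0) (vec4 1 0 0 0) = 1%:M by [].
apply: mx4_eq => a b c d.
rewrite mulmxA vec4_formJ vec4_mul mulmx1 !vec4Z !vec4D.
by congr vec4; field; rewrite ?char_neq3.
Qed.

Lemma sub_planeOf m (A : 'M[F]_(m, 4)) (c : 'rV[F]_4) :
  (A <= planeOf c)%MS = (A *m c^T == 0).
Proof. by rewrite genmxE; apply/sub_kermxP/eqP. Qed.

Lemma sub_polar A B : (A <= polar B)%MS = (A *m formJ *m B^T == 0).
Proof.
rewrite genmxE; apply/sub_kermxP/eqP; rewrite trmx_mul formJ_tr mulNmx mulmxN mulmxA.
  by move/eqP; rewrite oppr_eq0 => /eqP.
by move->; rewrite oppr0.
Qed.

(** The form is skew-symmetric, so transposing the vanishing product only changes its sign. *)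
Lemma sub_polarC A B : (A <= polar B)%MS = (B <= polar A)%MS.
Proof.
rewrite !sub_polar -[in LHS]trmx_eq0 !trmx_mul trmxK formJ_tr.
by rewrite mulNmx mulmxN oppr_eq0 mulmxA.
Qed.

Lemma genmx_polar A : <<polar A>>%MS = polar A.
Proof. exact: genmx_id. Qed.

Lemma eq_polar A B : (A :=: B)%MS -> polar A = polar B.
Proof.
move=> E; rewrite -(genmx_polar A) -(genmx_polar B); apply/genmxP.
by apply/andP; split; rewrite sub_polarC; [rewrite -E | rewrite E];
  rewrite sub_polarC.
Qed.

Lemma polar_pt x : polar (pt x) = planeOf (x *m formJ).
Proof.
rewrite /polar /planeOf; apply/genmxP; move: (pt x) (genmxE x : (pt x :=: x)%MS) => P E.
have [[D DP] [D' Dx]] : (exists D, x = D *m P) /\ (exists D, P = D *m x).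
  by split; apply/submxP; rewrite E.
apply/andP; split; apply/sub_kermxP.
  by rewrite DP -mulmxA (trmx_mul D) mulmxA mulmx_ker mul0mx.
by rewrite Dx -mulmxA (trmx_mul D') mulmxA mulmx_ker mul0mx.
Qed.

Lemma rank_polar A : \rank (polar A) = (4 - \rank A)%N.
Proof.
rewrite mxrank_gen mxrank_ker mxrank_tr mxrankMfree //.
by rewrite row_free_unit formJ_unit.
Qed.

(** One inclusion is the symmetry of orthogonality; equality holds by rank because [formJ] is
    invertible, which is where 3 != 0 enters. *)
Lemma polarK A : <<A>>%MS = A -> polar (polar A) = A.
Proof.
move=> gA; rewrite -[RHS]gA -[LHS]genmx_polar; apply/esym/genmxP.
have sA : (A <= polar (polar A))%MS by rewrite sub_polarC.
rewrite -(mxrank_leqif_eq sA) !rank_polar.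
by rewrite subKn // rank_leq_row.
Qed.

Lemma polar_subsp k A : (k <= 4)%N -> A \in subsp F k -> polar A \in subsp F (4 - k).
Proof.
by move=> k4; rewrite !inE rank_polar genmx_polar eqxx andbT => /andP[/eqP-> _].
Qed.

Lemma polar_sub_pt (a b c d a' b' c' d' : F) :
  (pt (vec4 a b c d) <= polar (pt (vec4 a' b' c' d')))%MS =
  (a' * d - 3%:R * b' * c + 3%:R * c' * b - d' * a == 0).
Proof.
rewrite polar_pt sub_ptl sub_planeOf vec4_formJ vec4_dot.
rewrite -scalemx1 scaler_eq0 oner_eq0 orbF; congr (_ == 0); ring.
Qed.

(* The vector [hv u v] spans the point of the cubic with parameter [u / v]. *)
Definition hv (u v : F) : 'rV[F]_4 := vec4 (u ^+ 3) (u ^+ 2 * v) (u * v ^+ 2) (v ^+ 3).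

Lemma hv_eq0 u v : (hv u v == 0) = (u == 0) && (v == 0).
Proof.
rewrite /hv vec4_eq0 (expf_eq0 u 3) (expf_eq0 v 3) /=.
by case: eqP => [->|//]; rewrite mul0r eqxx expr0n /= mul0r eqxx.
Qed.

Lemma hvZ k u v : hv (k * u) (k * v) = k ^+ 3 *: hv u v.
Proof. by rewrite vec4Z; congr vec4; ring. Qed.

Lemma Cpt_some t : Cpt (Some t) = pt (hv t 1).
Proof. by congr (pt (vec4 _ _ _ _)); ring. Qed.

Lemma Cpt_none : Cpt None = pt (hv 1 0).
Proof. by congr (pt (vec4 _ _ _ _)); ring. Qed.

Lemma pt_hv_Cpt u v : (u != 0) || (v != 0) ->
  pt (hv u v) = Cpt (if v == 0 then None else Some (u / v)).
Proof.
case: (eqVneq v 0) => [-> /=|v0 _].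
  rewrite orbF Cpt_none => u0; apply: (@pt_eq _ _ _ (u ^+ 3)).
    by rewrite expf_neq0.
  by rewrite -hvZ; congr hv; ring.
rewrite Cpt_some; apply: (@pt_eq _ _ _ (v ^+ 3)); first by rewrite expf_neq0.
by rewrite -hvZ; congr hv; field.
Qed.

Lemma cubicP P :
  reflect (exists u v, [/\ (u != 0) || (v != 0) & P = pt (hv u v)]) (P \in cubic F).
Proof.
apply: (iffP imsetP) => [[[t|] _ ->]|[u [v [uv ->]]]].
- by exists t, 1; rewrite oner_eq0 orbT Cpt_some.
- by exists 1, 0; rewrite oner_eq0 Cpt_none.
by rewrite pt_hv_Cpt //; eexists; last reflexivity.
Qed.

Lemma Cpt_cubic o : Cpt o \in cubic F.
Proof. exact: imset_f. Qed.

(** From here on, incidence with an osculating plane is evaluated through the form. *)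
Lemma polar_Cpt o : polar (Cpt o) = oscPlane o.
Proof.
have planeZ k c c' : k != 0 -> c = k *: c' -> planeOf c = planeOf c' :> 'M[F]_4.
  move=> k0 ->; apply/genmxP/andP; split; apply/sub_kermxP; last first.
    by rewrite linearZ /= -scalemxAr mulmx_ker scaler0.
  apply/eqP; have := mulmx_ker (k *: c')^T; rewrite linearZ /= -scalemxAr.
  by move/eqP; rewrite scaler_eq0 (negPf k0).
case: o => [t|]; rewrite /Cpt polar_pt vec4_formJ /oscPlane.
  by apply: (planeZ (-1)); rewrite ?oppr_eq0 ?oner_eq0 // vec4Z; congr vec4; ring.
by rewrite oppr0 !mulr0.
Qed.

Lemma Cpt_points o : Cpt o \in points F.
Proof.
by case: o => [t|]; rewrite ?Cpt_some ?Cpt_none pt_points hv_eq0 oner_eq0 ?andbF.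
Qed.

Lemma Cpt_inj : injective (@Cpt F).
Proof.
move=> o o'.
have nz a b c : vec4 a b c 1 != 0 :> 'rV[F]_4 by rewrite vec4_eq0 oner_eq0 !andbF.
have nz' a b c : vec4 1 a b c != 0 :> 'rV[F]_4 by rewrite vec4_eq0 oner_eq0.
case: o o' => [t|] [t'|] //= /pt_inj-/(_ _)[]// k k0; rewrite vec4Z => /vec4_inj[e0 e1 e2 e3].
- by move: e3 e2; rewrite mulr1 => <-; rewrite mul1r => ->.
- by move: e3; rewrite mulr0 => /eqP; rewrite oner_eq0.
- by move: e3; rewrite mulr1 => /esym/eqP; rewrite (negPf k0).
Qed.

Lemma points_genmx k P : P \in subsp F k -> <<P>>%MS = P.
Proof. by rewrite inE => /andP[_ /eqP]. Qed.

Lemma oscPlane_inj : injective (@oscPlane F).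
Proof.
move=> o o'; rewrite -!polar_Cpt => /(congr1 polar).
by rewrite !polarK ?(points_genmx (Cpt_points _)) // => /Cpt_inj.
Qed.

(** Parameters are counted rather than planes or points: both parametrisations being injective, the
    same number counts the Gamma-planes through [P] and the cubic points in [polar P]. *)
Definition nroots P := #|[set o : option F | (P <= oscPlane o)%MS]|.

Lemma nroots_gamma P : #|[set pi in gammaPlanes F | (P <= pi)%MS]| = nroots P.
Proof.
rewrite /nroots -[RHS](card_imset _ oscPlane_inj); apply: eq_card => pi.
rewrite inE; apply/andP/imsetP=> [[/imsetP[o _ ->] Po]|[o]].
  by exists o; rewrite ?inE.
by rewrite inE => Po ->; split=> //; apply: imset_f.
Qed.

Lemma nroots_cubic P : #|[set Q in cubic F | (Q <= polar P)%MS]| = nroots P.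
Proof.
rewrite /nroots -[RHS](card_imset _ Cpt_inj); apply: eq_card => Q.
rewrite inE; apply/andP/imsetP=> [[/imsetP[o _ ->] Po]|[o]].
  by exists o; rewrite ?inE // -polar_Cpt sub_polarC.
by rewrite inE -polar_Cpt => Po ->; split; [apply: imset_f | rewrite sub_polarC].
Qed.

Lemma nCpts_polar P : nCpts (polar P) = nroots P.
Proof. exact: nroots_cubic. Qed.

(** At a finite parameter the cubic form of the point is evaluated; infinity is a root when the
    coefficient of t^3 vanishes. *)
Lemma sub_osc (a b c d : F) o : (pt (vec4 a b c d) <= oscPlane o)%MS =
  if o is Some t then a - 3%:R * b * t + 3%:R * c * t ^+ 2 - d * t ^+ 3 == 0 else d == 0.
Proof.
rewrite -polar_Cpt sub_polarC; case: o => [t|] /=; rewrite polar_sub_pt.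
  by congr (_ == 0); ring.
by rewrite -oppr_eq0; congr (_ == 0); ring.
Qed.

(** A multiplier must be allowed since projectivities fix their matrices only up to scalars;
    orthogonality is unaffected by it. *)
Definition is_similitude M := exists2 k, k != 0 & M *m formJ *m M^T = k *: formJ.

Lemma simil_unit M : is_similitude M -> M \in unitmx.
Proof.
case=> k k0 E; have: M *m (formJ *m M^T *m (k^-1 *: invmx formJ)) = 1%:M.
  rewrite !mulmxA E -scalemxAl -scalemxAr scalerA mulfV // scale1r.
  by rewrite mulmxV // formJ_unit.
by case/mulmx1_unit.
Qed.

Lemma simil_mul M N : is_similitude M -> is_similitude N -> is_similitude (M *m N).
Proof.
case=> k k0 E [l l0 E']; exists (k * l); rewrite ?mulf_neq0 //.
rewrite trmx_mul !mulmxA -(mulmxA M N) -(mulmxA M) E'.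
by rewrite -scalemxAr -scalemxAl E scalerA mulrC.
Qed.

Lemma simil_inv M : is_similitude M -> is_similitude (invmx M).
Proof.
move=> sM; have uM := simil_unit sM; case: sM => k k0 E.
exists k^-1; rewrite ?invr_eq0 //.
have EJ : formJ = k^-1 *: (M *m formJ *m M^T) by rewrite E scalerA mulVf // scale1r.
rewrite {1}EJ -scalemxAr -scalemxAl !mulmxA mulVmx // mul1mx.
by rewrite -mulmxA -trmx_mul mulVmx // trmx1 mulmx1.
Qed.

(** A similitude preserves orthogonality, which gives one inclusion; the two sides have equal
    rank. *)
Lemma polar_act M A : is_similitude M -> <<A>>%MS = A -> polar (act M A) = act M (polar A).
Proof.
move=> sM gA; have uM := simil_unit sM; case: (sM) => k k0 E.
rewrite -[LHS]genmx_polar -[RHS]genmx_act; apply/esym/genmxP.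
have le : (act M (polar A) <= polar (act M A))%MS.
  have -> : polar (act M A) = polar (A *m M) by apply/eq_polar/genmxE.
  rewrite {1}/act genmxE sub_polar trmx_mul.
  rewrite -mulmxA -(mulmxA (polar A)) (mulmxA M) (mulmxA _ M^T) E.
  rewrite -scalemxAl -scalemxAr mulmxA scaler_eq0 (negPf k0) /=.
  by rewrite -sub_polar.
by rewrite -(mxrank_leqif_eq le) (rank_act _ uM) !rank_polar (rank_act _ uM).
Qed.

End Polarity.

(** * The group of the twisted cubic *)

Section CubicGroup.
Variable F : finFieldType.
Hypothesis char_neq3 : 3%:R != 0 :> F.
Hypothesis card_ge5 : (5 <= #|F|)%N.
Implicit Types (A B M N P : 'M[F]_4) (x y : 'rV[F]_4).
#[local] Arguments Cpt : simpl never.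
#[local] Arguments oscPlane : simpl never.

(* The third symmetric power of the Moebius map [t |-> (a t + b) / (c t + d)]. *)
Definition Smat (a b c d : F) : 'M[F]_4 := mx4
  (vec4 (a ^+ 3) (a ^+ 2 * c) (a * c ^+ 2) (c ^+ 3))
  (vec4 (3%:R * a ^+ 2 * b) (a ^+ 2 * d + 2%:R * a * b * c)
        (b * c ^+ 2 + 2%:R * a * c * d) (3%:R * c ^+ 2 * d))
  (vec4 (3%:R * a * b ^+ 2) (b ^+ 2 * c + 2%:R * a * b * d)
        (a * d ^+ 2 + 2%:R * b * c * d) (3%:R * c * d ^+ 2))
  (vec4 (b ^+ 3) (b ^+ 2 * d) (b * d ^+ 2) (d ^+ 3)).

(** This is the determinant of the Moebius map; the determinant of the 4 by 4 matrix is its sixth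
    power. *)
Definition Smat_det (a b c d : F) := a * d - b * c.

Lemma hv_Smat u v a b c d :
  hv u v *m Smat a b c d = hv (a * u + b * v) (c * u + d * v).
Proof. by rewrite vec4_mul !vec4Z !vec4D /hv; congr vec4; ring. Qed.

Lemma tr_mx4 a0 a1 a2 a3 b0 b1 b2 b3 c0 c1 c2 c3 d0 d1 d2 d3 :
  (mx4 (vec4 a0 a1 a2 a3) (vec4 b0 b1 b2 b3) (vec4 c0 c1 c2 c3) (vec4 d0 d1 d2 d3))^T
  = mx4 (vec4 a0 b0 c0 d0) (vec4 a1 b1 c1 d1) (vec4 a2 b2 c2 d2) (vec4 a3 b3 c3 d3)
  :> 'M[F]_4.
Proof.
apply/matrixP=> i j; rewrite !mxE.
by case: i => [[|[|[|[|//]]]] Hi]; case: j => [[|[|[|[|//]]]] Hj]; rewrite /= !mxE.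
Qed.

Lemma simil_Smat a b c d : Smat_det a b c d != 0 -> is_similitude (Smat a b c d).
Proof.
move=> D0; exists (Smat_det a b c d ^+ 3); first by rewrite expf_neq0.
apply: mx4_eq => x y z t; rewrite -scalemxAr vec4_formJ !mulmxA tr_mx4.
rewrite (vec4_mul x y z t) !vec4Z !vec4D vec4_formJ vec4_mul !vec4Z !vec4D.
by rewrite /Smat_det; congr vec4; ring.
Qed.

Lemma Gq_unit M : M \in Gq F -> M \in unitmx.
Proof. by rewrite inE => /andP[]. Qed.

Lemma cubic_genmx P : P \in cubic F -> <<P>>%MS = P.
Proof. by case/imsetP=> o _ ->; apply: points_genmx (Cpt_points o). Qed.

Lemma Gq_cubic M P : M \in Gq F -> <<P>>%MS = P -> (act M P \in cubic F) = (P \in cubic F).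
Proof.
move=> GM gP; have uM := Gq_unit GM; move: GM; rewrite inE => /andP[_ /eqP E].
rewrite -{1}E; apply/imsetP/idP=> [[Q Qc /(act_inj uM gP)->]|Pc]; last by exists P.
  by [].
exact: cubic_genmx.
Qed.

(** An injective map of the finite cubic into itself is already a permutation of it. *)
Lemma GqP M : M \in unitmx ->
  (forall P, P \in cubic F -> act M P \in cubic F) -> M \in Gq F.
Proof.
move=> uM sM; rewrite inE uM /= eqEcard; apply/andP; split.
  by apply/subsetP=> Q /imsetP[P Pc ->]; apply: sM.
rewrite [leqRHS]card_in_imset // => P Q Pc Qc; apply: act_inj => //; exact: cubic_genmx.
Qed.

Lemma Gq_mul M N : M \in Gq F -> N \in Gq F -> M *m N \in Gq F.
Proof.
move=> GM GN; apply: GqP => [|P Pc]; first by rewrite unitmx_mul !Gq_unit.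
by rewrite -act_comp Gq_cubic ?genmx_act // Gq_cubic ?cubic_genmx.
Qed.

Lemma Gq_inv M : M \in Gq F -> invmx M \in Gq F.
Proof.
move=> GM; have uM := Gq_unit GM; apply: GqP => [|P Pc]; first by rewrite unitmx_inv.
by rewrite -(Gq_cubic GM) ?genmx_act // act_comp mulVmx // act1 ?cubic_genmx.
Qed.

Lemma actK M A : M \in Gq F -> <<A>>%MS = A -> act (invmx M) (act M A) = A.
Proof. by move=> GM gA; rewrite act_comp mulmxV ?act1 ?Gq_unit. Qed.

Lemma actKV M A : M \in Gq F -> <<A>>%MS = A -> act M (act (invmx M) A) = A.
Proof. by move=> GM gA; rewrite act_comp mulVmx ?act1 ?Gq_unit. Qed.

Lemma Gq1 : 1%:M \in Gq F.
Proof. by apply: GqP => [|P Pc]; rewrite ?unitmx1 // act1 // cubic_genmx. Qed.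

Lemma act_hv u v a b c d :
  act (Smat a b c d) (pt (hv u v)) = pt (hv (a * u + b * v) (c * u + d * v)).
Proof. by rewrite act_pt hv_Smat. Qed.

Lemma Smat_Gq a b c d : Smat_det a b c d != 0 -> Smat a b c d \in Gq F.
Proof.
move=> D0; apply: GqP => [|P /cubicP[u [v [uv ->]]]].
  exact/(simil_unit char_neq3)/simil_Smat.
apply/cubicP; rewrite act_hv; do 2!eexists; split; last reflexivity.
move: uv; apply: contraTT; rewrite !negb_or !negbK => /andP[/eqP e1 /eqP e2].
(* Cramer's rule recovers [u] and [v], up to the determinant, from the two image coordinates. *)
suff: (Smat_det a b c d * u == 0) && (Smat_det a b c d * v == 0).
  by rewrite !mulf_eq0 (negPf D0).
have -> : Smat_det a b c d * u = d * (a * u + b * v) - b * (c * u + d * v).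
  by rewrite /Smat_det; ring.
have -> : Smat_det a b c d * v = a * (c * u + d * v) - c * (a * u + b * v).
  by rewrite /Smat_det; ring.
by rewrite e1 e2 !mulr0 subrr eqxx.
Qed.

Lemma act_scale k M A : k != 0 -> act (k *: M) A = act M A.
Proof. by move=> k0; apply/eq_genmx; rewrite -scalemxAr; apply: eqmx_scale. Qed.

Lemma pt_hv_neq (u v u' v' : F) : (u != 0) || (v != 0) -> (u' != 0) || (v' != 0) ->
  pt (hv u v) != pt (hv u' v') -> u * v' - u' * v != 0.
Proof.
move=> uv uv'; apply: contraNneq => /eqP; rewrite subr_eq0 => /eqP E.
rewrite !pt_hv_Cpt //; apply/eqP; congr Cpt; move: uv uv' E.
case: (eqVneq v 0) => [->|v0]; case: (eqVneq v' 0) => [->|v0'] //.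
- by rewrite orbF mulr0 => u0 _ /eqP; rewrite mulf_eq0 (negPf u0) (negPf v0').
- by rewrite orbF mulr0 => _ u0 /esym/eqP; rewrite mulf_eq0 (negPf u0) (negPf v0).
by move=> _ _ E; congr Some; apply/eqP; rewrite eqr_div // E mulrC.
Qed.

Lemma Cpt_hvP (o : option F) : exists u v, (u != 0) || (v != 0) /\ Cpt o = pt (hv u v).
Proof. by have /cubicP[u [v []]] := Cpt_cubic o; exists u, v. Qed.

Lemma Smat_two_trans (o1 o2 : option F) : o1 != o2 -> exists a b c d,
  [/\ Smat_det a b c d != 0, act (Smat a b c d) (Cpt o1) = Cpt None &
      act (Smat a b c d) (Cpt o2) = Cpt (Some 0)].
Proof.
move=> ne; have [u1 [v1 [uv1 E1]]] := Cpt_hvP o1; have [u2 [v2 [uv2 E2]]] := Cpt_hvP o2.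
have D0 : u1 * v2 - u2 * v1 != 0.
  by apply: pt_hv_neq => //; rewrite -E1 -E2; apply: contra_neq ne; apply: Cpt_inj.
(* The map t |-> (v2 t - u2) / (v1 t - u1): its denominator vanishes at [o1], its numerator at
   [o2]. *)
exists v2, (- u2), v1, (- u1); split.
- by rewrite /Smat_det -oppr_eq0; congr (_ != 0): D0; ring.
- rewrite E1 act_hv.
  have -> : v1 * u1 + - u1 * v1 = 0 by ring.
  by rewrite pt_hv_Cpt ?eqxx // orbF; congr (_ != 0): D0; ring.
rewrite E2 act_hv.
have -> : v2 * u2 + - u2 * v2 = 0 by ring.
have D1 : v1 * u2 + - u1 * v2 != 0.
  by rewrite -oppr_eq0; congr (_ != 0): D0; ring.
by rewrite pt_hv_Cpt ?D1 ?orbT // (negPf D1) mul0r.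
Qed.

(** A nonzero polynomial of degree at most 3 has at most 3 roots, but q >= 5 leaves at least 4
    nonzero elements. *)
Lemma cubic_vanish (c0 c1 c2 c3 : F) :
  (forall t : F, t != 0 -> c0 + c1 * t + c2 * t ^+ 2 + c3 * t ^+ 3 = 0) ->
  [/\ c0 = 0, c1 = 0, c2 = 0 & c3 = 0].
Proof.
move=> E; pose p := Poly [:: c0; c1; c2; c3].
have p0 : p = 0.
  apply/eqP; apply: contraTT isT => nz.
  have /(max_poly_roots nz) : all (root p) (enum (predC1 (0 : F))).
    apply/allP=> t; rewrite mem_enum inE => t0; apply/rootP.
    by rewrite horner_Poly /= -[RHS](E t t0); ring.
  rewrite enum_uniq => /(_ isT); rewrite -cardE cardC1.
  have : (size p <= 4)%N by apply: size_Poly.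
  move=> h1 h2; have := leq_trans h2 h1.
  by rewrite ltnNge -ltnS prednK ?card_ge5 // (leq_trans _ card_ge5).
have C i : p`_i = [:: c0; c1; c2; c3]`_i by rewrite coef_Poly.
by have:= (C 0%N, C 1%N, C 2, C 3); rewrite p0 !coef0 /= => -[[[]]].
Qed.

(** Two of the quadrics through the twisted cubic; together they suffice to make the matrix in
    [Gq_diag] diagonal. *)
Lemma cubic_rel y : (exists o, pt y = Cpt o) ->
  forall a b c d, y = vec4 a b c d -> a * c = b ^+ 2 /\ b * d = c ^+ 2.
Proof.
case=> o E a b c d Ey; have [u [v [uv Eo]]] := Cpt_hvP o.
have /pt_subP[k] : (pt y <= pt (hv u v))%MS by rewrite E Eo.
by rewrite Ey vec4Z => /vec4_inj[-> -> -> ->]; split; ring.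
Qed.

(* The coordinates p0, ..., p3 of the image of P(t) are cubic polynomials in t, and
   p0 p2 - p1^2 and p1 p3 - p2^2 are t^2 and t times polynomials of degree at most 3
   vanishing on the nonzero elements of F: this is where q >= 5 is needed. *)
Lemma Gq_diag M : M \in Gq F -> act M (Cpt None) = Cpt None ->
  act M (Cpt (Some 0)) = Cpt (Some 0) ->
  exists g k, [/\ g != 0, k != 0 & M = g *: Smat 1 0 0 k].
Proof.
move=> GM f1 f0; have uM := Gq_unit GM.
have [r0 [r1 [r2 [r3 EM]]]] := mx4P M.
have [m00 [m01 [m02 [m03 E0]]]] := vec4P r0; have [m10 [m11 [m12 [m13 E1]]]] := vec4P r1.
have [m20 [m21 [m22 [m23 E2]]]] := vec4P r2; have [m30 [m31 [m32 [m33 E3]]]] := vec4P r3.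
move: EM; rewrite {}E0 {}E1 {}E2 {}E3 => EM.
have vM (x y z t : F) : vec4 x y z t *m M =
    vec4 (x * m00 + y * m10 + z * m20 + t * m30) (x * m01 + y * m11 + z * m21 + t * m31)
         (x * m02 + y * m12 + z * m22 + t * m32) (x * m03 + y * m13 + z * m23 + t * m33).
  by rewrite EM vec4_mul !vec4Z !vec4D.
have nzM a b c d : vec4 a b c d != 0 :> 'rV[F]_4 -> vec4 a b c d *m M != 0.
  by apply: contra_neq => E; rewrite -[LHS](mulmxK uM) E mul0mx.
have [z1 z2 z3 g0] : [/\ m01 = 0, m02 = 0, m03 = 0 & m00 != 0].
  have /pt_subP[k] : (pt (vec4 1 0 0 0 *m M) <= pt (vec4 1 0 0 0))%MS.
    by rewrite -act_pt -/(Cpt None) f1.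
  rewrite vM vec4Z !(mul0r, mul1r, addr0, mulr0) => /vec4_inj[_ e1 e2 e3].
  split=> //; have := nzM 1 0 0 0; rewrite vM !vec4_eq0 e1 e2 e3.
  by rewrite !(mul0r, mul1r, addr0, mulr0) oner_eq0 !eqxx !andbT => /(_ isT).
have [y0 y1 y2 h0] : [/\ m30 = 0, m31 = 0, m32 = 0 & m33 != 0].
  have /pt_subP[k] : (pt (vec4 0 0 0 1 *m M) <= pt (vec4 0 0 0 1))%MS.
    by have := f0; rewrite /Cpt !expr0n /= act_pt => ->.
  rewrite vM vec4Z !(mul0r, mul1r, add0r, mulr0) => /vec4_inj[e0 e1 e2 _].
  split=> //; have := nzM 0 0 0 1; rewrite vM !vec4_eq0 e0 e1 e2.
  by rewrite !(mul0r, mul1r, add0r, mulr0) oner_eq0 !eqxx => /(_ isT).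
subst m01 m02 m03 m30 m31 m32.
have rel t : t != 0 ->
    (t ^+ 3 * m00 + t ^+ 2 * m10 + t * m20) * (t ^+ 2 * m12 + t * m22)
      = (t ^+ 2 * m11 + t * m21) ^+ 2 /\
    (t ^+ 2 * m11 + t * m21) * (t ^+ 2 * m13 + t * m23 + m33)
      = (t ^+ 2 * m12 + t * m22) ^+ 2.
  move=> t0; have /imsetP[o _ Eo] : act M (Cpt (Some t)) \in cubic F.
    by rewrite Gq_cubic ?Cpt_cubic // cubic_genmx ?Cpt_cubic.
  move: Eo; rewrite {1}/Cpt act_pt vM => Eo.
  have [e1 e2] := cubic_rel (ex_intro _ o Eo) erefl.
  by split; [move: e1|move: e2]; rewrite !(mulr0, addr0, add0r, mul1r).
have [a0 a1 a2 a3] : [/\ m20 * m22 - m21 ^+ 2 = 0,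
    m10 * m22 + m20 * m12 - 2%:R * m11 * m21 = 0,
    m00 * m22 + m10 * m12 - m11 ^+ 2 = 0 & m00 * m12 = 0].
  apply: cubic_vanish => t t0; have [e _] := rel t t0.
  apply: (mulfI (expf_neq0 2 t0)); rewrite mulr0.
  by move/eqP: e; rewrite -subr_eq0 => /eqP e; rewrite -[RHS]e; ring.
have [b0 b1 b2 b3] : [/\ m21 * m33 = 0, m11 * m33 + m21 * m23 - m22 ^+ 2 = 0,
    m11 * m23 + m21 * m13 - 2%:R * m12 * m22 = 0 & m11 * m13 - m12 ^+ 2 = 0].
  apply: cubic_vanish => t t0; have [_ e] := rel t t0.
  apply: (mulfI t0); rewrite mulr0.
  by move/eqP: e; rewrite -subr_eq0 => /eqP e; rewrite -[RHS]e; ring.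
have z12 : m12 = 0 by move/eqP: a3; rewrite mulf_eq0 (negPf g0) => /eqP.
have z21 : m21 = 0 by move/eqP: b0; rewrite mulf_eq0 (negPf h0) orbF => /eqP.
subst m12 m21; move: a0 a1 a2 b1 b2 b3 {a3 b0}.
rewrite !(mulr0, mul0r, addr0, expr0n, subr0) /= => a0 a1 a2 b1 b2 b3.
(* If [m22] vanished, [b1] would give [m11 = 0], and the second column of the invertible [M] would
   be zero. *)
have nz22 : m22 != 0.
  apply/eqP=> z22; subst m22; move: b1; rewrite expr0n /= subr0 => /eqP.
  rewrite mulf_eq0 (negPf h0) orbF => /eqP z11; subst m11.
  have [x [y [z [t E]]]] := vec4P (vec4 0 1 0 0 *m invmx M).
  have := vM x y z t; rewrite -E mulmxKV // => /vec4_inj[_ /eqP + _ _].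
  by rewrite !mulr0 !addr0 oner_eq0.
have nz11 : m11 != 0.
  by apply: contraNneq nz22 => z; move: b1; rewrite z mul0r sub0r => /eqP; rewrite oppr_eq0 expf_eq0.
have kill (u v : F) : v != 0 -> u * v = 0 -> u = 0.
  by move=> v0 /eqP; rewrite mulf_eq0 (negPf v0) orbF => /eqP.
have z20 := kill _ _ nz22 a0; have z10 := kill _ _ nz22 a1.
have z23 := kill m23 _ nz11 (etrans (mulrC _ _) b2).
have z13 := kill m13 _ nz11 (etrans (mulrC _ _) b3).
subst m20 m10 m23 m13.
have e22 : m22 = m11 ^+ 2 / m00.
  by move/eqP: a2; rewrite subr_eq0 => /eqP <-; rewrite mulrC mulKf.
have e33 : m33 = m22 ^+ 2 / m11.
  by move/eqP: b1; rewrite subr_eq0 => /eqP <-; rewrite mulrC mulKf.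
(* The relations [a2] and [b1] make the diagonal a geometric progression with first term [m00] and
   this ratio. *)
exists m00, (m11 / m00); split=> //; first by rewrite mulf_neq0 ?invr_eq0.
apply: mx4_eq => x y z t; rewrite vM -scalemxAr vec4_mul !vec4Z !vec4D vec4Z e33 e22.
by congr vec4; field; rewrite ?g0 ?nz11.
Qed.


End CubicGroup.

(** * Point types and numbers of osculating planes *)

Section PointTypes.
Variable F : finFieldType.
Hypothesis char_neq3 : 3%:R != 0 :> F.
Hypothesis card_ge5 : (5 <= #|F|)%N.
Implicit Types (A B M N P : 'M[F]_4).
#[local] Arguments Cpt : simpl never.
#[local] Arguments oscPlane : simpl never.

(** Composing [M] with a suitable [Smat] brings the images of P(infinity) and P(0) back, so
    [Gq_diag] applies to the product. Scalars, [Smat] matrices and their inverses are all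
    similitudes. *)
Lemma Gq_simil M : M \in Gq F -> is_similitude M.
Proof.
move=> GM; have cP o : exists o', act M (Cpt o) = Cpt o'.
  have : act M (Cpt o) \in cubic F by rewrite Gq_cubic ?cubic_genmx ?Cpt_cubic.
  by case/imsetP=> o' _ ->; exists o'.
have [[o1 E1] [o2 E2]] := (cP None, cP (Some 0)).
have ne : o1 != o2.
  apply/eqP=> e12; suff /Cpt_inj : Cpt None = Cpt (Some (0 : F)) by [].
  apply: (@act_inj _ M); rewrite ?Gq_unit ?cubic_genmx ?Cpt_cubic //.
  by rewrite E1 E2 e12.
have [a [b [c [d [D0 F1 F2]]]]] := Smat_two_trans ne; set N := Smat a b c d in F1 F2.
have GN : N \in Gq F by apply: Smat_Gq.
have [] := @Gq_diag _ card_ge5 (M *m N).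
- exact: Gq_mul.
- by rewrite -act_comp E1.
- by rewrite -act_comp E2.
move=> g [k [g0 k0 E]]; rewrite -(mulmxK (Gq_unit GN) M) E.
apply: simil_mul; last by apply: simil_inv => //; apply: simil_Smat.
have [//|l l0 El] := @simil_Smat F 1 0 0 k; first by rewrite /Smat_det mul1r mul0r subr0.
exists (g * g * l); first by rewrite !mulf_neq0.
by rewrite [in LHS]linearZ /= -!scalemxAl -scalemxAr El !scalerA.
Qed.

(** Viewed as cubic points on the polar plane, the roots are permuted by the very definition of
    [Gq], once the polarity commutes with [M]. *)
Lemma nroots_act M P : M \in Gq F -> <<P>>%MS = P -> nroots (act M P) = nroots P.
Proof.
move=> GM gP; rewrite -!nroots_cubic polar_act //; last exact: Gq_simil.
rewrite -[RHS](@card_in_imset _ _ (act M)); last first.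
  move=> Q Q'; rewrite !inE => /andP[Qc _] /andP[Q'c _].
  by apply: act_inj; rewrite ?Gq_unit ?cubic_genmx.
apply: eq_card => Q; rewrite inE; apply/andP/imsetP => [[Qc QP]|[R]].
  have gQ := cubic_genmx Qc; exists (act (invmx M) Q); last by rewrite actKV.
  by rewrite inE -(Gq_cubic GM) ?genmx_act // -(act_sub _ _ (Gq_unit GM)) actKV // Qc.
rewrite inE => /andP[Rc RP] ->.
by rewrite Gq_cubic ?cubic_genmx // act_sub ?Gq_unit.
Qed.

(** The form is 3 t (y t - x), with roots 0 and infinity; the third root x / y merges with one of
    them when [x] or [y] vanishes. *)
Lemma nroots_normal_form (x y : F) : (x != 0) || (y != 0) ->
  nroots (pt (vec4 0 x y 0)) = if (x == 0) || (y == 0) then 2%N else 3%N.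
Proof.
move=> xy; rewrite /nroots.
have root_t t : (pt (vec4 0 x y 0) <= oscPlane (Some t))%MS = (t == 0) || (x == y * t).
  rewrite sub_osc //.
  have -> : 0 - 3%:R * x * t + 3%:R * y * t ^+ 2 - 0 * t ^+ 3 = 3%:R * (t * (y * t - x)).
    by ring.
  by rewrite !mulf_eq0 (negPf char_neq3) subr_eq0 [x == _]eq_sym.
have root_inf : (pt (vec4 0 x y 0) <= oscPlane None)%MS by rewrite sub_osc.
case: ifPn => [|/norP[x0 y0]].
  move=> xy0; suff -> : [set o | (pt (vec4 0 x y 0) <= oscPlane o)%MS] = [set None; Some 0].
    by rewrite cards2.
  apply/setP=> -[t|]; rewrite !inE ?root_inf // root_t /= (inj_eq Some_inj).
  case: (eqVneq t 0) => //= t0; move: xy xy0.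
  case: (eqVneq x 0) => [->|x0] /= y0; last by move/eqP->; rewrite mul0r (negPf x0).
  by rewrite eq_sym mulf_eq0 (negPf y0) (negPf t0).
have -> : [set o | (pt (vec4 0 x y 0) <= oscPlane o)%MS] = None |: [set Some 0; Some (x / y)].
  apply/setP=> -[t|]; rewrite !inE ?root_inf // root_t /= !(inj_eq Some_inj).
  by congr (_ || _); apply/eqP/eqP => ->; field.
rewrite cardsU1 cards2 !inE /= (inj_eq Some_inj) eq_sym mulf_eq0 invr_eq0.
by rewrite (negPf x0) (negPf y0).
Qed.

(** Moving the two roots to infinity and 0 kills the last and the first coordinate. *)
Lemma two_roots_normal_form P o1 o2 : P \in points F -> o1 != o2 ->
  (P <= oscPlane o1)%MS -> (P <= oscPlane o2)%MS ->
  exists2 M, M \in Gq F & exists x y, (x != 0) || (y != 0) /\ act M P = pt (vec4 0 x y 0).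
Proof.
move=> Pp ne P1 P2; have [a [b [c [d [D0 F1 F2]]]]] := Smat_two_trans ne.
have GN := Smat_Gq char_neq3 D0; exists (Smat a b c d) => //.
have uN := Gq_unit GN; have sN := simil_Smat D0.
have : act (Smat a b c d) P \in points F by apply: act_subsp.
case/pointsP=> v; have [x0 [x [y [x3 ->]]]] := vec4P v => nz E.
have move_root o o' : act (Smat a b c d) (Cpt o) = Cpt o' -> (P <= oscPlane o)%MS ->
    (pt (vec4 x0 x y x3) <= oscPlane o')%MS.
  move=> Eo; rewrite -E -!polar_Cpt // -Eo polar_act ?(cubic_genmx (Cpt_cubic _)) //.
  by rewrite act_sub.
have := move_root _ _ F1 P1; have := move_root _ _ F2 P2.
rewrite !sub_osc // !expr0n /= !mulr0 !subr0 addr0 => /eqP z0 /eqP z3; subst x0 x3.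
by move: nz; rewrite vec4_eq0 eqxx /= andbT negb_and => nz; exists x, y; split.
Qed.

Lemma Gq_scaling (k : F) : k != 0 -> Smat 1 0 0 k \in Gq F.
Proof. by move=> k0; apply: Smat_Gq; rewrite // /Smat_det mul1r mul0r subr0. Qed.

Lemma scaling_vec4 (k a b c d : F) :
  vec4 a b c d *m Smat 1 0 0 k = vec4 a (k * b) (k ^+ 2 * c) (k ^+ 3 * d).
Proof. by rewrite vec4_mul !vec4Z !vec4D; congr vec4; ring. Qed.

Lemma Gq_swap : Smat 0 1 1 0 \in Gq F.
Proof. by apply: Smat_Gq; rewrite // /Smat_det mul1r mul0r sub0r oppr_eq0 oner_eq0. Qed.

Lemma swap_vec4 (a b c d : F) : vec4 a b c d *m Smat 0 1 1 0 = vec4 d c b a.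
Proof. by rewrite vec4_mul !vec4Z !vec4D; congr vec4; ring. Qed.

Lemma two_rootsP P : (2 <= nroots P)%N -> exists o1 o2,
  [/\ o1 != o2, (P <= oscPlane o1)%MS & (P <= oscPlane o2)%MS].
Proof.
by rewrite /nroots => /card_gt1P[o1 [o2 []]]; rewrite !inE => h1 h2 ne; exists o1, o2.
Qed.

Lemma nroots_ge2_orbit P : P \in points F -> (2 <= nroots P)%N ->
  (nroots P = 2%N /\ exists2 M, M \in Gq F & act M P = pt (vec4 0 0 1 0)) \/
  (nroots P = 3%N /\ exists2 M, M \in Gq F & act M P = pt (vec4 0 1 1 0)).
Proof.
move=> Pp /two_rootsP[o1 [o2 [ne P1 P2]]].
have [M GM [x [y [xy E]]]] := two_roots_normal_form Pp ne P1 P2.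
have rP : nroots P = if (x == 0) || (y == 0) then 2%N else 3%N.
  by rewrite -(nroots_normal_form xy) -E nroots_act ?(points_genmx Pp).
case: (eqVneq x 0) xy rP E => [->|x0] /=.
  move=> y0 -> E; left; split=> //; exists M => //.
  by rewrite E; apply: (pt_eq y0); rewrite vec4Z mulr0 mulr1.
move=> _; case: (eqVneq y 0) => [->|y0] -> E; [left|right]; split=> //.
  exists (M *m Smat 0 1 1 0); first exact: Gq_mul GM Gq_swap.
  rewrite -act_comp E act_pt swap_vec4.
  by apply: (pt_eq x0); rewrite vec4Z mulr0 mulr1.
(* Scaling by x / y multiplies [x] by x / y and [y] by its square, so that both become x^2 / y. *)
have xy0 : x / y != 0 by rewrite mulf_neq0 ?invr_eq0.
exists (M *m Smat 1 0 0 (x / y)); first exact: Gq_mul GM (Gq_scaling xy0).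
rewrite -act_comp E act_pt scaling_vec4.
apply: (@pt_eq _ _ _ (x ^+ 2 / y)); first by rewrite mulf_neq0 ?invr_eq0 ?expf_neq0.
by rewrite vec4Z; congr vec4; field.
Qed.

Lemma nroots_le3 P : P \in points F -> (nroots P <= 3)%N.
Proof.
move=> Pp; case: (leqP 2 (nroots P)) => [/(nroots_ge2_orbit Pp)|/ltnW/leq_trans->//].
by case=> -[-> _].
Qed.

(** The form of a cubic point is a perfect cube. Root number 1 thus covers the cubic points too, and
    being off the cubic has to be recorded separately for that type. *)
Lemma nroots_Cpt (o : option F) : nroots (Cpt o) = 1%N.
Proof.
have E (t : F) : nroots (Cpt (Some t)) = 1%N.
  rewrite /nroots; apply/eqP/cards1P; exists (Some t); apply/setP=> o'.
  rewrite !inE Cpt_some sub_osc //; case: o' => [u|]; last by rewrite expr1n oner_eq0.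
  have -> : t ^+ 3 - 3%:R * (t ^+ 2 * 1) * u + 3%:R * (t * 1 ^+ 2) * u ^+ 2 - 1 ^+ 3 * u ^+ 3
    = (t - u) ^+ 3 by ring.
  by rewrite expf_eq0 /= subr_eq0 (inj_eq Some_inj) eq_sym.
case: o => [//|]; rewrite -(E 0) -(nroots_act Gq_swap) ?(cubic_genmx (Cpt_cubic _)) //.
by rewrite /Cpt act_pt swap_vec4; congr (nroots (pt (vec4 _ _ _ _))); ring.
Qed.

Lemma nroots_tangent P o : P \in points F -> P \notin cubic F -> (P <= tangent o)%MS ->
  nroots P = 2%N.
Proof.
move=> /pointsP[x x0 ->]; rewrite sub_ptl => nC.
case: o nC => [t|] nC /lineThroughP[s [r Ex]].
  have r0 : r != 0.
    apply: contraNneq nC => r0; apply/imsetP; exists (Some t) => //.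
    apply: (@pt_eq _ _ _ s); last by rewrite Ex r0 scale0r addr0.
    by apply: contraNneq x0 => s0; rewrite Ex s0 r0 !scale0r addr0.
  rewrite /nroots Ex !vec4Z vec4D.
  (* The form of s P(t) + r P'(t) is (t - u)^2 (s (t - u) + 3 r); this is its simple root, infinite
     when s = 0. *)
  set o2 := if s == 0 then None else Some (t + 3%:R * r / s).
  transitivity #|[set Some t; o2]|; last first.
    rewrite cards2 /o2; case: (eqVneq s 0) => // s0; rewrite (inj_eq Some_inj).
    rewrite -[X in X == _]addr0 (inj_eq (addrI _)) eq_sym !mulf_eq0 invr_eq0.
    by rewrite (negPf s0) (negPf r0) (negPf char_neq3).
  apply: eq_card => o; rewrite !inE sub_osc // /o2; case: o => [u|]; last first.
    by rewrite mulr1 mulr0 addr0; case: eqP.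
  rewrite !(inj_eq Some_inj).
  rewrite (_ : _ - _ = (t - u) ^+ 2 * (s * (t - u) + 3%:R * r)); last by ring.
  rewrite mulf_eq0 expf_eq0 /= subr_eq0 eq_sym; congr (_ || _).
  case: (eqVneq s 0) => [->|s0] /=.
    by rewrite mul0r add0r mulf_eq0 (negPf r0) (negPf char_neq3).
  rewrite (inj_eq Some_inj).
  have -> : s * (t - u) + 3%:R * r = s * ((t + 3%:R * r / s) - u) by field.
  by rewrite mulf_eq0 (negPf s0) subr_eq0 eq_sym.
have r0 : r != 0.
  apply: contraNneq nC => r0; apply/imsetP; exists None => //.
  apply: (@pt_eq _ _ _ s); last by rewrite Ex r0 scale0r addr0.
  by apply: contraNneq x0 => s0; rewrite Ex s0 r0 !scale0r addr0.
rewrite /nroots Ex !vec4Z vec4D !(mulr1, mulr0, addr0, add0r).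
suff -> : [set o | (pt (vec4 s r 0 0) <= oscPlane o)%MS] = [set None; Some (s / (3%:R * r))].
  by rewrite cards2.
apply/setP=> o; rewrite !inE sub_osc //; case: o => [u|]; last by rewrite !eqxx.
rewrite (inj_eq Some_inj) mulr0 !mul0r addr0 subr0 subr_eq0 /= eq_sym mulrC.
by rewrite (can2_eq (mulfK _) (mulfVK _)) // mulf_neq0.
Qed.

(** By Vieta the third root of the form is again rational, so it repeats one of the two given roots;
    the point lies on the tangent at the repeated root. *)
Lemma nroots2_tangent P : P \in points F -> nroots P = 2%N -> exists o, (P <= tangent o)%MS.
Proof.
case/pointsP=> v _ ->; have [x0 [x1 [x2 [x3 ->]]]] := vec4P v.
move/eqP/cards2P=> [o1 [o2 [ne /setP E]]].
pose f t := x0 - 3%:R * x1 * t + 3%:R * x2 * t ^+ 2 - x3 * t ^+ 3.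
have Ef t : (f t == 0) = (Some t \in [set o1; o2]) by rewrite -E inE sub_osc.
have Ei : (x3 == 0) = (None \in [set o1; o2]) by rewrite -E inE sub_osc.
(* Two finite roots with [t] double: the last hypothesis is Vieta's formula for the sum of the
   roots. *)
have dbl (t u : F) : t != u -> f t = 0 -> f u = 0 -> 3%:R * x2 = x3 * (2%:R * t + u) ->
    exists o, (pt (vec4 x0 x1 x2 x3) <= tangent o)%MS.
  move=> tu ft fu e2.
  have {}e2 : x2 = x3 * (2%:R * t + u) / 3%:R by rewrite -e2 mulrC mulKf.
  have e1 : x1 = x3 * (t ^+ 2 + 2%:R * t * u) / 3%:R.
    apply: (@mulfI _ (3%:R * (u - t))); first by rewrite mulf_neq0 // subr_eq0 eq_sym.
    transitivity (f t - f u - 3%:R * x2 * (t ^+ 2 - u ^+ 2) + x3 * (t ^+ 3 - u ^+ 3)).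
      by rewrite /f; ring.
    by rewrite ft fu e2; field.
  have e0 : x0 = x3 * t ^+ 2 * u.
    transitivity (f t + 3%:R * x1 * t - 3%:R * x2 * t ^+ 2 + x3 * t ^+ 3).
      by rewrite /f; ring.
    by rewrite ft e1 e2; field.
  exists (Some t); rewrite sub_ptl; apply/lineThroughP; exists x3, (x2 - t * x3).
  by rewrite !vec4Z vec4D e0 e1 e2; congr vec4; field.
(* One root at infinity: it is the double one if x2 = 0; otherwise the quadratic has root sum x1 /
   x2, and uniqueness makes [t] double. *)
have inf t : x3 = 0 -> f t = 0 -> (forall u, f u = 0 -> u = t) ->
    exists o, (pt (vec4 x0 x1 x2 x3) <= tangent o)%MS.
  move=> z3 ft uniq; subst x3.
  case: (eqVneq x2 0) => [->|nz2].
    exists None; rewrite sub_ptl; apply/lineThroughP; exists x0, x1.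
    by rewrite !vec4Z vec4D; congr vec4; ring.
  have e0 : x0 = 3%:R * x1 * t - 3%:R * x2 * t ^+ 2.
    by rewrite -[LHS](subr0) -ft /f; ring.
  have e1 : x1 = 2%:R * t * x2.
    have /uniq e : f (x1 / x2 - t) = 0 by rewrite /f e0; field.
    have -> : x1 = (x1 / x2 - t + t) * x2 by rewrite subrK divfK.
    by rewrite e; ring.
  exists (Some t); rewrite sub_ptl; apply/lineThroughP; exists 0, x2.
  by rewrite !vec4Z vec4D e0 e1; congr vec4; ring.
have fP t : f t = 0 <-> (Some t == o1) || (Some t == o2).
  by split=> [/eqP|h]; [rewrite Ef !inE | apply/eqP; rewrite Ef !inE].
case: o1 o2 ne fP Ei {E Ef} => [t|] [u|] // ne fP Ei.
- have [ft fu] : f t = 0 /\ f u = 0 by split; apply/fP; rewrite eqxx ?orbT.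
  have tu : t != u by rewrite -(inj_eq Some_inj).
  have nz3 : x3 != 0 by rewrite Ei !inE.
  have e1 : x1 = x2 * (t + u) - x3 * (t ^+ 2 + t * u + u ^+ 2) / 3%:R.
    apply: (@mulfI _ (3%:R * (u - t))); first by rewrite mulf_neq0 // subr_eq0 eq_sym.
    transitivity (f t - f u - 3%:R * x2 * (t ^+ 2 - u ^+ 2) + x3 * (t ^+ 3 - u ^+ 3)).
      by rewrite /f; ring.
    by rewrite ft fu; field.
  have e0 : x0 = 3%:R * x1 * t - 3%:R * x2 * t ^+ 2 + x3 * t ^+ 3.
    by rewrite -[LHS](subr0) -ft /f; ring.
  have : f (3%:R * x2 / x3 - t - u) = 0 by rewrite /f e0 e1; field; rewrite ?nz3.
  case/fP/orP; rewrite (inj_eq Some_inj) => /eqP e.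
    apply: (dbl t u) => //; have -> : 3%:R * x2 = x3 * ((3%:R * x2 / x3 - t - u) + t + u).
      by field.
    by rewrite e; ring.
  apply: (dbl u t); rewrite 1?eq_sym //.
  have -> : 3%:R * x2 = x3 * ((3%:R * x2 / x3 - t - u) + t + u) by field.
  by rewrite e; ring.
- apply: (inf t); first by apply/eqP; rewrite Ei !inE.
    by apply/fP; rewrite eqxx.
  by move=> w /fP; rewrite orbF (inj_eq Some_inj) => /eqP.
apply: (inf u); first by apply/eqP; rewrite Ei !inE.
  by apply/fP; rewrite eqxx.
by move=> w /fP /=; rewrite (inj_eq Some_inj) => /eqP.
Qed.

Definition ptype_nroots p : nat :=
  (match p with pT => 2 | p3G => 3 | p1G => 1 | p0G => 0 end)%N.

Lemma isPtypeE p P : isPtype p P =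
  [&& P \in points F, P \notin cubic F & nroots P == ptype_nroots p].
Proof.
case: p => /=; [| by rewrite /isMuGammaPoint nroots_gamma ..].
rewrite /isTPoint; case Pp: (P \in points F) => //=; case nC: (P \in cubic F) => //=.
apply/existsP/eqP => [[o Po]|]; last exact: nroots2_tangent.
by apply: nroots_tangent Po; rewrite ?nC.
Qed.

Lemma isPtype_act p M P : M \in Gq F -> P \in points F ->
  isPtype p (act M P) = isPtype p P.
Proof.
move=> GM Pp; have gP := points_genmx Pp.
by rewrite !isPtypeE nroots_act // Gq_cubic // (act_subsp (Gq_unit GM) Pp) Pp.
Qed.

Lemma polar_gamma P : P \in points F -> (polar P \in gammaPlanes F) = (P \in cubic F).
Proof.
move=> Pp; apply/imsetP/imsetP => [[o _]|[o _ ->]]; last first.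
  by exists o => //; apply: polar_Cpt.
rewrite -polar_Cpt // => /(congr1 (@polar F)).
rewrite !polarK ?(points_genmx Pp) ?(cubic_genmx (Cpt_cubic _)) // => ->.
by exists o.
Qed.

(** For root numbers 0, 2 and 3 the point is off the cubic by [nroots_Cpt]; for root number 1 the
    condition of not being a Gamma-plane says so. *)
Lemma isPlaneType_polar p P : P \in points F -> isPlaneTypeOf p (polar P) = isPtype p P.
Proof.
move=> Pp; rewrite isPtypeE Pp /=.
have pp : polar P \in planes F by apply: (polar_subsp char_neq3 _ Pp).
have nC : nroots P != 1%N -> P \notin cubic F.
  by apply: contraNN => /imsetP[o _ ->]; rewrite nroots_Cpt.
case: p => /=; rewrite /isdCPlane /isbar1CPlane pp nCpts_polar //= ?polar_gamma //;
  by case: eqP => [E|]; rewrite ?andbF // nC ?E.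
Qed.

End PointTypes.

(** * Roots in a common extension *)

Section CommonExtension.
Variable F : finFieldType.
Implicit Types (p g h : {poly F}).

Lemma irreducible_root_dvdp (K : fieldExtType F) g h (b : K) :
  irreducible_poly g -> root (map_poly (in_alg K) g) b ->
  root (map_poly (in_alg K) h) b -> g %| h.
Proof.
move=> [g1 irr] rg rh; apply/negPn/negP => ndvd.
have cop : coprimep g h.
  rewrite /coprimep; apply/negPn/negP => /(irr _)/(_ (dvdp_gcdl _ _)) E.
  by case/negP: ndvd; rewrite -(eqp_dvdl _ E) dvdp_gcdr.
rewrite -(coprimep_map (in_alg K)) in cop.
by have := coprimep_root cop rg; rewrite -/(root _ _) rh.
Qed.

Lemma irreducible_root_eq0 (K : fieldExtType F) g h (b : K) :
  irreducible_poly g -> root (map_poly (in_alg K) g) b -> (size h < size g)%N ->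
  root (map_poly (in_alg K) h) b -> h = 0.
Proof.
move=> irr rg sz /(irreducible_root_dvdp irr rg) dvd.
by apply/eqP; apply: contraTT sz => h0; rewrite -leqNgt dvdp_leq.
Qed.

(** With Q = q ^ deg g, Fermat's little theorem in the field obtained by adjoining a root of [g]
    shows that [g] divides X^Q - X, and this polynomial splits into linear factors over [K], which
    has Q elements. *)
Lemma irreducible_has_root (K : fieldExtType F) g :
  irreducible_poly g -> \dim {:K} = (size g).-1 ->
  exists b : K, root (map_poly (in_alg K) g) b.
Proof.
move=> irr dimK; have [L dimL [b rb _]] := irredp_FAdjoin irr.
set Q := (#|F| ^ (size g).-1)%N.
have mapXQ (E : fieldExtType F) :
    map_poly (in_alg E) ('X^Q - 'X) = 'X^Q - 'X by rewrite rmorphB rmorphXn /= !map_polyX.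
have dvd : g %| 'X^Q - 'X.
  apply: (irreducible_root_dvdp irr rb); rewrite mapXQ rootE !hornerE.
  have : b \in {:L}%VS by rewrite memvf.
  rewrite (Fermat's_little_theorem {:L}%AS) dimL => /eqP ->.
  by rewrite subrr.
have dvdK : map_poly (in_alg K) g %| 'X^Q - 'X by rewrite -mapXQ dvdp_map.
have cardK : #|finvect_type K| = Q.
  have := @card_vspace F (finvect_type K) _ (fullv : {vspace (finvect_type K : vectType F)}).
  by rewrite card_vspacef => ->; rewrite /Q -dimK.
have split : 'X^Q - 'X = \prod_(x : finvect_type K) ('X - x%:P) :> {poly finvect_type K}.
  by rewrite -finField_genPoly cardK.
have dvdE : (map_poly (in_alg K) g : {poly finvect_type K}) %|
    \prod_(x : finvect_type K) ('X - x%:P) by rewrite -split; exact: dvdK.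
have [m E] := dvdp_prod_XsubC dvdE.
have sz : size (map_poly (in_alg K) g) = size g by apply: size_map_poly.
case Es : (mask m (index_enum _)) E => [|z s] E.
  have := eqp_size E; rewrite big_nil size_poly1 => E1.
  by case: irr; rewrite -sz E1.
exists z; have : root (\prod_(x <- z :: s) ('X - x%:P)) z.
  by rewrite root_prod_XsubC mem_head.
by rewrite -(eqp_root E).
Qed.

Lemma lin_dep (K : fieldExtType F) n (X : 'I_n -> K) : (\dim {:K} < n)%N ->
  exists2 v : 'rV[F]_n, v != 0 & \sum_i v 0 i *: X i = 0.
Proof.
move=> lt; set B := vbasis {:K}.
pose A := \matrix_(i < n, j < \dim {:K}) coord B j (X i).
have k0 : kermx A != 0.
  rewrite -mxrank_eq0 mxrank_ker subn_eq0 -ltnNge.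
  exact: leq_ltn_trans (rank_leq_col _) _.
exists (nz_row (kermx A)); first by rewrite nz_row_eq0.
have vA0 : nz_row (kermx A) *m A = 0 by apply/sub_kermxP/nz_row_sub.
move: (nz_row _) vA0 => v vA0.
have XE i : X i = \sum_j A i j *: B`_j.
  rewrite [LHS](coord_vbasis (memvf _)); apply: eq_bigr => j _.
  by rewrite mxE.
transitivity (\sum_j (v *m A) 0 j *: B`_j); last first.
  by apply: big1 => j _; rewrite vA0 mxE scale0r.
under eq_bigr => i _ do rewrite XE scaler_sumr.
rewrite exchange_big; apply: eq_bigr => j _ /=.
by rewrite mxE scaler_suml; apply: eq_bigr => i _; rewrite scalerA.
Qed.

(* Irreducible polynomials of equal degree have roots in a common extension whose
   degree is that of the polynomials. *)
Lemma common_extension p g n : irreducible_poly p -> irreducible_poly g ->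
    size p = n -> size g = n ->
  exists (K : fieldType) (f : {rmorphism F -> K}) (a b : K),
  [/\ root (map_poly f p) a, root (map_poly f g) b,
      forall h, (size h < n)%N -> root (map_poly f h) a \/ root (map_poly f h) b -> h = 0 &
      forall X : 'I_n -> K, exists2 v : 'rV[F]_n, v != 0 & \sum_i f (v 0 i) * X i = 0].
Proof.
move=> irp irg szp szg; have [K dimK [a ra _]] := irredp_FAdjoin irp.
have [b rb] : exists b : K, root (map_poly (in_alg K) g) b.
  by apply: irreducible_has_root; rewrite // dimK szp szg.
exists K, (in_alg K : {rmorphism F -> K}), a, b; split=> //.
  move=> h sh [rh|rh]; first by apply: (irreducible_root_eq0 irp ra); rewrite ?szp.
  by apply: (irreducible_root_eq0 irg rb); rewrite ?szg.
move=> X; have [|v v0 E] := lin_dep (n := n) X.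
  by rewrite dimK szp ltn_predL -szp; case: irp => /ltnW.
by exists v => //; rewrite -[RHS]E; apply: eq_bigr => i _; rewrite mulr_algl.
Qed.

End CommonExtension.

(** * Transitivity on the point types *)

Section Transitivity.
Variable F : finFieldType.
Hypothesis char_neq3 : 3%:R != 0 :> F.
Hypothesis card_ge5 : (5 <= #|F|)%N.
Implicit Types (A B M N P : 'M[F]_4).
#[local] Arguments Cpt : simpl never.
#[local] Arguments oscPlane : simpl never.

(* The roots of [cpoly x0 x1 x2 x3] are the parameters of the osculating planes
   through P(x0, x1, x2, x3). *)
Definition cpoly (x0 x1 x2 x3 : F) : {poly F} :=
  Poly [:: x0; - (3%:R * x1); 3%:R * x2; - x3].

Lemma root_cpoly (K : fieldType) (f : {rmorphism F -> K}) (x0 x1 x2 x3 : F) (b : K) :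
  root (map_poly f (cpoly x0 x1 x2 x3)) b =
  (f x0 - 3%:R * f x1 * b + 3%:R * f x2 * b ^+ 2 - f x3 * b ^+ 3 == 0).
Proof.
rewrite rootE map_Poly ?rmorph0 // horner_Poly /= !rmorphN !rmorphM /= !rmorph_nat.
by congr (_ == 0); ring.
Qed.

Lemma root_cpolyF (x0 x1 x2 x3 t : F) : root (cpoly x0 x1 x2 x3) t =
  (x0 - 3%:R * x1 * t + 3%:R * x2 * t ^+ 2 - x3 * t ^+ 3 == 0).
Proof. by rewrite rootE horner_Poly /=; congr (_ == 0); ring. Qed.

Lemma cpoly0_size (x0 x1 x2 : F) : (size (cpoly x0 x1 x2 0%R) <= 3)%N.
Proof.
suff -> : cpoly x0 x1 x2 0 = Poly [:: x0; - (3%:R * x1); 3%:R * x2] by apply: size_Poly.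
apply/polyP=> i; rewrite !coef_Poly oppr0.
by case: i => [|[|[|[|i]]]] //=; rewrite nth_nil.
Qed.

Lemma cpoly00_size (x0 x1 : F) : (size (cpoly x0 x1 0%R 0%R) <= 2)%N.
Proof.
suff -> : cpoly x0 x1 0 0 = Poly [:: x0; - (3%:R * x1)] by apply: size_Poly.
apply/polyP=> i; rewrite !coef_Poly oppr0 mulr0.
by case: i => [|[|[|[|i]]]] //=; rewrite nth_nil.
Qed.

Lemma cpoly_eq0 (x0 x1 x2 x3 : F) : cpoly x0 x1 x2 x3 = 0 ->
  vec4 x0 x1 x2 x3 = 0.
Proof.
move=> E; have C i : [:: x0; - (3%:R * x1); 3%:R * x2; - x3]`_i = 0.
  by rewrite -coef_Poly -/(cpoly _ _ _ _) E coef0.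
apply/eqP; rewrite vec4_eq0; apply/and4P.
have := (C 0%N, C 1%N, C 2%N, C 3%N) => /= -[[[/eqP e0 /eqP e1] /eqP e2] /eqP e3].
move: e1 e2 e3; rewrite !oppr_eq0 !mulf_eq0 (negPf char_neq3) /= => e1 e2 e3.
by split.
Qed.

Lemma cpoly_size_gt (x0 x1 x2 x3 : F) :
  (x3 != 0 -> (3 < size (cpoly x0 x1 x2 x3))%N) /\ (x2 != 0 -> (2 < size (cpoly x0 x1 x2 x3))%N).
Proof.
have C i : (cpoly x0 x1 x2 x3)`_i = [:: x0; - (3%:R * x1); 3%:R * x2; - x3]`_i.
  by rewrite coef_Poly.
split=> nz; rewrite ltnNge; apply: contraNN nz => /leq_sizeP sz.
  by have := sz 3%N (leqnn _); rewrite C /= => /eqP; rewrite oppr_eq0.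
have := sz 2%N (leqnn _); rewrite C /= => /eqP.
by rewrite mulf_eq0 (negPf char_neq3).
Qed.

Lemma no_roots (x0 x1 x2 x3 : F) :
  (forall t, ~~ (pt (vec4 x0 x1 x2 x3) <= oscPlane (Some t))%MS) ->
  forall t, ~~ root (cpoly x0 x1 x2 x3) t.
Proof. by move=> h t; move: (h t); rewrite sub_osc // root_cpolyF. Qed.

(** Roots in an extension also move by the Moebius map: the new form at [be], times the cube of the
    denominator, is the cube of the determinant times the old form at [al]. *)
Lemma Smat_root (K : fieldType) (f : {rmorphism F -> K})
    (x0 x1 x2 x3 y0 y1 y2 y3 a b c d : F) (al be : K) :
  vec4 x0 x1 x2 x3 *m Smat a b c d = vec4 y0 y1 y2 y3 ->
  f c * al + f d != 0 -> f a * al + f b = be * (f c * al + f d) ->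
  root (map_poly f (cpoly x0 x1 x2 x3)) al ->
  root (map_poly f (cpoly y0 y1 y2 y3)) be.
Proof.
rewrite vec4_mul !vec4Z !vec4D => /vec4_inj[<- <- <- <-] V0 EU.
rewrite !root_cpoly => /eqP fx; apply/eqP; apply: (mulIf (expf_neq0 3 V0)).
rewrite mul0r; transitivity ((f a * f d - f b * f c) ^+ 3 *
    (f x0 - 3%:R * f x1 * al + 3%:R * f x2 * al ^+ 2 - f x3 * al ^+ 3)); last first.
  by rewrite fx mulr0.
set V := f c * al + f d in EU *; set U := f a * al + f b in EU.
rewrite !(rmorphD, rmorphM, rmorphXn, rmorph_nat) /=.
set y0' := (X in X - _ + _ - _); set y1' := (X in _ - 3%:R * X * _ + _ - _).
set y2' := (X in _ - _ + 3%:R * X * _ - _); set y3' := (X in _ - _ + _ - X * _).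
transitivity (y0' * V ^+ 3 - 3%:R * y1' * (be * V) * V ^+ 2
   + 3%:R * y2' * (be * V) ^+ 2 * V - y3' * (be * V) ^+ 3); first by ring.
by rewrite -EU /y0' /y1' /y2' /y3' /U /V; ring.
Qed.

(** The linear polynomial v + u X is written as [cpoly v (- u / 3) 0 0], so that the degree bound on
    polynomials vanishing at [z] applies to it. *)
Lemma deg1_indep (K : fieldType) (f : {rmorphism F -> K}) n (z : K) (u v : F) :
  (2 < n)%N -> (forall h : {poly F}, (size h < n)%N -> root (map_poly f h) z -> h = 0%R) ->
  f u * z + f v = 0 -> u = 0 /\ v = 0.
Proof.
move=> n2 ind E; have n3 : (3%:R : K) != 0 by rewrite -(rmorph_nat f) fmorph_eq0.
have /ind e0 : (size (cpoly v (- u / 3%:R)%R 0%R 0%R) < n)%N.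
  exact: leq_ltn_trans (cpoly00_size _ _) n2.
have /vec4_inj[-> /eqP + _ _] : vec4 v (- u / 3%:R) 0 0 = vec4 0 0 0 0.
  rewrite vec4_0; apply/cpoly_eq0/e0; rewrite root_cpoly; apply/eqP; rewrite -[RHS]E.
  by rewrite !(rmorphM, rmorphN, fmorphV, rmorph_nat, rmorph0) /=; field.
by rewrite mulf_eq0 oppr_eq0 invr_eq0 (negPf char_neq3) orbF => /eqP->.
Qed.

Lemma proportional_pt (x0 x1 x2 x3 y0 y1 y2 y3 : F) k l : k != 0 ->
  vec4 x0 x1 x2 x3 != 0 ->
  k *: vec4 x0 x1 x2 x3 = l *: vec4 y0 y1 y2 y3 ->
  pt (vec4 x0 x1 x2 x3) = pt (vec4 y0 y1 y2 y3).
Proof.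
move=> k0 x0' E; have l0 : l != 0.
  apply: contraNneq x0' => l0; move/eqP: E; rewrite l0 scale0r scaler_eq0 (negPf k0).
  by [].
apply: (@pt_eq _ _ _ (k^-1 * l)); first by rewrite mulf_neq0 ?invr_eq0.
by rewrite -scalerA -E scalerA mulVf // scale1r.
Qed.

Lemma act_Smat_pt (x0 x1 x2 x3 a b c d : F) : Smat_det a b c d != 0 ->
  vec4 x0 x1 x2 x3 != 0 ->
  exists z0 z1 z2 z3, [/\ vec4 x0 x1 x2 x3 *m Smat a b c d = vec4 z0 z1 z2 z3,
    vec4 z0 z1 z2 z3 != 0 & act (Smat a b c d) (pt (vec4 x0 x1 x2 x3)) = pt (vec4 z0 z1 z2 z3)].
Proof.
move=> D0 nz; have [z0 [z1 [z2 [z3 E]]]] := vec4P (vec4 x0 x1 x2 x3 *m Smat a b c d).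
exists z0, z1, z2, z3; split=> //; last by rewrite act_pt E.
rewrite -E; apply: contra_neq nz => E0.
have uS : Smat a b c d \in unitmx by apply/Gq_unit/Smat_Gq.
by rewrite -[LHS](mulmxK uS) E0 mul0mx.
Qed.

Lemma nroots0_trans P P' : P \in points F -> P' \in points F ->
  nroots P = 0%N -> nroots P' = 0%N -> exists2 M, M \in Gq F & act M P = P'.
Proof.
case/pointsP=> x nzx ->; have [x0 [x1 [x2 [x3 Ex]]]] := vec4P x; subst x.
case/pointsP=> y nzy ->; have [y0 [y1 [y2 [y3 Ey]]]] := vec4P y; subst y.
have key (z0 z1 z2 z3 : F) : nroots (pt (vec4 z0 z1 z2 z3)) = 0%N ->
    [/\ z3 != 0, size (cpoly z0 z1 z2 z3) = 4%N & irreducible_poly (cpoly z0 z1 z2 z3)].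
  move/eqP; rewrite cards_eq0 => /eqP/setP E.
  have nr o : ~~ (pt (vec4 z0 z1 z2 z3) <= oscPlane o)%MS by have := E o; rewrite !inE => ->.
  have z3n : z3 != 0 by have := nr None; rewrite sub_osc.
  have sz : size (cpoly z0 z1 z2 z3) = 4%N.
    by apply/eqP; rewrite eqn_leq size_Poly; have [->] := cpoly_size_gt z0 z1 z2 z3.
  by split=> //; apply: cubic_irreducible; rewrite ?sz //; apply: no_roots.
move=> /key[x3n szx irx] /key[y3n szy iry].
have [K [f [al [be [ral rbe ind dep]]]]] := common_extension irx iry szx szy.
have inda (u v : F) : f u * al + f v = 0 -> u = 0 /\ v = 0.
  by apply: (@deg1_indep _ _ 4) => // h sh rh; apply: (ind h sh); left.
have indb (u v : F) : f u * be + f v = 0 -> u = 0 /\ v = 0.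
  by apply: (@deg1_indep _ _ 4) => // h sh rh; apply: (ind h sh); right.
(* Four elements of a cubic extension are dependent, and a dependency a al + b = be (c al + d) is a
   Moebius map over [F] from [al] to [be]. *)
have [v nzv] := dep (fun i => nth 0 [:: al; 1; - (be * al); - be] i).
have [a [b [c [d Ev]]]] := vec4P v; subst v.
rewrite !big_ord_recl big_ord0 !mxE /= => E.
have {}E : f a * al + f b = be * (f c * al + f d).
  by apply/eqP; rewrite -subr_eq0 -[X in _ == X]E; apply/eqP; ring.
have V0 : f c * al + f d != 0.
  apply: contraNneq nzv => V0; have [-> ->] := inda _ _ V0.
  by move: E; rewrite V0 mulr0 => /inda[-> ->]; rewrite vec4_0.
(* A singular matrix would give c be = a and d be = b, hence a = b = c = d = 0, as 1 and [be] are
   independent over [F]. *)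
have D0 : Smat_det a b c d != 0.
  apply: contraNneq nzv => D0.
  have fD0 : f a * f d - f b * f c = 0 by rewrite -!rmorphM -rmorphB -/(Smat_det a b c d) D0 rmorph0.
  have e1 : f c * be + f (- a) = 0.
    apply: (mulIf V0); rewrite mul0r.
    transitivity (f c * (be * (f c * al + f d)) - f a * (f c * al + f d)).
      by rewrite rmorphN; ring.
    by rewrite -E -[RHS]oppr0 -[in RHS]fD0; ring.
  have e2 : f d * be + f (- b) = 0.
    apply: (mulIf V0); rewrite mul0r.
    transitivity (f d * (be * (f c * al + f d)) - f b * (f c * al + f d)).
      by rewrite rmorphN; ring.
    by rewrite -E -[RHS](mul0r al) -[in RHS]fD0; ring.
  have [-> /eqP] := indb _ _ e1; have [-> /eqP] := indb _ _ e2.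
  by rewrite !oppr_eq0 => /eqP-> /eqP->; rewrite vec4_0.
exists (Smat a b c d); first exact: Smat_Gq.
have [z0 [z1 [z2 [z3 [Ez nzz ->]]]]] := act_Smat_pt D0 nzx.
have rz := Smat_root Ez V0 E ral.
(* Cross-multiplying by the leading coefficients cancels the cubic term of the difference; being of
   degree at most 2 and vanishing at [be], it is zero. *)
apply: (proportional_pt (k := y3) (l := z3)) => //.
rewrite !vec4Z; apply/eqP; rewrite -subr_eq0 -scaleN1r vec4Z vec4D; apply/eqP.
have -> : y3 * z3 + -1 * (z3 * y3) = 0 by ring.
apply: cpoly_eq0; apply: ind; first exact: leq_ltn_trans (cpoly0_size _ _ _) _.
right; rewrite root_cpoly !(rmorphD, rmorphM, rmorphN, rmorph1, rmorph0) /=.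
move: rz rbe; rewrite !root_cpoly => /eqP rz /eqP rbe; apply/eqP.
transitivity (f y3 * (f z0 - 3%:R * f z1 * be + 3%:R * f z2 * be ^+ 2 - f z3 * be ^+ 3)
  - f z3 * (f y0 - 3%:R * f y1 * be + 3%:R * f y2 * be ^+ 2 - f y3 * be ^+ 3)); first by ring.
by rewrite rz rbe !mulr0 subrr.
Qed.

(** With the only root at infinity, a quadratic without rational roots remains. If its leading
    coefficient vanished, there would be a finite root or the point would be P(infinity). *)
Lemma nroots1_normal_form P : P \in points F -> P \notin cubic F -> nroots P = 1%N ->
  exists2 M, M \in Gq F & exists x0 x1 x2, [/\ act M P = pt (vec4 x0 x1 x2 0), x2 != 0 &
     forall t, ~~ root (cpoly x0 x1 x2 0) t].
Proof.
move=> Pp nC /eqP/cards1P[o /setP Eo].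
have Po o' : (P <= oscPlane o')%MS = (o' == o) by have := Eo o'; rewrite !inE.
have [o2 ne] : exists o2, o != o2.
  by case: o {Eo Po} => [t|]; [exists None | exists (Some 0)].
have [a [b [c [d [D0 F1 F2]]]]] := Smat_two_trans ne; set N := Smat a b c d in F1.
have GN : N \in Gq F by apply: Smat_Gq.
have Np : act N P \in points F by apply: act_subsp Pp; apply: Gq_unit.
exists N => //; case/pointsP: Np => v nzv Ev.
have [x0 [x1 [x2 [x3 E]]]] := vec4P v; subst v.
have nxC : pt (vec4 x0 x1 x2 x3) \notin cubic F.
  by rewrite -Ev Gq_cubic // (points_genmx Pp).
have root_inf : (pt (vec4 x0 x1 x2 x3) <= oscPlane None)%MS.
  rewrite -Ev -!polar_Cpt // -F1 polar_act ?(cubic_genmx (Cpt_cubic _)) //; last exact: simil_Smat.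
  by rewrite act_sub ?(Gq_unit GN) // polar_Cpt // Po.
have nr : nroots (pt (vec4 x0 x1 x2 x3)) = 1%N.
  rewrite -Ev nroots_act ?(points_genmx Pp) //; apply/eqP/cards1P; exists o.
  by apply/setP=> o'; rewrite !inE Po.
have root_t t : ~~ (pt (vec4 x0 x1 x2 x3) <= oscPlane (Some t))%MS.
  apply/negP=> rt; have /eqP/cards1P[o' /setP E] := nr.
  have := E None; have := E (Some t); rewrite !inE root_inf rt.
  by move=> /esym/eqP <- /esym/eqP.
move: root_inf; rewrite sub_osc // => /eqP z3; subst x3.
exists x0, x1, x2; split=> //; last exact: no_roots.
apply/eqP=> z2; subst x2; have rt := no_roots root_t.
case: (eqVneq x1 0) => [z1|x1n].
  case/negP: nxC; apply/imsetP; exists None => //; subst x1.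
  move: nzv; rewrite vec4_eq0 eqxx !andbT => x0n.
  by apply: (pt_eq x0n); rewrite vec4Z !mulr0 mulr1.
have /negP[] := rt (x0 / (3%:R * x1)); rewrite root_cpolyF.
by apply/eqP; field; rewrite ?x1n.
Qed.

(** In normal form infinity stays fixed, so an affine map suffices: in a quadratic extension the
    three elements [al], 1 and [- be] are dependent, giving a al + b = d be. *)
Lemma nroots1_trans P P' : P \in points F -> P' \in points F ->
  P \notin cubic F -> P' \notin cubic F ->
  nroots P = 1%N -> nroots P' = 1%N -> exists2 M, M \in Gq F & act M P = P'.
Proof.
move=> Pp Pp' nC nC' rP rP'.
have [M GM [x0 [x1 [x2 [EM x2n rx]]]]] := nroots1_normal_form Pp nC rP.
have [M' GM' [y0 [y1 [y2 [EM' y2n ry]]]]] := nroots1_normal_form Pp' nC' rP'.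
suff [N GN EN] : exists2 N, N \in Gq F &
    act N (pt (vec4 x0 x1 x2 0)) = pt (vec4 y0 y1 y2 0).
  exists (M *m N *m invmx M'); first by rewrite !Gq_mul // Gq_inv.
  by rewrite -!act_comp EM EN -EM' actK // (points_genmx Pp').
have nzx : vec4 x0 x1 x2 0 != 0 :> 'rV[F]_4 by rewrite vec4_eq0 (negPf x2n) !andbF.
have key (z0 z1 z2 : F) : z2 != 0 -> (forall t, ~~ root (cpoly z0 z1 z2 0) t) ->
    size (cpoly z0 z1 z2 0) = 3%N /\ irreducible_poly (cpoly z0 z1 z2 0).
  move=> z2n rz; have sz : size (cpoly z0 z1 z2 0) = 3%N.
    by apply/eqP; rewrite eqn_leq cpoly0_size; have [_ ->] := cpoly_size_gt z0 z1 z2 0.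
  by split=> //; apply: cubic_irreducible; rewrite ?sz.
have [szx irx] := key _ _ _ x2n rx; have [szy iry] := key _ _ _ y2n ry.
have [K [f [al [be [ral rbe ind dep]]]]] := common_extension irx iry szx szy.
have inda (u v : F) : f u * al + f v = 0 -> u = 0 /\ v = 0.
  by apply: (@deg1_indep _ _ 3) => // h sh rh; apply: (ind h sh); left.
have indb (u v : F) : f u * be + f v = 0 -> u = 0 /\ v = 0.
  by apply: (@deg1_indep _ _ 3) => // h sh rh; apply: (ind h sh); right.
have [v nzv] := dep (fun i => nth 0 [:: al; 1; - be] i).
set a := v 0 0; set b := v 0 1; set d := v 0 2%:R.
have vE : v = \row_(i < 3) nth 0 [:: a; b; d] i.
  apply/rowP=> i; rewrite mxE.
  by case: i => [[|[|[|//]]] Hi] /=; congr (v _ _); apply: val_inj.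
rewrite !big_ord_recl big_ord0 {1 2 3}vE !mxE /= => E.
have {}E : f a * al + f b = be * (f 0 * al + f d).
  by apply/eqP; rewrite -subr_eq0 -[X in _ == X]E rmorph0; apply/eqP; ring.
have d0 : d != 0.
  apply: contraNneq nzv => d0; move: E; rewrite d0 rmorph0 mul0r addr0 mulr0.
  move/inda => [a0 b0]; rewrite vE a0 b0 d0.
  by apply/eqP/rowP=> i; rewrite !mxE; case: i => [[|[|[|//]]] Hi].
have V0 : f 0 * al + f d != 0 by rewrite rmorph0 mul0r add0r fmorph_eq0.
have a0 : a != 0.
  apply: contraNneq d0 => a0; move: E; rewrite a0 !rmorph0 !mul0r !add0r => E.
  have e : f d * be + f (- b) = 0 by rewrite rmorphN E mulrC subrr.
  by have [->] := indb _ _ e.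
have D0 : Smat_det a b 0 d != 0 by rewrite /Smat_det mulr0 subr0 mulf_neq0.
exists (Smat a b 0 d); first exact: Smat_Gq.
have [z0 [z1 [z2 [z3 [Ez nzz ->]]]]] := act_Smat_pt D0 nzx.
have z3_0 : z3 = 0.
  by move: Ez; rewrite vec4_mul !vec4Z !vec4D => /vec4_inj[_ _ _ <-]; ring.
subst z3; have rz := Smat_root Ez V0 E ral.
apply: (proportional_pt (k := y2) (l := z2)) => //.
rewrite !vec4Z; apply/eqP; rewrite -subr_eq0 -scaleN1r vec4Z vec4D; apply/eqP.
have -> : y2 * z2 + -1 * (z2 * y2) = 0 by ring.
have -> : y2 * 0 + -1 * (z2 * 0) = 0 by ring.
apply: cpoly_eq0; apply: ind; first exact: leq_ltn_trans (cpoly00_size _ _) _.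
right; rewrite root_cpoly !(rmorphD, rmorphM, rmorphN, rmorph1, rmorph0) /=.
move: rz rbe; rewrite !root_cpoly => /eqP rz /eqP rbe; apply/eqP.
transitivity (f y2 * (f z0 - 3%:R * f z1 * be + 3%:R * f z2 * be ^+ 2 - f 0 * be ^+ 3)
  - f z2 * (f y0 - 3%:R * f y1 * be + 3%:R * f y2 * be ^+ 2 - f 0 * be ^+ 3)).
  by rewrite rmorph0; ring.
by rewrite rz rbe !mulr0 subrr.
Qed.

Lemma ptype_trans p P P' : isPtype p P -> isPtype p P' ->
  exists2 M, M \in Gq F & act M P = P'.
Proof.
rewrite !isPtypeE // => /and3P[Pp nC /eqP rP] /and3P[Pp' nC' /eqP rP'].
case: p rP rP' => /= rP rP'; [| |exact: nroots1_trans|exact: nroots0_trans].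
- have [|[_ [M GM EM]]|[]] := nroots_ge2_orbit char_neq3 card_ge5 Pp; rewrite ?rP //.
  have [|[_ [N GN EN]]|[]] := nroots_ge2_orbit char_neq3 card_ge5 Pp'; rewrite ?rP' //.
  exists (M *m invmx N); first by rewrite Gq_mul // Gq_inv.
  by rewrite -act_comp EM -EN actK // (points_genmx Pp').
have [|[]|[_ [M GM EM]]] := nroots_ge2_orbit char_neq3 card_ge5 Pp; rewrite ?rP //.
have [|[]|[_ [N GN EN]]] := nroots_ge2_orbit char_neq3 card_ge5 Pp'; rewrite ?rP' //.
exists (M *m invmx N); first by rewrite Gq_mul // Gq_inv.
by rewrite -act_comp EM -EN actK // (points_genmx Pp').
Qed.

End Transitivity.

(** * Double counting *)

Lemma double_count (S T : finType) (A : {set S}) (B : {set T}) (r : S -> T -> bool) :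
  (\sum_(x in A) #|[set y in B | r x y]| = \sum_(y in B) #|[set x in A | r x y]|)%N.
Proof.
under eq_bigr => x _ do rewrite -sum1_card.
under [RHS]eq_bigr => y _ do rewrite -sum1_card.
rewrite (exchange_big_dep (mem B)) /= => [|x y _]; last by rewrite inE => /andP[].
by apply: eq_bigr => y yB; apply: eq_bigl => x; rewrite !inE yB.
Qed.

Lemma card_ordered_pairs (T : finType) (A : {set T}) :
  (#|[set u : T * T | [&& u.1 != u.2, u.1 \in A & u.2 \in A]]| + #|A| = #|A| * #|A|)%N.
Proof.
rewrite -cardsX -[RHS](cardsID [set u | u.1 != u.2]); congr (_ + _)%N.
  by apply: eq_card => u; rewrite !inE andbC.
have inj : injective (fun x : T => (x, x)) by move=> x y [].
rewrite -(card_imset _ inj).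
apply: eq_card => -[x y]; rewrite !inE negbK /=.
apply/imsetP/andP => [[z zA [-> ->]]|[/eqP-> /andP[yA _]]]; first by rewrite eqxx zA.
by exists y.
Qed.

(** * Sizes of the point types *)

Section Counting.
Variable F : finFieldType.
Hypothesis char_neq3 : 3%:R != 0 :> F.
Hypothesis card_ge5 : (5 <= #|F|)%N.
Implicit Types (A B M N P : 'M[F]_4).
#[local] Arguments Cpt : simpl never.
#[local] Arguments oscPlane : simpl never.

Lemma card_subspace_vectors A : #|[set x : 'rV[F]_4 | (x <= A)%MS]| = (#|F| ^ \rank A)%N.
Proof.
rewrite -[\rank A]mul1n -card_mx -cardsT.
rewrite -(card_imset _ (row_free_inj (row_base_free A) : injective (mulmx^~ (row_base A)))).
apply: eq_card => x; rewrite inE; apply/idP/imsetP => [|[D _ ->]].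
  by rewrite -(eq_row_base A) => /submxP[D ->]; exists D.
by rewrite -(eq_row_base A) submxMl.
Qed.

Lemma card_pt_fiber P : P \in points F -> #|[set x : 'rV[F]_4 | pt x == P & x != 0]| = #|F|.-1.
Proof.
case/pointsP=> y y0 ->; rewrite -(cardC1 (0 : F)).
have inj : injective (fun k : F => k *: y).
  move=> k l /eqP; rewrite -subr_eq0 -scalerBl scaler_eq0 (negPf y0) orbF subr_eq0.
  by move/eqP.
rewrite -(card_imset _ inj); apply: eq_card => x; rewrite inE.
apply/andP/imsetP => [[/eqP E x0]|[k k0 ->]].
  by have [k k0 ->] := pt_inj x0 E; exists k => //; rewrite inE.
rewrite inE in k0; split; last by rewrite scaler_eq0 negb_or k0.
by apply/eqP; apply: (pt_eq k0).
Qed.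

Lemma card_subspace_points A :
  (#|[set P in points F | (P <= A)%MS]| * #|F|.-1 = (#|F| ^ \rank A).-1)%N.
Proof.
pose V := [set x : 'rV[F]_4 | (x <= A)%MS] :\ 0.
have <- : #|V| = (#|F| ^ \rank A).-1.
  rewrite -card_subspace_vectors /V; set W := [set x | _]; have m0 : 0 \in W by rewrite inE sub0mx.
  by rewrite (cardsD1 0 W) m0.
pose r (P : 'M[F]_4) (x : 'rV[F]_4) := pt x == P.
have := double_count [set P in points F | (P <= A)%MS] V r.
rewrite (eq_bigr (fun=> #|F|.-1)) => [|P]; last first.
  rewrite inE => /andP[Pp PA]; rewrite -(card_pt_fiber Pp); apply: eq_card => x.
  rewrite !inE /r; case: (eqVneq (pt x) P) => [E|]; rewrite ?andbF //= andbT.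
  by rewrite -sub_ptl E PA andbT.
rewrite sum_nat_const => ->; rewrite -sum1_card; apply: eq_bigr => x.
rewrite !inE => /andP[x0 xA]; apply/eqP/cards1P; exists (pt x); apply/setP=> P.
rewrite 2!inE in_set1 /r [P == _]eq_sym; case: (eqVneq (pt x) P) => [<-|]; last by rewrite andbF.
by rewrite sub_ptl xA pt_points x0.
Qed.

Let q := #|F|.

Lemma card_all_points : #|points F| = (q ^ 3 + q ^ 2 + q + 1)%N.
Proof.
have q0 : (0 < q.-1)%N by rewrite -ltnS prednK /q; case: #|F| card_ge5 => [|[]].
have := card_subspace_points 1%:M; rewrite mxrank1.
have -> : [set P in points F | (P <= 1%:M)%MS] = points F.
  by apply/setP=> P; rewrite !inE submx1 andbT.
rewrite -/q => E; apply/eqP; rewrite -(eqn_pmul2r q0) E; apply/eqP.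
by case: q q0 => // n _ /=; lia.
Qed.

Lemma card_osc_points o :
  #|[set P in points F | (P <= oscPlane o)%MS]| = (q ^ 2 + q + 1)%N.
Proof.
have q0 : (0 < q.-1)%N by rewrite -ltnS prednK /q; case: #|F| card_ge5 => [|[]].
have := card_subspace_points (oscPlane o).
rewrite -polar_Cpt // rank_polar //.
have /andP[/eqP -> _] : (\rank (Cpt o) == 1%N) && (<<Cpt o>>%MS == Cpt o).
  by have := Cpt_points o; rewrite inE.
rewrite -/q => E; apply/eqP; rewrite -(eqn_pmul2r q0) E; apply/eqP.
by case: q q0 => // n _ /=; lia.
Qed.

(** The cubic points are kept in class 1, so that the classes partition all points. *)
Definition nroots_class k := [set P in points F | nroots P == k].

Lemma card_option_F : #|[set: option F]| = q.+1.
Proof. by rewrite cardsT card_option. Qed.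

Lemma vec01_inj : injective (fun y : F => pt (vec4 0 1 y 0)).
Proof.
move=> y z /pt_inj[|k _]; first by rewrite vec4_eq0 oner_eq0 andbF.
by rewrite vec4Z => /vec4_inj[_ + -> _]; rewrite mulr1 => <-; rewrite mul1r.
Qed.

Lemma card_class_pair k o1 o2 : o1 != o2 ->
  #|[set P in nroots_class k | (P <= oscPlane o1)%MS && (P <= oscPlane o2)%MS]| =
  #|[set P in nroots_class k | (P <= oscPlane None)%MS && (P <= oscPlane (Some 0))%MS]|.
Proof.
move=> ne; have [a [b [c [d [D0 F1 F2]]]]] := Smat_two_trans ne.
set N := Smat a b c d in F1 F2; have GN : N \in Gq F by apply: Smat_Gq.
have uN := Gq_unit GN; have sN : is_similitude N by apply: simil_Smat.
have osc_act P o o' : act N (Cpt o) = Cpt o' ->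
    (act N P <= oscPlane o')%MS = (P <= oscPlane o)%MS.
  move=> E; rewrite -!polar_Cpt // -E polar_act ?(cubic_genmx (Cpt_cubic _)) //.
  by rewrite act_sub.
have gC P : P \in nroots_class k -> <<P>>%MS = P by rewrite inE => /andP[/points_genmx].
have class_act P : <<P>>%MS = P -> (act N P \in nroots_class k) = (P \in nroots_class k).
  move=> gP; rewrite [LHS]inE [RHS]inE nroots_act //; congr (_ && _).
  apply/idP/idP => Pp; last exact: act_subsp.
  by rewrite -(actK GN gP); apply: act_subsp => //; rewrite unitmx_inv.
rewrite -[LHS](@card_in_imset _ _ (act N)); last first.
  move=> P Q /setIdP[/gC gP _] /setIdP[/gC gQ _].
  exact: act_inj.
apply: eq_card => Q; rewrite inE; apply/imsetP/and3P => [[P]|[Qc Q1 Q2]].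
  rewrite inE => /and3P[Pc P1 P2] ->.
  rewrite class_act ?(osc_act _ _ _ F1) ?(osc_act _ _ _ F2) //.
  exact: gC Pc.
have gQ := gC _ Qc.
exists (act (invmx N) Q); last by rewrite actKV.
rewrite inE -(osc_act _ _ _ F1) -(osc_act _ _ _ F2) -class_act ?genmx_act // actKV //.
by rewrite Qc Q1.
Qed.

Lemma osc_0inf P : P \in points F -> (P <= oscPlane None)%MS -> (P <= oscPlane (Some 0))%MS ->
  P = pt (vec4 0 0 1 0) \/ exists y, P = pt (vec4 0 1 y 0).
Proof.
case/pointsP=> v; have [x0 [x [y [x3 ->]]]] := vec4P v => nz ->.
rewrite !sub_osc // !expr0n /= !mulr0 !subr0 addr0 => /eqP z3 /eqP z0; subst x0 x3.
move: nz; rewrite vec4_eq0 eqxx andbT /=; case: (eqVneq x 0) => [-> /= y0|x0 _].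
  by left; apply: (pt_eq y0); rewrite vec4Z !mulr0 mulr1.
by right; exists (y / x); apply: (pt_eq x0); rewrite vec4Z !mulr0 mulr1 mulrC divfK.
Qed.

Lemma pt010 (y : F) : [/\ pt (vec4 0 1 y 0) \in points F, (pt (vec4 0 1 y 0) <= oscPlane None)%MS,
  (pt (vec4 0 1 y 0) <= oscPlane (Some 0))%MS & nroots (pt (vec4 0 1 y 0)) = (2 + (y != 0%R))%N].
Proof.
split; rewrite ?pt_points ?sub_osc // ?vec4_eq0 ?oner_eq0 ?andbF //.
  by rewrite !expr0n /= !mulr0 !subr0 addr0.
by rewrite nroots_normal_form ?oner_eq0 //=; case: (y == 0).
Qed.

Lemma pt001 : [/\ pt (vec4 0 0 1 0) \in points F, (pt (vec4 0 0 1 0 : 'rV[F]_4) <= oscPlane None)%MS,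
  (pt (vec4 0 0 1 0 : 'rV[F]_4) <= oscPlane (Some 0))%MS & nroots (pt (vec4 0 0 1 0 : 'rV[F]_4)) = 2%N].
Proof.
split; rewrite ?pt_points ?sub_osc // ?vec4_eq0 ?oner_eq0 ?andbF //.
  by rewrite !expr0n /= !mulr0 !subr0 addr0.
by rewrite nroots_normal_form ?oner_eq0 ?eqxx.
Qed.

Lemma card_class_0inf2 :
  #|[set P in nroots_class 2%N | (P <= oscPlane None)%MS && (P <= oscPlane (Some 0))%MS]| = 2%N.
Proof.
have [A1 A2 A3 A4] := pt001; have [B1 B2 B3] := pt010 0; rewrite eqxx => B4.
apply/eqP/cards2P; exists (pt (vec4 0 0 1 0)), (pt (vec4 0 1 0 0)); split.
  apply/eqP=> /pt_inj[|k _]; first by rewrite vec4_eq0 oner_eq0 !andbF.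
  by rewrite vec4Z => /vec4_inj[_ _ /eqP]; rewrite mulr0 oner_eq0.
apply/setP=> P; rewrite 2!inE in_set2; apply/and3P/orP => [[/andP[Pp /eqP rP] P1 P2]|].
  have [->|[y E]] := osc_0inf Pp P1 P2; first by left.
  right; rewrite E; move: rP; rewrite E; have [_ _ _ ->] := pt010 y.
  by case: (eqVneq y 0) => [->|].
by case=> /eqP ->; split; rewrite // ?A1 ?A4 ?B1 ?B4.
Qed.

Lemma card_class_0inf3 :
  #|[set P in nroots_class 3%N | (P <= oscPlane None)%MS && (P <= oscPlane (Some 0))%MS]| = q.-1.
Proof.
rewrite /q -(cardC1 (0 : F)) -(card_imset _ vec01_inj); apply: eq_card => P.
rewrite 2!inE; apply/and3P/imsetP => [[/andP[Pp /eqP rP] P1 P2]|[y y0 ->]].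
  have [E|[y E]] := osc_0inf Pp P1 P2; move: rP; rewrite E.
    by have [_ _ _ ->] := pt001.
  have [_ _ _ ->] := pt010 y; case: (eqVneq y 0) => // y0 _; by exists y.
have [-> -> -> ->] := pt010 y; move: y0; rewrite inE => y0.
by rewrite y0.
Qed.

(** Counts a point together with an ordered pair of distinct roots; 2-transitivity makes every pair
    contribute as much as (infinity, 0). *)
Lemma class_pair_count k : (#|nroots_class k| * (k * k - k) =
  (q.+1 * q.+1 - q.+1) *
  #|[set P in nroots_class k | (P <= oscPlane None)%MS && (P <= oscPlane (Some 0%R))%MS]|)%N.
Proof.
pose pairs := [set u : option F * option F | u.1 != u.2].
have cp (R : {set option F}) :
    #|[set u in pairs | (u.1 \in R) && (u.2 \in R)]| = (#|R| * #|R| - #|R|)%N.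
  rewrite -card_ordered_pairs addnK; apply: eq_card => u.
  by rewrite !inE.
have := double_count (nroots_class k) pairs
  (fun P u => (P <= oscPlane u.1)%MS && (P <= oscPlane u.2)%MS).
rewrite (eq_bigr (fun=> (k * k - k)%N)) => [|P]; last first.
  rewrite inE => /andP[_ /eqP <-]; rewrite /nroots -cp.
  by apply: eq_card => u; rewrite !inE.
rewrite sum_nat_const => ->.
rewrite (eq_bigr (fun=> #|[set P in nroots_class k |
    (P <= oscPlane None)%MS && (P <= oscPlane (Some 0))%MS]|)) => [|u].
  rewrite sum_nat_const; congr (_ * _)%N; rewrite -card_option_F -cp.
  by apply: eq_card => u; rewrite !inE !andbT.
by rewrite inE; apply: card_class_pair.
Qed.

Lemma sum_nroots : (\sum_(P in points F) nroots P = q.+1 * (q ^ 2 + q + 1))%N.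
Proof.
have := double_count (points F) [set: option F] (fun P o => (P <= oscPlane o)%MS).
rewrite [RHS](eq_bigr (fun=> (q ^ 2 + q + 1)%N)) => [|o _]; last exact: card_osc_points.
rewrite sum_nat_const card_option_F => <-; apply: eq_bigr => P _.
by apply: eq_card => o; rewrite !inE.
Qed.

End Counting.

(** Taken with [g] constant 1 and with [g] the identity, it turns the number of points and the
    number of incidences into linear equations in the class sizes. *)
Lemma sum_by_value (T : finType) (A : {set T}) (f : T -> nat) (n : nat) (g : nat -> nat) :
  (forall x, x \in A -> f x < n)%N ->
  (\sum_(x in A) g (f x) = \sum_(k < n) g k * #|[set x in A | f x == k]|)%N.
Proof.
move=> fn; transitivity (\sum_(x in A) \sum_(k < n) (f x == k) * g k)%N.
  apply: eq_bigr => x xA; rewrite (bigD1 (Ordinal (fn x xA))) //= eqxx mul1n.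
  rewrite big1 ?addn0 // => k; rewrite -val_eqE /= eq_sym => /negPf ->.
  by rewrite mul0n.
rewrite exchange_big; apply: eq_bigr => k _ /=; rewrite -big_distrl mulnC /=; congr (_ * _)%N.
rewrite -sum1_card big_mkcond [RHS]big_mkcond; apply: eq_bigr => x _; rewrite inE.
by case: (x \in A); case: (f x == k).
Qed.

Section TypeSizes.
Variable F : finFieldType.
Hypothesis char_neq3 : 3%:R != 0 :> F.
Hypothesis card_ge5 : (5 <= #|F|)%N.
Implicit Types (A B M N P : 'M[F]_4).
#[local] Arguments Cpt : simpl never.
#[local] Arguments oscPlane : simpl never.
Let q := #|F|.

Definition ptype_set p := [set P in points F | isPtype p P].

Lemma card_cubic : #|cubic F| = q.+1.
Proof. by rewrite card_imset ?card_option //; apply: Cpt_inj. Qed.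

Lemma ptype_set_class p : p <> p1G -> ptype_set p = nroots_class F (ptype_nroots p).
Proof.
move=> np; apply/setP=> P; rewrite [LHS]inE [RHS]inE isPtypeE //.
case Pp: (P \in points F) => //=; case: eqP => rP; rewrite ?andbF // andbT.
apply/negP=> /imsetP[o _ E]; move: rP; rewrite E nroots_Cpt //.
by case: p np.
Qed.

Lemma card_class1 : #|nroots_class F 1| = (#|ptype_set p1G| + q.+1)%N.
Proof.
rewrite -card_cubic -(cardsID (cubic F)) addnC; congr (_ + _)%N; apply: eq_card => P.
  rewrite in_setD [_ \in nroots_class _ _]inE [_ \in ptype_set _]inE isPtypeE //.
  by case: (P \in points F); case: (P \in cubic F).
rewrite in_setI [_ \in nroots_class _ _]inE andbC; case Pc: (P \in cubic F) => //=.
by case/imsetP: Pc => o _ ->; rewrite Cpt_points nroots_Cpt.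
Qed.

(** Counting root pairs determines classes 2 and 3; the numbers of incidences and of points then
    give classes 1 and 0. *)
Lemma ptype_set_sizes :
  [/\ #|ptype_set pT| = (q * q.+1)%N, (6 * #|ptype_set p3G| = q.+1 * q * q.-1)%N,
      (2 * #|ptype_set p1G| = q.+1 * q * q.-1)%N & (3 * #|ptype_set p0G| = q.+1 * q * q.-1)%N].
Proof.
have r3 P : P \in points F -> (nroots P < 4)%N by move=> Pp; rewrite ltnS nroots_le3.
have := sum_by_value id r3; have := sum_by_value (fun=> 1%N) r3.
rewrite sum1_card card_all_points // sum_nroots // !big_ord_recl !big_ord0 /=.
rewrite -!/(nroots_class _ _) /bump /= !addn0 !add1n => S0 S1.
have := class_pair_count char_neq3 card_ge5 2%N; rewrite card_class_0inf2 //.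
have := class_pair_count char_neq3 card_ge5 3%N; rewrite card_class_0inf3 //.
move: S0 S1; rewrite card_class1 -!(ptype_set_class (p := pT)) // -!(ptype_set_class (p := p3G)) //.
rewrite -!(ptype_set_class (p := p0G)) // -/q.
have : (0 < q)%N by exact: leq_trans card_ge5.
case: q => // n _ /=; move: #|_| #|_| #|_| #|_| => n3 n2 n1 n0 S0 S1 S3 S2.
have e2 : n2 = (n.+1 * n.+2)%N by nia.
have e3 : (6 * n3 = n.+2 * n.+1 * n)%N by nia.
split=> //; nia.
Qed.

End TypeSizes.

(** * Points of the line l_L *)

Section LineL.
Variable F : finFieldType.
Hypothesis char_neq3 : 3%:R != 0 :> F.
Hypothesis card_ge5 : (5 <= #|F|)%N.
Implicit Types (A B M N P : 'M[F]_4).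
#[local] Arguments Cpt : simpl never.
#[local] Arguments oscPlane : simpl never.
Let q := #|F|.

Definition Lpt (o : option F) : 'M[F]_4 :=
  if o is Some b then pt (vec4 1 0 b 1) else pt (vec4 0 0 1 0).

Lemma sub_lineL (a b c d : F) : (pt (vec4 a b c d) <= lineL F)%MS = (b == 0) && (d == a).
Proof.
rewrite sub_ptl; apply/lineThroughP/andP => [[s [t]]|[/eqP-> /eqP->]].
  rewrite !vec4Z vec4D => /vec4_inj[-> -> _ ->].
  by rewrite !mulr0 !mulr1 !addr0.
by exists a, c; rewrite !vec4Z vec4D; congr vec4; ring.
Qed.

Lemma Lpt_inj : injective Lpt.
Proof.
move=> [b|] [c|] //= /pt_inj[|k k0]; rewrite ?vec4_eq0 ?oner_eq0 ?andbF // vec4Z => /vec4_inj[+ _ e2 _].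
- by rewrite mulr1 => e1; rewrite e2 -e1 mul1r.
- by rewrite mulr0 => /eqP; rewrite oner_eq0.
by rewrite mulr1 => /eqP; rewrite eq_sym (negPf k0).
Qed.

Lemma Lpt_points o : Lpt o \in points F.
Proof. by case: o => [b|]; rewrite pt_points vec4_eq0 oner_eq0 ?andbF. Qed.

Lemma lineL_points P : P \in points F -> (P <= lineL F)%MS = (P \in [set Lpt o | o : option F]).
Proof.
case/pointsP=> v; have [a [b [c [d ->]]]] := vec4P v => nz ->; rewrite sub_lineL.
apply/andP/imsetP => [[/eqP b0 /eqP da]|[[t|] _ E]]; last 2 first.
- have : (pt (vec4 a b c d) <= lineL F)%MS by rewrite E sub_lineL !eqxx.
  by rewrite sub_lineL => /andP.
- have : (pt (vec4 a b c d) <= lineL F)%MS by rewrite E sub_lineL !eqxx.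
  by rewrite sub_lineL => /andP.
subst b d; case: (eqVneq a 0) nz => [->|a0 _].
  rewrite vec4_eq0 eqxx /= andbT => c0; exists None => //=.
  by apply: (pt_eq c0); rewrite vec4Z !mulr0 mulr1.
exists (Some (c / a)) => //=; apply: (pt_eq a0).
by rewrite vec4Z !mulr0 !mulr1 mulrC divfK.
Qed.

Lemma lineL_cubic P : P \in cubic F -> ~~ (P <= lineL F)%MS.
Proof.
case/imsetP=> [[t|] _ ->]; rewrite /Cpt sub_lineL; last by rewrite eqxx eq_sym oner_eq0.
rewrite expf_eq0 /=; case: (eqVneq t 0) => // ->; rewrite expr0n oner_eq0.
by [].
Qed.

Lemma Pcount_lineL p :
  Pcount (isPtype p) (lineL F) = #|[set o | nroots (Lpt o) == ptype_nroots p]|.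
Proof.
rewrite /Pcount -[RHS](card_imset _ Lpt_inj); apply: eq_card => P.
rewrite [LHS]inE; apply/and3P/imsetP => [[Pp]|[o]].
  rewrite isPtypeE // => /and3P[_ _ rP]; rewrite lineL_points // => /imsetP[o _ E].
  by exists o; rewrite // inE -E.
rewrite inE => ro ->; have sL : (Lpt o <= lineL F)%MS.
  by rewrite lineL_points ?Lpt_points //; apply: imset_f.
split; rewrite ?Lpt_points // isPtypeE // Lpt_points ro andbT /=.
by apply/negP=> /lineL_cubic; rewrite sL.
Qed.

Lemma Lpt_osc_some b t : (Lpt (Some b) <= oscPlane (Some t))%MS =
  (1 + 3%:R * b * t ^+ 2 - t ^+ 3 == 0).
Proof. by rewrite sub_osc //; congr (_ == 0); ring. Qed.

Lemma Lpt_osc_inf b : (Lpt (Some b) <= oscPlane None)%MS = false.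
Proof. by rewrite sub_osc // oner_eq0. Qed.

Lemma Lpt_none_osc o : (Lpt None <= oscPlane o)%MS = (o == None) || (o == Some 0).
Proof.
rewrite sub_osc //; case: o => [t|]; last by rewrite eqxx.
rewrite (inj_eq Some_inj) /=.
rewrite (_ : _ - _ = 3%:R * t ^+ 2); last by ring.
by rewrite mulf_eq0 (negPf char_neq3) expf_eq0.
Qed.

(** No osculating plane contains l_L. The planes at infinity and 0 meet it in P(0, 0, 1, 0), and the
    one at any other t where b = (t^3 - 1) / (3 t^2). *)
Lemma card_Lpt_osc o : #|[set x | (Lpt x <= oscPlane o)%MS]| = 1%N.
Proof.
have [t0|/negPf oN] := boolP ((o == None) || (o == Some 0)).
  apply/eqP/cards1P; exists None; apply/setP=> -[b|]; rewrite !inE ?Lpt_none_osc ?t0 //.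
  case/orP: t0 => /eqP->; first by rewrite Lpt_osc_inf.
  by rewrite Lpt_osc_some !expr0n /= mulr0 addr0 subr0 oner_eq0.
case: o oN => // t; rewrite (inj_eq Some_inj) /= => t0.
have t0' : t != 0 by rewrite t0.
apply/eqP/cards1P; exists (Some ((t ^+ 3 - 1) / (3%:R * t ^+ 2))); apply/setP=> -[b|].
  rewrite !inE Lpt_osc_some (inj_eq Some_inj); apply/eqP/eqP => [E|->].
    have -> : t ^+ 3 - 1 = 3%:R * b * t ^+ 2.
      by apply/eqP; rewrite -subr_eq0 -oppr_eq0 -[X in _ == X]E; apply/eqP; ring.
    by field; rewrite ?t0'.
  by field; rewrite ?t0'.
by rewrite !inE Lpt_none_osc (inj_eq Some_inj) t0.
Qed.

(* P(1, 0, b, 1) lies on a tangent iff 4 b^3 = -1. *)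
Definition double_root_count := #|[set b : F | 4%:R * b ^+ 3 == -1]|.
(* Dividing the cubic 1 + 3 b u^2 - u^3 of P(1, 0, b, 1) by its root t leaves
   t^2 u^2 + u + t up to a scalar, and y = t^2 u turns this into y^2 + y + t^3. *)
Definition one_root_count := #|[set t : F | [forall y : F, y ^+ 2 + y + t ^+ 3 != 0]]|.

Lemma Lpt_nroots2 b : (nroots (Lpt (Some b)) == 2%N) = (4%:R * b ^+ 3 == -1).
Proof.
have nC : Lpt (Some b) \notin cubic F.
  by apply/negP=> /lineL_cubic; rewrite sub_lineL !eqxx.
apply/eqP/eqP => [/(nroots2_tangent char_neq3 (Lpt_points _))[[t|]]|E].
- rewrite sub_ptl => /lineThroughP[s [r]]; rewrite !vec4Z vec4D => /vec4_inj[e0 e1 e2 e3].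
  move: e3; rewrite mulr1 mulr0 addr0 => e3; rewrite -e3 !mul1r in e0 e1 e2.
  have t0 : t != 0.
    by apply: contraTneq (oner_neq0 F) => t0; rewrite e0 t0 !expr0n /= !mulr0 addr0 eqxx.
  have tr : t = - (2%:R * r).
    apply: (mulIf t0); apply/eqP; rewrite -subr_eq0 [X in _ == X]e1; apply/eqP; ring.
  rewrite e2 mulr1; transitivity (- (t ^+ 3 + r * (3%:R * t ^+ 2))); last by rewrite -e0.
  by rewrite tr; ring.
- rewrite sub_ptl => /lineThroughP[s [r]]; rewrite !vec4Z vec4D => /vec4_inj[_ _ _ /eqP].
  by rewrite !mulr0 addr0 oner_eq0.
(* The derivative of 1 + 3 b u^2 - u^3 is 3 u (2 b - u), so a double root must be 2 b, where the
   value is 1 + 4 b^3. *)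
apply: (@nroots_tangent _ char_neq3 _ (Some (2%:R * b))) => //; first exact: Lpt_points.
rewrite sub_ptl; apply/lineThroughP; exists 1, (- b); rewrite !vec4Z vec4D.
have {1}-> : 1 = - (4%:R * b ^+ 3) by rewrite E opprK.
by congr vec4; ring.
Qed.

Lemma Lpt_PT : #|[set o | nroots (Lpt o) == 2%N]| = double_root_count.+1.
Proof.
have r0 : nroots (Lpt None) == 2%N.
  rewrite /nroots (_ : [set o | _] = [set None; Some 0]) ?cards2 //.
  by apply/setP=> o; rewrite !inE Lpt_none_osc.
rewrite (cardsD1 None) inE r0 add1n; congr _.+1.
have inj : injective (@Some F) by move=> x y [].
rewrite /double_root_count -(card_imset _ inj); apply: eq_card => o.
rewrite !inE; apply/andP/imsetP => [[o0 ro]|[b]].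
  by case: o o0 ro => // b _ rb; exists b; rewrite // inE -Lpt_nroots2.
by rewrite inE -Lpt_nroots2 => rb ->.
Qed.

Lemma Lpt_nroots1 t : t != 0 ->
  (nroots (Lpt (Some ((t ^+ 3 - 1) / (3%:R * t ^+ 2)))) == 1%N) =
  [forall y, y ^+ 2 + y + t ^+ 3 != 0].
Proof.
move=> t0; set b := _ / _.
have root_u u : (Lpt (Some b) <= oscPlane (Some u))%MS =
    (u == t) || ((t ^+ 2 * u) ^+ 2 + t ^+ 2 * u + t ^+ 3 == 0).
  rewrite Lpt_osc_some -[u == t]subr_eq0 -mulf_eq0.
  have -> : (u - t) * ((t ^+ 2 * u) ^+ 2 + t ^+ 2 * u + t ^+ 3)
     = - (t ^+ 4 * (1 + 3%:R * b * u ^+ 2 - u ^+ 3)) by rewrite /b; field; rewrite ?t0.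
  by rewrite oppr_eq0 mulf_eq0 expf_eq0 (negPf t0).
apply/cards1P/forallP => [[o /setP E] y|noy].
  apply/negP=> /eqP Ey.
  (* If [t] is the only root, both [y] and [-1 - y] equal t^3; then 2 t^3 = -1 and t^6 + 2 t^3 = 0
     force 3 t^3 = 0. *)
  have other w : w ^+ 2 + w + t ^+ 3 = 0 -> w = t ^+ 3.
    move=> Ew; have root_o u : (Lpt (Some b) <= oscPlane (Some u))%MS -> Some u = o.
      by move=> ru; have := E (Some u); rewrite !inE ru => /esym/eqP.
    have t20 := expf_neq0 2 t0.
    have [eu] : Some (w / t ^+ 2) = Some t.
      rewrite (root_o t) ?root_u ?eqxx // (root_o (w / t ^+ 2)) // root_u.
      by rewrite [t ^+ 2 * _]mulrC divfK // Ew eqxx orbT.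
    by rewrite -[LHS](divfK t20) eu; ring.
  have ey := other _ Ey.
  have e1 : -1 - y = t ^+ 3 by apply: other; rewrite -Ey; ring.
  have e2 : t ^+ 3 + t ^+ 3 + 1 = 0 by rewrite -{1}e1 ey; ring.
  have : 3%:R * t ^+ 3 = 0.
    transitivity (2%:R * ((t ^+ 3) ^+ 2 + t ^+ 3 + t ^+ 3) - t ^+ 3 * (t ^+ 3 + t ^+ 3 + 1)).
      by ring.
    by rewrite e2 -{1 2}ey Ey !mulr0 subrr.
  by move/eqP; rewrite mulf_eq0 (negPf char_neq3) expf_eq0 (negPf t0).
exists (Some t); apply/setP=> -[u|]; last by rewrite !inE Lpt_osc_inf.
rewrite !inE root_u (inj_eq Some_inj); case: (u == t) => //=.
by rewrite (negPf (noy (t ^+ 2 * u))).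
Qed.

(** A point with one root is indexed by that root. The roots 0 and infinity occur only for P(0, 0,
    1, 0), which has two. *)
Lemma Lpt_P1 : #|[set o | nroots (Lpt o) == 1%N]| = one_root_count.
Proof.
pose bt (t : F) : option F := Some ((t ^+ 3 - 1) / (3%:R * t ^+ 2)).
have nz (t : F) : [forall y, y ^+ 2 + y + t ^+ 3 != 0] -> t != 0.
  by move/forallP/(_ 0); apply: contraNneq => ->; rewrite !expr0n /= !addr0.
have bt_root t o : t != 0 -> (Lpt o <= oscPlane (Some t))%MS -> o = bt t.
  case: o => [b|] t0; last by rewrite Lpt_none_osc (inj_eq Some_inj) (negPf t0).
  rewrite Lpt_osc_some => /eqP E; congr Some.
  have -> : t ^+ 3 - 1 = 3%:R * b * t ^+ 2.
    by apply/eqP; rewrite -subr_eq0 -oppr_eq0 -[X in _ == X]E; apply/eqP; ring.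
  by field; rewrite ?t0.
have root_bt t : t != 0 -> (Lpt (bt t) <= oscPlane (Some t))%MS.
  by move=> t0; rewrite Lpt_osc_some; apply/eqP; field; rewrite ?t0.
rewrite /one_root_count -[RHS](@card_in_imset _ _ bt); last first.
  move=> t u; rewrite !inE => ht hu E; have [t0 u0] := (nz t ht, nz u hu).
  have : nroots (Lpt (bt t)) == 1%N by rewrite Lpt_nroots1.
  case/cards1P=> o /setP Eo; have := Eo (Some t); have := Eo (Some u).
  rewrite !inE root_bt // E root_bt // => /esym/eqP <- /esym/eqP[].
  by [].
apply: eq_card => o; rewrite inE; apply/idP/imsetP => [ro|[t]]; last first.
  by rewrite inE => ht ->; rewrite Lpt_nroots1 // nz.
have /cards1P[o' /setP Eo] := ro; have := Eo o'; rewrite !inE eqxx.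
case: o' {Eo} => [t|] rt; last first.
  case: o ro rt => [b|]; first by rewrite Lpt_osc_inf.
  suff -> : nroots (Lpt None) = 2%N by [].
  rewrite /nroots (_ : [set o | _] = [set None; Some 0]) ?cards2 //.
  by apply/setP=> o; rewrite !inE Lpt_none_osc.
have t0 : t != 0.
  apply: contraTneq ro => t0; move: rt; rewrite t0; case: o => [b|_].
    by rewrite Lpt_osc_some !expr0n /= mulr0 addr0 subr0 oner_eq0.
  suff -> : nroots (Lpt None) = 2%N by [].
  rewrite /nroots (_ : [set o | _] = [set None; Some 0]) ?cards2 //.
  by apply/setP=> o; rewrite !inE Lpt_none_osc.
have Eo := bt_root _ _ t0 rt; exists t => //.
by rewrite inE -Lpt_nroots1 // -[Some _]/(bt t) -Eo.
Qed.

Lemma Pcount_lineL_rel : let P := fun p => Pcount (isPtype p) (lineL F) in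
  [/\ P pT = double_root_count.+1, P p1G = one_root_count, (3 * P p3G + 2 * P pT + P p1G = q.+1)%N &
      (P p3G + P pT + P p1G + P p0G = q.+1)%N].
Proof.
move=> P; rewrite /P !Pcount_lineL /= Lpt_PT Lpt_P1; split=> //.
  have r3 o : o \in [set: option F] -> (nroots (Lpt o) < 4)%N.
    by rewrite ltnS nroots_le3 // Lpt_points.
  have D : (\sum_(x in [set: option F]) nroots (Lpt x) = q.+1)%N.
    have := double_count [set: option F] [set: option F] (fun x o => (Lpt x <= oscPlane o)%MS).
    rewrite [RHS](eq_bigr (fun=> 1%N)) => [|o _]; last first.
      by apply: etrans (card_Lpt_osc o); apply: eq_card => x; rewrite !inE.
    rewrite sum1_card card_option_F => <-; apply: eq_bigr => x _.
    by apply: eq_card => o; rewrite !inE.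
  have := sum_by_value id r3; rewrite !big_ord_recl !big_ord0 /= D.
  have S k : #|[set x in [set: option F] | nroots (Lpt x) == k]| = #|[set o | nroots (Lpt o) == k]|.
    by apply: eq_card => o; rewrite !inE.
  by rewrite !S /bump /= !add1n Lpt_PT Lpt_P1; lia.
have r3 o : o \in [set: option F] -> (nroots (Lpt o) < 4)%N.
  by rewrite ltnS nroots_le3 // Lpt_points.
have := sum_by_value (fun=> 1%N) r3; rewrite !big_ord_recl !big_ord0 /=.
rewrite sum1_card card_option_F -/q => ->.
have S k : #|[set x in [set: option F] | nroots (Lpt x) == k]| = #|[set o | nroots (Lpt o) == k]|.
  by apply: eq_card => o; rewrite !inE.
by rewrite !S /bump /= !add1n Lpt_PT Lpt_P1; lia.
Qed.

End LineL.

(** * The orbit of l_L *)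

Section OrbitL.
Variable F : finFieldType.
Hypothesis char_neq3 : 3%:R != 0 :> F.
Hypothesis card_ge5 : (5 <= #|F|)%N.
Implicit Types (A B M N P l : 'M[F]_4).
#[local] Arguments Cpt : simpl never.
#[local] Arguments oscPlane : simpl never.
Let q := #|F|.

Lemma lineThrough_sub (a b : 'rV[F]_4) A :
  (lineThrough a b <= A)%MS = (a <= A)%MS && (b <= A)%MS.
Proof. by rewrite genmxE col_mx_sub. Qed.

Lemma lineL_subsp : lineL F \in subsp F 2.
Proof.
rewrite inE genmx_id eqxx andbT mxrank_gen; apply: inj_row_free => v.
rewrite -{1}[v]hsubmxK mul_row_col [lsubmx v]mx11_scalar [rsubmx v]mx11_scalar.
rewrite !mul_scalar_mx !vec4Z vec4D -vec4_0 => /vec4_inj[+ _ + _].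
rewrite !mulr0 !mulr1 addr0 add0r => l0 r0.
by rewrite -[v]hsubmxK [lsubmx v]mx11_scalar [rsubmx v]mx11_scalar l0 r0 !raddf0 row_mx0.
Qed.

Lemma polar_lineL : polar (lineL F) = lineL F.
Proof.
have le : (lineL F <= polar (lineL F))%MS.
  rewrite lineThrough_sub -!sub_ptl; apply/andP; split; rewrite sub_polarC;
    by rewrite lineThrough_sub -!sub_ptl !polar_sub_pt; apply/andP; split; apply/eqP; ring.
rewrite -[LHS]genmx_polar -[RHS](points_genmx lineL_subsp); apply/esym/genmxP.
rewrite -(mxrank_leqif_eq le) rank_polar //.
by have := lineL_subsp; rewrite inE => /andP[/eqP->].
Qed.

Lemma orbitLP l : reflect (exists2 M, M \in Gq F & l = act M (lineL F)) (l \in orbitL F).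
Proof. by apply: (iffP imsetP). Qed.

Lemma orbit_act M l : M \in Gq F -> l \in orbitL F -> act M l \in orbitL F.
Proof.
move=> GM /orbitLP[N GN ->]; rewrite act_comp.
by apply/orbitLP; exists (N *m M) => //; apply: Gq_mul.
Qed.

Lemma orbit_genmx l : l \in orbitL F -> <<l>>%MS = l.
Proof. by case/orbitLP=> M _ ->; apply: genmx_act. Qed.

Lemma polar_orbit l : l \in orbitL F -> polar l = l.
Proof.
case/orbitLP=> M GM ->.
by rewrite polar_act ?polar_lineL ?(points_genmx lineL_subsp) //; apply: Gq_simil.
Qed.

Lemma orbit_cubic l P : l \in orbitL F -> P \in cubic F -> ~~ (P <= l)%MS.
Proof.
case/orbitLP=> M GM -> Pc; have gP := cubic_genmx Pc.
rewrite -(actKV GM gP) act_sub ?Gq_unit //; apply: lineL_cubic.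
by rewrite -(Gq_cubic GM) ?genmx_act // actKV.
Qed.

Lemma Pcount_orbit p l : l \in orbitL F ->
  Pcount (isPtype p) l = Pcount (isPtype p) (lineL F).
Proof.
case/orbitLP=> M GM ->; have uM := Gq_unit GM.
rewrite /Pcount -[RHS](@card_in_imset _ _ (act M)); last first.
  by move=> P Q /setIdP[Pp _] /setIdP[Qp _]; apply: act_inj => //; apply: points_genmx; eassumption.
apply: eq_card => Q; apply/setIdP/imsetP => [[Qp /andP[tQ Ql]]|[P /setIdP[Pp /andP[tP Pl]] ->]].
  have gQ := points_genmx Qp; exists (act (invmx M) Q); last by rewrite actKV.
  have Q'p : act (invmx M) Q \in points F by apply: act_subsp => //; rewrite unitmx_inv.
  apply/setIdP; split=> //; rewrite -(isPtype_act _ _ _ GM) // -(act_sub _ _ uM) actKV //.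
  by rewrite tQ.
split; first exact: act_subsp.
by rewrite isPtype_act // act_sub // tP.
Qed.

Lemma polar_points_inj : {in points F &, injective (@polar F)}.
Proof.
move=> P Q Pp Qp /(congr1 (@polar F)).
by rewrite !polarK // ?(points_genmx Pp) ?(points_genmx Qp).
Qed.

Lemma plane_polar pi : pi \in planes F -> exists2 P, P \in points F & pi = polar P.
Proof.
move=> pp; exists (polar pi); first exact: (polar_subsp char_neq3 _ pp).
by rewrite polarK // (points_genmx pp).
Qed.

Lemma Picount_orbit p l : l \in orbitL F ->
  Picount (isPlaneTypeOf p) l = Pcount (isPtype p) l.
Proof.
move=> lO; rewrite /Pcount -[RHS](@card_in_imset _ _ (@polar F)); last first.
  by move=> P Q /setIdP[Pp _] /setIdP[Qp _]; apply: polar_points_inj.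
apply: eq_card => pi; apply/setIdP/imsetP => [[pp /andP[tpi lpi]]|[P /setIdP[Pp /andP[tP Pl]] ->]].
  have [P Pp E] := plane_polar pp; exists P => //; apply/setIdP; split=> //.
  by rewrite -isPlaneType_polar // -E tpi -(polar_orbit lO) sub_polarC -E.
split; first exact: (polar_subsp char_neq3 _ Pp).
by rewrite isPlaneType_polar // tP sub_polarC polar_orbit.
Qed.

Lemma Lambdacount_polar P : Lambdacount (polar P) = Lcount P.
Proof.
apply: eq_card => l; apply/setIdP/setIdP => -[lO h]; split=> //.
  by rewrite -(polar_orbit lO) sub_polarC.
by rewrite sub_polarC polar_orbit.
Qed.

Lemma Lcount_act M P : M \in Gq F -> <<P>>%MS = P -> Lcount (act M P) = Lcount P.
Proof.
move=> GM gP; have uM := Gq_unit GM.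
rewrite /Lcount -[RHS](@card_in_imset _ _ (act M)); last first.
  by move=> l l' /setIdP[/orbit_genmx gl _] /setIdP[/orbit_genmx gl' _]; apply: act_inj.
apply: eq_card => l; apply/setIdP/imsetP => [[lO Pl]|[l' /setIdP[lO Pl] ->]].
  exists (act (invmx M) l); last by rewrite actKV ?orbit_genmx.
  apply/setIdP; split; first exact: orbit_act (Gq_inv GM) lO.
  by rewrite -(act_sub _ _ uM) actKV ?orbit_genmx.
by split; [exact: orbit_act | rewrite act_sub].
Qed.

Lemma incidence_count p P : isPtype p P ->
  (#|ptype_set F p| * Lcount P = #|orbitL F| * Pcount (isPtype p) (lineL F))%N.
Proof.
move=> tP; have := double_count (ptype_set F p) (orbitL F) (fun P l => (P <= l)%MS).
rewrite (eq_bigr (fun=> Lcount P)) => [|Q]; last first.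
  case/setIdP=> Qp tQ; have [M GM <-] := ptype_trans char_neq3 card_ge5 tP tQ.
  by rewrite -[RHS](Lcount_act GM) // (points_genmx (k := 1)) //; move: tP; rewrite isPtypeE // => /and3P[].
rewrite sum_nat_const => ->.
rewrite (eq_bigr (fun=> Pcount (isPtype p) (lineL F))) => [|l lO]; first by rewrite sum_nat_const.
rewrite -(Pcount_orbit p lO); apply: eq_card => Q.
apply/setIdP/setIdP => [[/setIdP[Qp tQ] Ql]|[Qp /andP[tQ Ql]]]; first by rewrite tQ.
by split=> //; apply/setIdP.
Qed.

Definition line_e2 (s : F) := lineThrough (vec4 0 0 1 0) (vec4 1 0 0 s).

Lemma line_e2_inj : injective line_e2.
Proof.
move=> s s' E; have : (vec4 1 0 0 s <= line_e2 s')%MS.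
  by rewrite -E; apply/lineThroughP; exists 0, 1; rewrite scale0r add0r scale1r.
case/lineThroughP=> a [b]; rewrite !vec4Z vec4D => /vec4_inj[+ _ _ ->].
by rewrite !mulr0 mulr1 !add0r => <-; rewrite mul1r.
Qed.

Lemma scaling_lineL (k : F) : k != 0 -> act (Smat 1 0 0 k) (lineL F) = line_e2 (k ^+ 3).
Proof.
move=> k0; rewrite act_lineThrough !scaling_vec4 !mulr0 !mulr1.
rewrite /line_e2 /lineThrough -[LHS]genmx_id -[RHS]genmx_id -!/(lineThrough _ _).
apply/genmxP; rewrite !lineThrough_sub; apply/andP; split; apply/andP; split; apply/lineThroughP.
- by exists 0, 1; rewrite scale0r add0r scale1r.
- by exists (k ^+ 2), 0; rewrite scale0r addr0 vec4Z !mulr0 mulr1.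
- by exists 0, (k ^- 2); rewrite scale0r add0r vec4Z !mulr0 mulVf ?expf_neq0.
by exists 1, 0; rewrite scale0r addr0 scale1r.
Qed.

(* The stabiliser of [lineL] is transitive on its T-points: for 4 b^3 = -1 the number
   r = -2 b is a cube root of 2, and the cubic of P(1, 0, b, 1) has the double root -r
   and the simple root r / 2, to which the matrix below sends 0 and infinity. *)
Lemma stab_lineL_T o : nroots (Lpt o) = 2%N ->
  exists2 M, M \in Gq F & act M (lineL F) = lineL F /\ act M (Lpt None) = Lpt o.
Proof.
case: o => [b /eqP|_]; last first.
  exists 1%:M; first exact: Gq1.
  by rewrite !act1 ?(points_genmx (Lpt_points _)) ?(points_genmx lineL_subsp).
rewrite Lpt_nroots2 // => /eqP E; pose r := - (2%:R * b).
have b0 : b != 0.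
  apply: contra_eq_neq E => ->; rewrite expr0n mulr0 eq_sym oppr_eq0.
  exact: oner_neq0.
have n2 : (2%:R : F) != 0.
  apply: contra_eq_neq E => n2; have -> : 4%:R = 2%:R * 2%:R :> F by ring.
  by rewrite n2 !mul0r eq_sym oppr_eq0 oner_neq0.
have r3 : r ^+ 3 = 2%:R.
  transitivity (- (2%:R * (4%:R * b ^+ 3))); first by rewrite /r; ring.
  by rewrite E; ring.
have D0 : Smat_det r (r ^+ 2) 2%:R (- r) != 0.
  have -> : Smat_det r (r ^+ 2) 2%:R (- r) = - (3%:R * r ^+ 2) by rewrite /Smat_det; ring.
  by rewrite oppr_eq0 mulf_neq0 // expf_neq0 // /r oppr_eq0 mulf_neq0.
have GM := Smat_Gq char_neq3 D0; exists (Smat r (r ^+ 2) 2%:R (- r)) => //.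
have e2E : vec4 0 0 1 0 *m Smat r (r ^+ 2) 2%:R (- r) = 6%:R * r ^+ 2 *: vec4 1 0 b 1.
  rewrite vec4_mul !vec4Z !vec4D; congr vec4; rewrite /=.
  - by transitivity (3%:R * r ^+ 3 * r ^+ 2); [ring | rewrite r3; ring].
  - by transitivity (0 : F); ring.
  - have -> : b = - r / 2%:R by rewrite /r; field.
    have -> : 6%:R * r ^+ 2 * (- r / 2%:R) = - 3%:R * r ^+ 3 by field.
    by ring.
  - by ring.
have e1E : vec4 1 0 0 1 *m Smat r (r ^+ 2) 2%:R (- r) = 6%:R *: vec4 1 0 r 1.
  have r6 : r ^+ 6 = 4%:R by rewrite -[6%N]/(3 * 2)%N exprM r3; ring.
  have r4 : r ^+ 4 = 2%:R * r by rewrite exprSr r3.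
  rewrite vec4_mul !vec4Z !vec4D; congr vec4; rewrite /=.
  - by transitivity (r ^+ 3 + r ^+ 6); [ring | rewrite r3 r6; ring].
  - by transitivity (r ^+ 2 * (2%:R - r ^+ 3)); [ring | rewrite r3; ring].
  - by transitivity (4%:R * r + r ^+ 4); [ring | rewrite r4; ring].
  - by transitivity (8%:R - r ^+ 3); [ring | rewrite r3; ring].
have n6 : (6%:R : F) != 0 by rewrite (_ : 6%:R = 2%:R * 3%:R :> F) ?mulf_neq0 //; ring.
split; last first.
  rewrite act_pt e2E; apply: (@pt_eq _ _ _ (6%:R * r ^+ 2)) => //.
  by rewrite mulf_neq0 // expf_neq0 // /r oppr_eq0 mulf_neq0.
have le : (act (Smat r (r ^+ 2) 2%:R (- r)) (lineL F) <= lineL F)%MS.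
  rewrite act_lineThrough e1E e2E lineThrough_sub -!sub_ptl !vec4Z !sub_lineL.
  by rewrite !mulr0 !eqxx.
rewrite -[LHS]genmx_act -[RHS](points_genmx lineL_subsp); apply/genmxP.
by rewrite -(mxrank_leqif_eq le) rank_act ?Gq_unit.
Qed.

(** The form of P(0, 0, 1, 0) has exactly the roots 0 and infinity, so [M] fixes or exchanges them.
    An exchange would be a scaling followed by the swap, which takes the point to P(0, 1, 0, 0). *)
Lemma fix_T_scaling M : M \in Gq F -> act M (Lpt None) = Lpt None ->
  exists2 k, k != 0 & forall A, act M A = act (Smat 1 0 0 k) A.
Proof.
move=> GM fixT; have uM := Gq_unit GM.
have gC o : <<Cpt o>>%MS = Cpt o := cubic_genmx (Cpt_cubic o).
have move_root o : (o == None) || (o == Some 0) ->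
    exists2 o', (o' == None) || (o' == Some 0) & act M (Cpt o) = Cpt o'.
  rewrite -Lpt_none_osc // => h.
  have /imsetP[o' _ E] : act M (Cpt o) \in cubic F by rewrite Gq_cubic ?Cpt_cubic.
  exists o' => //; rewrite -Lpt_none_osc // -polar_Cpt // -E polar_act //; last exact: Gq_simil.
  by rewrite -fixT act_sub // polar_Cpt.
have diag N : N \in Gq F -> act N (Cpt None) = Cpt None -> act N (Cpt (Some 0)) = Cpt (Some 0) ->
    exists2 k, k != 0 & forall A, act N A = act (Smat 1 0 0 k) A.
  move=> GN h1 h2; have [g [k [g0 k0 ->]]] := Gq_diag card_ge5 GN h1 h2.
  by exists k => // A; rewrite act_scale.
have [o1 ho1 E1] := move_root None isT.
have [o2 ho2 E2] : exists2 o', (o' == None) || (o' == Some 0) & act M (Cpt (Some 0)) = Cpt o'.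
  by apply: move_root; rewrite eqxx orbT.
have ne : o1 != o2.
  apply/eqP=> e12; suff /Cpt_inj : Cpt None = Cpt (Some (0 : F)) by [].
  by apply: (@act_inj _ M); rewrite ?gC // E1 E2 e12.
have swap_inf : act (Smat 0 1 1 0) (Cpt None) = Cpt (Some (0 : F)).
  by rewrite /Cpt act_pt swap_vec4 !expr0n.
have swap_0 : act (Smat 0 1 1 0) (Cpt (Some (0 : F))) = Cpt None.
  by rewrite /Cpt act_pt !expr0n swap_vec4.
case/orP: ho1 ne E1 E2 => /eqP->; case/orP: ho2 => /eqP->;
  rewrite ?eqxx // => _ E1 E2; first exact: diag.
have [||k k0 kE] := diag (M *m Smat 0 1 1 0) (Gq_mul GM (Gq_swap char_neq3)).
- by rewrite -act_comp E1.
- by rewrite -act_comp E2.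
have := kE (Lpt None); rewrite -act_comp fixT /= !act_pt swap_vec4 scaling_vec4.
case/pt_inj; first by rewrite vec4_eq0 oner_eq0 andbF.
by move=> c _; rewrite vec4Z => /vec4_inj[_ /eqP]; rewrite !mulr0 oner_eq0.
Qed.

(** If M l_L passes through P(0, 0, 1, 0), the preimage of this point is a T-point of l_L. The
    stabiliser of l_L can correct [M] so that it fixes P(0, 0, 1, 0), and then it acts as a
    scaling. *)
Lemma Lcount_T0 : Lcount (Lpt (None : option F)) = #|[set k ^+ 3 | k in predC1 (0 : F)]|.
Proof.
rewrite /Lcount -(card_imset _ line_e2_inj); apply: eq_card => l.
apply/setIdP/imsetP => [[/orbitLP[M GM ->] Tl]|[s /imsetP[k k0 ->] ->]]; last first.
  rewrite inE in k0; split.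
    by rewrite -scaling_lineL //; apply/orbitLP; exists (Smat 1 0 0 k); rewrite ?Gq_scaling.
  rewrite sub_ptl; apply/lineThroughP; exists 1, 0.
  by rewrite scale0r addr0 scale1r.
have Tp := Lpt_points (None : option F); have gT := points_genmx Tp.
pose Q := act (invmx M) (Lpt None).
have Qp : Q \in points F by apply: act_subsp => //; rewrite unitmx_inv Gq_unit.
have : (Q <= lineL F)%MS by rewrite -(act_sub _ _ (Gq_unit GM)) actKV.
rewrite lineL_points // => /imsetP[o _ Qo].
have rT : nroots (Lpt (None : option F)) = 2%N by rewrite nroots_normal_form ?oner_eq0 ?eqxx.
have [h Gh [hL hT]] : exists2 h, h \in Gq F & act h (lineL F) = lineL F /\ act h (Lpt None) = Lpt o.
  by apply: stab_lineL_T; rewrite -Qo nroots_act // Gq_inv.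
have [||k k0 kE] := @fix_T_scaling (h *m M).
- exact: Gq_mul.
- by rewrite -act_comp hT -Qo actKV.
exists (k ^+ 3); first by apply/imsetP; exists k; rewrite ?inE.
by rewrite -scaling_lineL // -kE -act_comp hL.
Qed.

Lemma card_cubes :
  (#|[set (k ^+ 3)%R | k in predC1 (0%R : F)]| * #|[set w : F | w ^+ 3 == 1%R]| = q.-1)%N.
Proof.
have := double_count [set k ^+ 3 | k in predC1 (0 : F)] [set k : F | k != 0] (fun s k => k ^+ 3 == s).
rewrite (eq_bigr (fun=> #|[set w : F | w ^+ 3 == 1]|)) => [|s]; last first.
  case/imsetP=> k; rewrite inE => k0 ->; rewrite -[RHS](card_imset _ (mulfI k0)).
  apply: eq_card => x; rewrite !inE; apply/andP/imsetP => [[x0 /eqP E]|[w]].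
    exists (x / k); last by rewrite mulrC divfK.
    by rewrite inE expr_div_n E divff // expf_neq0.
  rewrite inE => /eqP w1 ->; rewrite exprMn w1 mulr1 eqxx mulf_neq0 //.
  by apply: contra_eq_neq w1 => ->; rewrite expr0n eq_sym oner_neq0.
rewrite sum_nat_const => ->; rewrite (eq_bigr (fun=> 1%N)) => [|k].
  by rewrite sum1_card -(cardC1 (0 : F)); apply: eq_card => k; rewrite !inE.
rewrite inE => k0; apply/eqP/cards1P; exists (k ^+ 3); apply/setP=> s.
rewrite in_set1; apply/setIdP/eqP => [[_ /eqP->]|->] //.
by split=> //; apply: imset_f; rewrite inE.
Qed.

End OrbitL.

(** * Cubes and character sums *)

Section FieldCounts.
Variable F : finFieldType.
Let q := #|F|.

(** Translation by 1 permutes the field and adds q times 1 to the sum of its elements. *)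
Lemma card_natr0 : q%:R = 0 :> F.
Proof.
apply: (addrI (\sum_(x : F) x)); rewrite addr0 [RHS](reindex_inj (addIr 1)) /=.
by rewrite big_split /= sumr_const.
Qed.

Lemma natr_mod d r : d%:R = 0 :> F -> (q %% d)%N = r -> r%:R = 0 :> F.
Proof.
move=> d0 <-; have := card_natr0; rewrite {1}(divn_eq q d) natrD natrM d0 mulr0.
by rewrite add0r.
Qed.

Lemma char_neq3_mod : (q %% 3 = 1 \/ q %% 3 = 2)%N -> 3%:R != 0 :> F.
Proof.
move=> h; apply/eqP=> z3; case: h => /(natr_mod z3); first by move/eqP; rewrite oner_eq0.
move=> z2; have : 1 = 3%:R - 2%:R :> F by ring.
by rewrite z3 z2 subr0 => /eqP; rewrite oner_eq0.
Qed.

Lemma char_neq2_odd : odd q -> 2%:R != 0 :> F.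
Proof.
move=> oq; apply/eqP=> z2; have /eqP := natr_mod z2 (erefl _).
by rewrite modn2 oq oner_eq0.
Qed.

Lemma char2_pow n : q = (2 ^ n)%N -> 2%:R = 0 :> F.
Proof.
move=> E; have := card_natr0; rewrite E natrX => /eqP.
by rewrite expf_eq0 => /andP[_ /eqP].
Qed.

(** If w^3 = 1, then w = w^q = w^2, so w = 1. *)
Lemma cube_inj : (q %% 3 = 2)%N -> injective (fun x : F => x ^+ 3).
Proof.
move=> q2; have one (w : F) : w ^+ 3 = 1 -> w = 1.
  move=> w3; have w0 : w != 0.
    by apply: contra_eq_neq w3 => ->; rewrite expr0n eq_sym oner_neq0.
  have := expf_card w; rewrite -/q (divn_eq q 3) q2 mulnC exprD exprM w3 expr1n mul1r.
  by move=> E; apply: (mulfI w0); rewrite mulr1 -expr2.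
move=> x y /= E; case: (eqVneq y 0) => [y0|y0].
  by move: E; rewrite y0 expr0n => /eqP; rewrite expf_eq0 => /andP[_ /eqP].
rewrite -[LHS](divfK y0) (one (x / y)) ?mul1r //.
by rewrite expr_div_n E divff // expf_neq0.
Qed.

Lemma card_cube_roots1_inj : (q %% 3 = 2)%N -> #|[set w : F | w ^+ 3 == 1]| = 1%N.
Proof.
move=> q2; apply/eqP/cards1P; exists 1; apply/setP=> w; rewrite !inE.
by apply/eqP/eqP => [E|->]; [apply: (cube_inj q2); rewrite E expr1n | rewrite expr1n].
Qed.

(** With k = (q - 1) / 3, the polynomial X^k - 1 has too few roots to kill all nonzero elements; any
    x^k != 1 is a primitive cube root of unity. *)
Lemma cube_root_unity : (q %% 3 = 1)%N -> exists w : F, w ^+ 2 + w + 1 = 0.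
Proof.
move=> q1; set k := (q %/ 3)%N; have qE : q = (k * 3 + 1)%N by rewrite {1}(divn_eq q 3) q1.
have q1' : (1 < q)%N by apply: finNzRing_gt1.
have k0 : (0 < k)%N by rewrite lt0n; apply: contraTneq q1' => k0; rewrite qE k0.
have [x x0 xk] : exists2 x : F, x != 0 & x ^+ k != 1.
  apply/exists_inP; apply: contraTT isT => /exists_inPn h.
  have /(max_poly_roots (p := 'X^k - 1)) : all (root ('X^k - 1)) (enum (predC1 (0 : F))).
    apply/allP=> t; rewrite mem_enum inE => t0.
    by rewrite rootE !hornerE subr_eq0; have := h t t0; rewrite negbK.
  rewrite -size_poly_eq0 size_XnsubC // enum_uniq => /(_ isT isT).
  by rewrite -cardE cardC1 -/q qE; lia.
exists (x ^+ k); apply: (mulfI (x := x ^+ k - 1)); first by rewrite subr_eq0.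
rewrite mulr0; transitivity ((x ^+ k) ^+ 3 - 1); first by ring.
apply/eqP; rewrite subr_eq0 -exprM; apply/eqP/(mulIf x0).
by rewrite mul1r -exprSr -addn1 -qE expf_card.
Qed.

Lemma card_cube_roots1 : (q %% 3 = 1)%N -> #|[set w : F | w ^+ 3 == 1]| = 3%N.
Proof.
move=> q1; have [w Ew] := cube_root_unity q1.
have n3 : 3%:R != 0 :> F by apply: char_neq3_mod; left.
have w1 : w != 1.
  by apply: contra_neq n3 => w1; rewrite -Ew w1; ring.
have w2 : w ^+ 2 = - w - 1 by apply/eqP; rewrite -subr_eq0 -[X in _ == X]Ew; apply/eqP; ring.
have -> : [set w : F | w ^+ 3 == 1] = 1 |: [set w; w ^+ 2].
  apply/setP=> x; rewrite !inE -subr_eq0.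
  have -> : x ^+ 3 - 1 = (x - 1) * ((x - w) * (x - w ^+ 2)).
    transitivity ((x - 1) * (x ^+ 2 + x + 1) - (w ^+ 2 + w + 1) * (x - 1) * (x + 1 - w)); last by ring.
    by rewrite Ew; ring.
  by rewrite !mulf_eq0 !subr_eq0.
have w0 : w != 0.
  by apply: contraTneq (oner_neq0 F) => w0; rewrite -Ew w0 expr0n !add0r eqxx.
rewrite cardsU1 cards2 !inE negb_or [1 == w]eq_sym w1 /=.
have -> : 1 != w ^+ 2.
  apply: contra_neq n3 => E; have Ew' : w = - 2%:R.
    by move: Ew; rewrite -E => Ew; apply/eqP; rewrite -subr_eq0 -[X in _ == X]Ew; apply/eqP; ring.
  by transitivity ((- 2%:R) ^+ 2 - 1 : F); [ring | rewrite -Ew' -E subrr].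
have -> // : w != w ^+ 2.
by rewrite expr2 -[X in X != _]mulr1 (inj_eq (mulfI w0)) eq_sym.
Qed.

Lemma double_root_count_char2 : 2%:R = 0 :> F -> double_root_count F = 0%N.
Proof.
move=> z2; apply/eqP; rewrite cards_eq0; apply/eqP/setP=> b; rewrite !inE.
have -> : 4%:R = 2%:R * 2%:R :> F by ring.
by rewrite z2 !mul0r eq_sym oppr_eq0 oner_eq0.
Qed.

Lemma double_root_count_inj : (q %% 3 = 2)%N -> 2%:R != 0 :> F -> double_root_count F = 1%N.
Proof.
move=> q2 n2; have n4 : 4%:R != 0 :> F.
  by rewrite (_ : 4%:R = 2%:R * 2%:R) ?mulf_neq0 //; ring.
have [g _ gK] := injF_bij (cube_inj q2).
apply/eqP/cards1P; exists (g (- 4%:R^-1)); apply/setP=> b; rewrite !inE.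
apply/eqP/eqP => [E|->]; last by rewrite gK; field.
apply: (cube_inj q2); rewrite gK /=; apply: (mulfI n4); rewrite E; field.
by rewrite n4.
Qed.

Lemma double_root_count_noncube : 2%:R != 0 :> F -> ~ (exists x : F, x ^+ 3 = 2%:R) ->
  double_root_count F = 0%N.
Proof.
move=> n2 nc; apply/eqP; rewrite cards_eq0; apply/eqP/setP=> b; rewrite !inE.
apply/eqP=> E; apply: nc; exists (- 2%:R * b).
by transitivity (- 2%:R * (4%:R * b ^+ 3)); [ring | rewrite E; ring].
Qed.

(** If x^3 = 2, then b = - x / 2 is one solution, and the others are its multiples by cube roots of
    unity. *)
Lemma double_root_count_cube : (q %% 3 = 1)%N -> 2%:R != 0 :> F ->
  (exists x : F, x ^+ 3 = 2%:R) -> double_root_count F = 3%N.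
Proof.
move=> q1 n2 [x Ex]; apply: etrans (card_cube_roots1 q1); rewrite /double_root_count.
have x0 : x != 0 by apply: contra_eq_neq Ex => ->; rewrite expr0n eq_sym.
have c0 : - (x / 2%:R) != 0 by rewrite oppr_eq0 mulf_neq0 ?invr_eq0.
rewrite -[RHS](card_imset _ (mulfI c0)); apply: eq_card => b; rewrite inE.
apply/eqP/imsetP => [E|[w]].
  exists (b / - (x / 2%:R)); last by rewrite mulrC divfK.
  have n8 : 8%:R != 0 :> F.
    by rewrite (_ : 8%:R = 2%:R * 2%:R * 2%:R) ?mulf_neq0 //; ring.
  rewrite inE; apply/eqP; apply: (mulIf (expf_neq0 3 c0)).
  rewrite -exprMn divfK // mul1r; apply: (mulfI n8).
  transitivity (2%:R * (4%:R * b ^+ 3)); first by ring.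
  rewrite E; transitivity (- x ^+ 3); first by rewrite Ex; ring.
  by field.
rewrite inE => /eqP w1 ->; transitivity (- (x ^+ 3 * w ^+ 3) / 2%:R); first by field.
by rewrite Ex w1; field.
Qed.

(** Completing the square turns y^2 + y + t^3 = 0 into (2 y + 1)^2 = 1 - 4 t^3; then b = - t. *)
Lemma one_root_count_Nq : 2%:R != 0 :> F -> one_root_count F = Nq F.
Proof.
move=> n2; rewrite /one_root_count -(card_imset _ oppr_inj); apply: eq_card => b.
rewrite inE; apply/imsetP/existsPn => [[t] + -> y|h].
  rewrite inE => /forallP/(_ ((y - 1) / 2%:R)); apply: contraNneq => E.
  apply/eqP; apply: (mulfI (_ : 2%:R * 2%:R != 0 :> F)); first by rewrite mulf_neq0.
  transitivity (y ^+ 2 - 1 + 4%:R * t ^+ 3); first by field.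
  by rewrite E; ring.
exists (- b); last by rewrite opprK.
rewrite inE; apply/forallP=> y; apply: contraNneq (h (2%:R * y + 1)) => E.
rewrite -subr_eq0; apply/eqP.
transitivity (4%:R * (y ^+ 2 + y + (- b) ^+ 3)); first by ring.
by rewrite E mulr0.
Qed.

(** The values of y^2 + y at [y] and at [-1 - y] agree and nothing else collides, so the map is
    2-to-1 away from fixed points of this involution. *)
Lemma card_wp_image (A : {set F}) : (forall y, y \in A -> -1 - y \in A /\ -1 - y != y) ->
  (2 * #|[set (y ^+ 2 + y)%R | y in A]| = #|A|)%N.
Proof.
move=> hA; have := double_count [set y ^+ 2 + y | y in A] A (fun c y => y ^+ 2 + y == c).
rewrite (eq_bigr (fun=> 2%N)) => [|c /imsetP[y yA ->]]; last first.
  have [y'A ne] := hA y yA; apply/eqP/cards2P; exists y, (-1 - y); rewrite eq_sym; split=> //.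
  apply/setP=> z; rewrite in_set2 inE -subr_eq0.
  have -> : z ^+ 2 + z - (y ^+ 2 + y) = (z - y) * (z - (-1 - y)) by ring.
  rewrite mulf_eq0 !subr_eq0; apply/andP/orP => [[_ /orP]|] //.
  by case=> /eqP->; rewrite ?yA ?y'A ?eqxx ?orbT.
rewrite sum_nat_const mulnC => ->; rewrite (eq_bigr (fun=> 1%N)) ?sum1_card // => y yA.
apply/eqP/cards1P; exists (y ^+ 2 + y); apply/setP=> c; rewrite in_set1.
by apply/setIdP/eqP => [[_ /eqP]|->] //; split=> //; apply: imset_f.
Qed.

Lemma one_root_count_bij : (q %% 3 = 2)%N ->
  one_root_count F = #|[set c : F | [forall y : F, y ^+ 2 + y + c != 0]]|.
Proof.
move=> q2; rewrite /one_root_count -[RHS](on_card_preimset (f := fun x : F => x ^+ 3)).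
  by apply: eq_card => t; rewrite !inE.
exact/onW_bij/injF_bij/cube_inj.
Qed.

(* The Artin-Schreier map; in characteristic 2 its image is the kernel of the
   absolute trace, which makes [psi] below the character (-1)^Tr. *)
Definition wp (y : F) := y ^+ 2 + y.
Definition wpim := [set wp y | y : F].

Lemma card_nowp :
  (#|[set c : F | [forall y : F, (y ^+ 2 + y + c)%R != 0%R]]| + #|wpim| = q)%N.
Proof.
rewrite addnC -[RHS]/#|F| -[RHS](cardsC wpim); congr (_ + _)%N; rewrite -(card_imset _ oppr_inj).
apply: eq_card => c; rewrite in_setC; apply/imsetP/idP => [[d + ->]|nc].
  rewrite inE => /forallP h; apply/imsetP=> -[y _ E].
  by have /eqP[] := h y; rewrite -/(wp y) -E addNr.
exists (- c); last by rewrite opprK.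
rewrite inE; apply/forallP=> y; apply: contraNneq nc => E; apply/imsetP; exists y => //.
by apply/eqP; rewrite -subr_eq0 -oppr_eq0 -[X in _ == X]E; apply/eqP; rewrite /wp; ring.
Qed.

Lemma one_root_count_inj_odd : (q %% 3 = 2)%N -> 2%:R != 0 :> F -> (2 * one_root_count F = q.-1)%N.
Proof.
move=> q2 n2; rewrite one_root_count_bij //; pose y0 : F := - 2%:R^-1.
have E0 : -1 - y0 = y0 by rewrite /y0; field.
have C : (2 * #|[set (y ^+ 2 + y)%R | y in ~: [set y0]]| = q.-1)%N.
  rewrite card_wp_image ?cardsC1 // => y; rewrite !inE => ne; split.
    by apply: contra_neq ne => E; rewrite -[y](subKr (-1)) E.
  apply: contra_neq ne => E; apply: (mulfI n2); rewrite /y0 mulrN divff //.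
  by apply/eqP; rewrite -subr_eq0; apply/eqP; transitivity (y - (-1 - y)); [ring | rewrite E subrr].
have W : #|wpim| = (#|[set (y ^+ 2 + y)%R | y in ~: [set y0]]|).+1.
  rewrite (cardsD1 (wp y0)) imset_f // add1n; congr _.+1; apply: eq_card => c.
  rewrite in_setD1; apply/andP/imsetP => [[ne /imsetP[y _ Ec]]|[y]].
    by exists y => //; rewrite !inE; apply: contra_neq ne => <-.
  rewrite !inE => ne ->; split; last by apply/imsetP; exists y.
  rewrite -subr_eq0 /wp; have -> : y ^+ 2 + y - (y0 ^+ 2 + y0) = (y - y0) * (y - (-1 - y0)) by ring.
  by rewrite E0 mulf_eq0 orbb subr_eq0.
have := card_nowp; have : (1 < q)%N by apply: finNzRing_gt1.
by rewrite W; move: C; lia.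
Qed.

(** * The cubic character sum in characteristic 2 *)

Section Char2.
Hypothesis char2 : 2%:R = 0 :> F.

Lemma addrr2 (x : F) : x + x = 0.
Proof. by rewrite -mulr2n -mulr_natl char2 mul0r. Qed.

Lemma card_wpim2 : (2 * #|wpim| = q)%N.
Proof.
rewrite /q -cardsT -(@card_wp_image [set: F]) => [|y _].
  by congr (2 * _)%N; apply: eq_card => c; apply/imsetP/imsetP => -[y _ ->]; exists y.
split; rewrite ?inE //; rewrite -subr_eq0.
have -> : -1 - y - y = -1 - 2%:R * y by ring.
by rewrite char2 mul0r subr0 oppr_eq0 oner_eq0.
Qed.

Lemma one_root_count_inj_even : (q %% 3 = 2)%N -> (2 * one_root_count F = q)%N.
Proof.
by move=> q2; have := card_nowp; have := card_wpim2; rewrite one_root_count_bij //; lia.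
Qed.

Lemma wpD (x y : F) : wp (x + y) = wp x + wp y.
Proof.
rewrite /wp; transitivity (x ^+ 2 + x + (y ^+ 2 + y) + 2%:R * x * y); first by ring.
by rewrite char2 !mul0r addr0.
Qed.

Definition psi (c : F) : int := if c \in wpim then 1 else -1.

Lemma wpimD x y : x \in wpim -> (x + y \in wpim) = (y \in wpim).
Proof.
case/imsetP=> z _ ->; apply/imsetP/imsetP => -[w _ E]; last first.
  by exists (z + w); rewrite // wpD E.
exists (z + w) => //; rewrite wpD -E addrA addrr2 add0r.
by [].
Qed.

(* The image of [wp] is an additive subgroup of index 2. *)
Lemma psiD x y : psi (x + y) = psi x * psi y.
Proof.
rewrite /psi; case: (boolP (x \in wpim)) => [xT|nx]; first by rewrite wpimD // mul1r.
case: (boolP (y \in wpim)) => [yT|ny]; first by rewrite addrC wpimD // (negPf nx) mulr1.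
suff -> : x + y \in wpim by rewrite mulN1r opprK.
have sub : [set x + z | z in wpim] \subset ~: wpim.
  apply/subsetP=> c /imsetP[z zT ->]; rewrite inE addrC wpimD //.
have : [set x + z | z in wpim] == ~: wpim.
  rewrite eqEcard sub card_imset; last exact: addrI.
  by have := cardsC wpim; have := card_wpim2; rewrite -/q; lia.
move/eqP/setP/(_ y); rewrite inE ny => /imsetP[z zT ->].
by rewrite addrA addrr2 add0r.
Qed.

Lemma psi_sqr x : psi (x ^+ 2) = psi x.
Proof.
have h : x ^+ 2 + x \in wpim by apply: imset_f.
by rewrite /psi -[x \in wpim](wpimD _ h) -addrA addrr2 addr0.
Qed.

Lemma sum_psi : \sum_(x : F) psi x = 0.
Proof.
rewrite (bigID (mem wpim)) /=.
rewrite (eq_bigr (fun=> 1)) => [|x xT]; last by rewrite /psi xT.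
rewrite [X in _ + X](eq_bigr (fun=> -1)) => [|x xT]; last by rewrite /psi (negPf xT).
rewrite !sumr_const; have := cardsC wpim; have := card_wpim2.
have -> : #|[pred x | x \notin wpim]| = #|~: wpim| by apply: eq_card => x; rewrite !inE.
rewrite -/q => h1 h2; have e : #|wpim| = #|~: wpim| by lia.
by rewrite mulNrn -e subrr.
Qed.

Definition psi_cube_sum : int := \sum_(x : F) psi (x ^+ 3).

Lemma psi_cube_sumE : psi_cube_sum = q%:Z - 2%:Z * (one_root_count F)%:Z.
Proof.
have e (t : F) : (t ^+ 3 \in wpim) = ~~ [forall y : F, y ^+ 2 + y + t ^+ 3 != 0].
  rewrite negb_forall; apply/imsetP/existsP => [[y _ ->]|[y]].
    by exists y; rewrite negbK /wp addrr2.
  rewrite negbK => /eqP E; exists y => //; apply: (addrI (wp y)).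
  by rewrite addrr2.
rewrite /psi_cube_sum (bigID (fun t : F => t ^+ 3 \in wpim)) /=.
rewrite (eq_bigr (fun=> 1)) => [|x xT]; last by rewrite /psi xT.
rewrite [X in _ + X](eq_bigr (fun=> -1)) => [|x xT]; last by rewrite /psi (negPf xT).
rewrite !sumr_const; pose A := [set t : F | [forall y : F, y ^+ 2 + y + t ^+ 3 != 0]].
have -> : #|[pred t : F | t ^+ 3 \in wpim]| = #|~: A| by apply: eq_card => x; rewrite !inE e.
have -> : #|[pred t : F | t ^+ 3 \notin wpim]| = #|A| by apply: eq_card => x; rewrite !inE e negbK.
have /esym := cardsC A; rewrite -/q => ->; rewrite !mulNrn !natz PoszD /one_root_count -/A.
by ring.
Qed.

(** Squaring is injective in characteristic 2, so for e != 0 the sum is that of [psi] over the whole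
    field. *)
Lemma sum_psi_sqr (e : F) : \sum_(x : F) psi (x ^+ 2 * e) = if e == 0 then q%:Z else 0.
Proof.
case: (eqVneq e 0) => [->|e0].
  rewrite (eq_bigr (fun=> 1)) => [|x _]; first by rewrite sumr_const natz.
  rewrite mulr0 /psi ifT //; apply/imsetP; exists 0 => //.
  by rewrite /wp expr0n addr0.
have inj : injective (fun x : F => x ^+ 2 * e).
  move=> x y /(mulIf e0) E; apply: (addIr y); rewrite addrr2; apply/eqP.
  rewrite -[_ == 0](expf_eq0 _ 2) /=; apply/eqP.
  transitivity (x ^+ 2 + y ^+ 2 + 2%:R * x * y); first by ring.
  by rewrite E addrr2 char2 !mul0r addr0.
by rewrite -[RHS]sum_psi [RHS](reindex_inj inj).
Qed.

(* psi (x^3 + (x + a)^3) = psi (a^3) psi (x^2 (a + a^4)), so only the four roots of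
   a^4 = a contribute to the square. *)
Lemma psi_cube_sum_sqr : (q %% 3 = 1)%N -> psi_cube_sum ^+ 2 = 4%:Z * q%:Z.
Proof.
move=> q1; rewrite expr2 /psi_cube_sum big_distrl /=.
transitivity (\sum_(x : F) \sum_(a : F) psi (x ^+ 3) * psi ((x + a) ^+ 3)).
  by apply: eq_bigr => x _; rewrite big_distrr /= (reindex_inj (addrI x)).
rewrite exchange_big /=.
transitivity (\sum_(a : F) psi (a ^+ 3) * \sum_(x : F) psi (x ^+ 2 * (a + a ^+ 4))).
  apply: eq_bigr => a _; rewrite big_distrr; apply: eq_bigr => x _ /=.
  rewrite -psiD.
  have -> : x ^+ 3 + (x + a) ^+ 3 = a ^+ 3 + (x ^+ 2 * a + x * a ^+ 2).
    transitivity (a ^+ 3 + (x ^+ 2 * a + x * a ^+ 2)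
       + 2%:R * (x ^+ 3 + x ^+ 2 * a + x * a ^+ 2)); first by ring.
    by rewrite char2 mul0r addr0.
  rewrite psiD; congr (_ * _); rewrite mulrDr !psiD; congr (_ * _).
  (* Invariance under squaring trades x a^2 for x^2 a^4, making the sum over [x] one of the type of
     [sum_psi_sqr]. *)
  by rewrite -[LHS]psi_sqr; congr psi; ring.
under eq_bigr => a _ do rewrite sum_psi_sqr.
have [w Ew] := cube_root_unity q1.
(* A primitive cube root of unity satisfies w^2 + w = 1 here, so 1 lies in the image of [wp]. *)
have psi1 : psi 1 = 1.
  rewrite /psi ifT //; apply/imsetP; exists w => //; apply: (addrI (wp w)).
  by rewrite addrr2 -Ew.
have psi0 : psi 0 = 1.
  by rewrite /psi ifT //; apply/imsetP; exists 0 => //; rewrite /wp expr0n addr0.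
rewrite (bigD1 0) //= expr0n psi0 mul1r expr0n addr0 eqxx.
rewrite (bigID (fun a : F => a ^+ 3 == 1)) /= [X in _ + (_ + X)]big1 ?addr0.
  rewrite (eq_bigr (fun=> q%:Z)) => [|a /andP[a0 /eqP a1]].
    rewrite sumr_const.
    have -> : #|[pred a : F | (a != 0) && (a ^+ 3 == 1)]| = 3%N.
      apply: etrans (card_cube_roots1 q1); apply: eq_card => a; rewrite !inE.
      apply/andP/eqP => [[_ /eqP] //|E]; rewrite E eqxx; split=> //.
      by apply: contra_eq_neq E => ->; rewrite expr0n eq_sym oner_neq0.
    by rewrite -mulr_natl natz; ring.
  rewrite a1 psi1 mul1r exprSr a1 mul1r addrr2 eqxx.
  by [].
move=> a /andP[a0 a1]; rewrite ifN ?mulr0 //.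
have -> : a + a ^+ 4 = a * (1 + a ^+ 3) by ring.
rewrite mulf_neq0 //; apply: contra_neq a1 => E; apply: (addrI 1).
by rewrite E addrr2.
Qed.

Lemma psi_cube_sum_mod3 : (q %% 3 = 1)%N -> exists k : int, psi_cube_sum = 1 + 3%:Z * k.
Proof.
move=> q1; exists (\sum_(s in [set k ^+ 3 | k in predC1 (0 : F)]) psi s).
rewrite /psi_cube_sum (bigD1 0) //=; congr (_ + _).
  by rewrite expr0n /psi ifT //; apply/imsetP; exists 0 => //; rewrite /wp expr0n addr0.
rewrite (partition_big (fun k : F => k ^+ 3) (mem [set k ^+ 3 | k in predC1 (0 : F)])) /=.
  rewrite big_distrr; apply: eq_bigr => s /imsetP[k k0 ->] /=; rewrite inE in k0.
  rewrite (eq_bigr (fun=> psi (k ^+ 3))) => [|x /andP[_ /eqP->]] //.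
  rewrite sumr_const -mulr_natl natz; congr (Posz _ * _).
  apply: etrans (card_cube_roots1 q1); rewrite -[RHS](card_imset _ (mulfI k0)); apply: eq_card => x.
  rewrite unfold_in /=; apply/andP/imsetP => [[x0 /eqP E]|[w]].
    exists (x / k); last by rewrite mulrC divfK.
    by rewrite inE expr_div_n E divff // expf_neq0.
  rewrite inE => /eqP w1 ->; rewrite exprMn w1 mulr1 eqxx mulf_neq0 //.
  by apply: contra_eq_neq w1 => ->; rewrite expr0n eq_sym oner_neq0.
by move=> k k0; apply: imset_f.
Qed.

(* The square fixes the sum up to sign, and the sum is 1 modulo 3 because cubing is
   3-to-1 on nonzero elements. *)
Lemma one_root_count_even m : q = (2 ^ (2 * m))%N -> (q %% 3 = 1)%N ->
  2%:Z * (one_root_count F)%:Z = q%:Z + 2%:Z * (-2) ^+ m.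
Proof.
move=> Eq q1; have S2 := psi_cube_sum_sqr q1; have [k Sk] := psi_cube_sum_mod3 q1.
have S3 := psi_cube_sumE.
have [j Ej] : exists j : int, (-2) ^+ m.+1 = 1 + 3%:Z * j.
  elim: m {Eq} => [|m [j Ej]]; first by exists (-1).
  by exists (-1 - 2%:Z * j); rewrite exprS Ej; ring.
have sq : psi_cube_sum ^+ 2 = ((-2) ^+ m.+1) ^+ 2.
  rewrite S2 Eq -[RHS]exprM (mulnC m.+1) [RHS]exprM [RHS]exprS; congr (_ * _).
  by rewrite expnM -natz natrX.
have Se : psi_cube_sum = (-2) ^+ m.+1.
  move/eqP: sq; rewrite eqf_sqr => /orP[/eqP//|/eqP E].
  by move: E; rewrite Sk Ej; lia.
move: S3; rewrite Se exprS => S3.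
have -> : 2%:Z * (one_root_count F)%:Z = q%:Z - (q%:Z - 2%:Z * (one_root_count F)%:Z) by ring.
by rewrite -S3; ring.
Qed.

End Char2.
End FieldCounts.

(** * The parameters *)

Section Values.
Variable F : finFieldType.
Hypothesis char_neq3 : 3%:R != 0 :> F.
Hypothesis card_ge5 : (5 <= #|F|)%N.
Let q := #|F|.
Let K := #|[set w : F | w ^+ 3 == 1]|.

(* The order of the stabiliser of a point of the given type in PGL(2, q). *)
Definition stab_order p : nat :=
  match p with pT => q.-1 | p3G => 6%N | p1G => 2%N | p0G => 3%N end.

(** Both the type size times [stab_order p] and |O_L| times K (n + 1) equal q (q + 1) (q - 1);
    comparing them with the incidence count leaves this relation. *)
Lemma Lcount_eq p (P : 'M[F]_4) : isPtype p P ->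
  (Lcount P * (K * (double_root_count F).+1) = stab_order p * Pcount (isPtype p) (lineL F))%N.
Proof.
move=> tP; have q1 : (0 < q.-1)%N by rewrite -ltnS prednK //; exact: leq_trans card_ge5.
have [sT s3 s1 s0] := ptype_set_sizes char_neq3 card_ge5.
have [PT _ _ _] := Pcount_lineL_rel char_neq3 card_ge5.
have size_p : (stab_order p * #|ptype_set F p| = q * q.+1 * q.-1)%N.
  case: p tP => _ /=; first by rewrite sT mulnC.
  - by rewrite s3 [(_.+1 * _)%N]mulnC.
  - by rewrite s1 [(_.+1 * _)%N]mulnC.
  by rewrite s0 [(_.+1 * _)%N]mulnC.
(* The T-points give the orbit size: there are q (q + 1) of them, each on as many orbit lines as
   there are nonzero cubes, namely (q - 1) / K. *)
have orbit_size : (#|orbitL F| * (K * (double_root_count F).+1) = q * q.+1 * q.-1)%N.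
  have tT : isPtype pT (Lpt (None : option F)).
    rewrite isPtypeE // Lpt_points nroots_normal_form ?oner_eq0 ?eqxx //= andbT.
    by apply/negP=> /lineL_cubic; rewrite sub_lineL !eqxx.
  have := incidence_count char_neq3 card_ge5 tT; have := card_cubes F.
  rewrite PT sT Lcount_T0 // -/q -/K => EC EI.
  by rewrite -EC [(K * _)%N]mulnC mulnA -EI mulnA.
have n0 : (0 < #|ptype_set F p|)%N.
  have q0 : (0 < q)%N by exact: leq_trans card_ge5.
  have : (0 < q * q.+1 * q.-1)%N by rewrite !muln_gt0 q1 q0.
  by rewrite -size_p muln_gt0 => /andP[].
apply/eqP; rewrite -(eqn_pmul2l n0); apply/eqP.
rewrite mulnA (incidence_count char_neq3 card_ge5 tP).
transitivity (#|orbitL F| * (K * (double_root_count F).+1) * Pcount (isPtype p) (lineL F))%N; first by ring.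
by rewrite orbit_size -size_p; ring.
Qed.

Lemma hasValuesI (vP vL : ptype -> rat) :
  (forall p, (Pcount (isPtype p) (lineL F))%:R = vP p) ->
  (forall p, vL p * (K * (double_root_count F).+1)%:R = (stab_order p)%:R * vP p) ->
  hasValues F vP vL.
Proof.
move=> EP EL; have K0 : (K * (double_root_count F).+1)%:R != 0 :> rat.
  rewrite pnatr_eq0 -lt0n muln_gt0 andbT; apply/card_gt0P; exists 1.
  by rewrite inE expr1n.
have vLE p (P : 'M[F]_4) : isPtype p P -> (Lcount P)%:R = vL p.
  by move=> tP; apply: (mulIf K0); rewrite EL -EP -!natrM (Lcount_eq tP).
split; first by move=> p l lO; rewrite Picount_orbit // Pcount_orbit // EP.
split=> [p P _|p pi pp]; first exact: vLE.
have [P Pp ->] := plane_polar char_neq3 pp.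
by rewrite isPlaneType_polar // Lambdacount_polar //; apply: vLE.
Qed.

Lemma Pcount_values : let P p : rat := (Pcount (isPtype p) (lineL F))%:R in
  [/\ P pT = (double_root_count F)%:R + 1, P p1G = (one_root_count F)%:R,
      3%:R * P p3G = q%:R + 1 - 2%:R * ((double_root_count F)%:R + 1) - (one_root_count F)%:R &
      3%:R * P p0G = 2%:R * (q%:R + 1) - ((double_root_count F)%:R + 1) - 2%:R * (one_root_count F)%:R].
Proof.
move=> P; have [e1 e2 e3 e4] := Pcount_lineL_rel char_neq3 card_ge5.
have f1 : P pT = (double_root_count F)%:R + 1 by rewrite /P e1 -natr1.
have f2 : P p1G = (one_root_count F)%:R by rewrite /P e2.
have f3 : 3%:R * P p3G + 2%:R * P pT + P p1G = q%:R + 1.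
  by rewrite /P -!natrM -!natrD e3 natr1.
have f4 : P p3G + P pT + P p1G + P p0G = q%:R + 1 by rewrite /P -!natrD e4 natr1.
by rewrite f1 f2 in f3 f4; split=> //; lra.
Qed.

End Values.

Theorem theorem4p7 (F : finFieldType) (q : nat) (xi : int) :
  #|F| = q -> (5 <= q)%N -> (xi = 1 \/ xi = -1) -> (q%:Z = xi %[mod 3])%Z ->
  (* Pi_Gamma = Lambda_Gamma = P_C = L_C = 0 *)
  (forall l : 'M[F]_4, l \in orbitL F ->
     Picount (fun pi => isGammaPlane pi) l = 0%N /\ Pcount (fun P => isCPoint P) l = 0%N)
  /\ (forall pi : 'M[F]_4, isGammaPlane pi -> Lambdacount pi = 0%N)
  /\ (forall P : 'M[F]_4, isCPoint P -> Lcount P = 0%N)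
  (* (1) q odd, xi = -1 *)
  /\ (odd q -> xi = -1 ->
       hasValues F
         (fun p => match p with
                   | pT => 2 | p3G => (q%:R - 5) / 6%:R
                   | p1G => (q%:R - 1) / 2%:R | p0G => (q%:R + 1) / 3%:R end)
         (fun p => match p with
                   | pT => q%:R - 1 | p3G => (q%:R - 5) / 2%:R
                   | p1G => (q%:R - 1) / 2%:R | p0G => (q%:R + 1) / 2%:R end))
  (* (2) q = 2^(2m+1) *)
  /\ (forall m : nat, q = (2 ^ (2 * m + 1))%N ->
       hasValues F
         (fun p => match p with
                   | pT => 1 | p3G => (q%:R - 2) / 6%:R
                   | p1G => q%:R / 2%:R | p0G => (q%:R + 1) / 3%:R end)
         (fun p => match p with
                   | pT => q%:R - 1 | p3G => q%:R - 2
                   | p1G => q%:R | p0G => q%:R + 1 end))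
  (* (3) q odd, xi = 1, 2 a non-cube *)
  /\ (odd q -> xi = 1 -> ~ (exists x : F, x ^+ 3 = 2%:R) ->
       hasValues F
         (fun p => match p with
                   | pT => 1 | p3G => (q%:R - 1 - (Nq F)%:R) / 3%:R
                   | p1G => (Nq F)%:R
                   | p0G => (2%:R * q%:R + 1 - 2%:R * (Nq F)%:R) / 3%:R end)
         (fun p => match p with
                   | pT => (q%:R - 1) / 3%:R
                   | p3G => 2%:R / 3%:R * (q%:R - 1 - (Nq F)%:R)
                   | p1G => 2%:R / 3%:R * (Nq F)%:R
                   | p0G => (2%:R * q%:R + 1 - 2%:R * (Nq F)%:R) / 3%:R end))
  (* (4) q odd, xi = 1, 2 a cube *)
  /\ (odd q -> xi = 1 -> (exists x : F, x ^+ 3 = 2%:R) ->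
       hasValues F
         (fun p => match p with
                   | pT => 4%:R | p3G => (q%:R - 7 - (Nq F)%:R) / 3%:R
                   | p1G => (Nq F)%:R
                   | p0G => 2%:R / 3%:R * (q%:R - 1 - (Nq F)%:R) end)
         (fun p => match p with
                   | pT => (q%:R - 1) / 3%:R
                   | p3G => (q%:R - 7 - (Nq F)%:R) / 6%:R
                   | p1G => (Nq F)%:R / 6%:R
                   | p0G => (q%:R - 1 - (Nq F)%:R) / 6%:R end))
  (* (5) q = 2^(2m) *)
  /\ (forall m : nat, q = (2 ^ (2 * m))%N ->
       hasValues F
         (fun p => match p with
                   | pT => 1
                   | p3G => 1 / 3%:R * (q%:R / 2%:R - 1 - (-2) ^+ m)
                   | p1G => q%:R / 2%:R + (-2) ^+ m
                   | p0G => 1 / 3%:R * (q%:R + 1 + (-2) ^+ m.+1) end)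
         (fun p => match p with
                   | pT => (q%:R - 1) / 3%:R
                   | p3G => 2%:R / 3%:R * (q%:R / 2%:R - 1 - (-2) ^+ m)
                   | p1G => 2%:R / 3%:R * (q%:R / 2%:R + (-2) ^+ m)
                   | p0G => 1 / 3%:R * (q%:R + 1 + (-2) ^+ m.+1) end)).
Proof.
move=> Eq; subst q; set q := #|F| => q5 hxi hmod.
have [m1 m2] : (xi = 1 -> (q %% 3 = 1)%N) /\ (xi = -1 -> (q %% 3 = 2)%N).
  by split=> E; move: hmod; rewrite E; lia.
have c3 : 3%:R != 0 :> F.
  by apply: char_neq3_mod; case: hxi => [/m1|/m2] h; [left | right].
have pred_q : (q.-1)%:R = q%:R - 1 :> rat.
  by rewrite -subn1 natrB //; apply: leq_trans q5.
have [vT v1 v3 v0] := Pcount_values c3 q5; rewrite -/q in v3 v0.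
(* Each case supplies three numbers; the remaining hypotheses are free of division by unknowns and
   become rational identities closed by [field]. *)
have finish nTv n1v Kv vP vL : double_root_count F = nTv -> (one_root_count F)%:R = n1v ->
    #|[set w : F | w ^+ 3 == 1]| = Kv ->
    vP pT = nTv%:R + 1 -> vP p1G = n1v ->
    3%:R * vP p3G = q%:R + 1 - 2%:R * (nTv%:R + 1) - n1v ->
    3%:R * vP p0G = 2%:R * (q%:R + 1) - (nTv%:R + 1) - 2%:R * n1v ->
    vL pT * (Kv * nTv.+1)%:R = (q%:R - 1) * vP pT ->
    vL p3G * (Kv * nTv.+1)%:R = 6%:R * vP p3G ->
    vL p1G * (Kv * nTv.+1)%:R = 2%:R * vP p1G ->
    vL p0G * (Kv * nTv.+1)%:R = 3%:R * vP p0G -> hasValues F vP vL.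
  move=> EnT En1 EK wT w1 w3 w0 lT l3 l1 l0; rewrite EnT En1 in vT v1 v3 v0.
  apply: (hasValuesI c3 q5); rewrite ?EK ?EnT; last by case; rewrite //= pred_q.
  by case; [rewrite wT | apply: (mulfI (_ : 3%:R != 0 :> rat)); rewrite ?v3 ?w3
           | rewrite w1 | apply: (mulfI (_ : 3%:R != 0 :> rat)); rewrite ?v0 ?w0].
split; [|split; [|split]].
- move=> l lO; split; apply/eqP; rewrite cards_eq0 -subset0; apply/subsetP=> A /setIdP[_ /andP[]].
    case/imsetP=> o _ ->; rewrite -polar_Cpt sub_polarC (polar_orbit c3 q5 lO) => h.
    by case/negP: (orbit_cubic lO (Cpt_cubic o)).
  by move=> Ac Al; case/negP: (orbit_cubic lO Ac).
- move=> pi /imsetP[o _ ->]; apply/eqP; rewrite cards_eq0 -subset0; apply/subsetP=> l /setIdP[lO].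
  rewrite -polar_Cpt sub_polarC (polar_orbit c3 q5 lO) => h.
  by case/negP: (orbit_cubic lO (Cpt_cubic o)).
- move=> P Pc; apply/eqP; rewrite cards_eq0 -subset0; apply/subsetP=> l /setIdP[lO Pl].
  by case/negP: (orbit_cubic lO Pc).
split; [|split; [|split; [|split]]].
- move=> oq /m2 q2; have n2 := char_neq2_odd oq.
  have E1 : (one_root_count F)%:R = (q%:R - 1) / 2%:R :> rat.
    by rewrite -pred_q -(one_root_count_inj_odd q2 n2) natrM; field.
  by apply: (finish 1%N _ 1%N _ _ (double_root_count_inj q2 n2) E1 (card_cube_roots1_inj q2)) => /=; field.
- move=> m Em; have z2 := char2_pow Em.
  have q2 : (q %% 3 = 2)%N.
    rewrite Em; elim: m {Em} => [//|m IH].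
    by rewrite mulnS -addnA expnD -modnMmr IH.
  have E1 : (one_root_count F)%:R = q%:R / 2%:R :> rat.
    by rewrite {1}/q -(one_root_count_inj_even z2 q2) natrM; field.
  by apply: (finish 0%N _ 1%N _ _ (double_root_count_char2 z2) E1 (card_cube_roots1_inj q2)) => /=; field.
- move=> oq /m1 q1 nc; have n2 := char_neq2_odd oq.
  have E1 : (one_root_count F)%:R = (Nq F)%:R :> rat by rewrite one_root_count_Nq.
  by apply: (finish 0%N _ 3%N _ _ (double_root_count_noncube n2 nc) E1 (card_cube_roots1 q1)) => /=; field.
- move=> oq /m1 q1 cb; have n2 := char_neq2_odd oq.
  have E1 : (one_root_count F)%:R = (Nq F)%:R :> rat by rewrite one_root_count_Nq.
  by apply: (finish 3%N _ 3%N _ _ (double_root_count_cube q1 n2 cb) E1 (card_cube_roots1 q1)) => /=; field.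
move=> m Em; have z2 := char2_pow Em.
have q1 : (q %% 3 = 1)%N.
  rewrite Em; elim: m {Em} => [//|m IH].
  by rewrite mulnS expnD -modnMmr IH.
have E1 : (one_root_count F)%:R = q%:R / 2%:R + (-2) ^+ m :> rat.
  have /(congr1 (fun z : int => z%:~R : rat)) := one_root_count_even z2 Em q1.
  rewrite !rmorphD !rmorphM rmorphXn /= -!pmulrn => E.
  have n2 : 2%:R != 0 :> rat by [].
  by apply: (mulfI n2); rewrite E; field.
by apply: (finish 0%N _ 3%N _ _ (double_root_count_char2 z2) E1 (card_cube_roots1 q1)) => /=;
  rewrite ?exprS; field.
Qed.
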